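(* Let $N,s,m\ge1$ be integers and let $q_1,\dots,q_m\in\mathbb{C}\langle\mathbf{x}_1,\dots,\mathbf{x}_s\rangle$ be non-commutative monomials of degrees $n_1,\dots,n_m\ge1$. If $\mathbf{W}_1\in\mathcal{W}_N(\frac1N\mathbf{C}_1,N\lambda_1),\dots,\mathbf{W}_s\in\mathcal{W}_N(\frac1N\mathbf{C}_s,N\lambda_s)$ are independent, then the following identity of formal power series in $\mathbf{u}=(u_1,\dots,u_m)$ holds: $$\frac{1}{N^2}\widetilde{\ln Z}_N(\mathbf{u})=\sum_{g\ge0}\frac{1}{N^{2g}}\sum_{k_1+\dots+k_m\ge1}\frac{(-\mathbf{u})^{\mathbf{k}}}{\mathbf{k}!}\,c(\mathbf{k},g,\mathbf{C}),$$ where $$c(\mathbf{k},g,\mathbf{C})=\sum_{(V,E,F)\in\mathcal{H}(g,\mathbf{k})}\ \prod_{r=1}^s\lambda_r^{\#V_r}\prod_{f\in F}\mathrm{tr}_N\mathbf{C}^{f,t}.$$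
   Context: Complex Wishart law: let $\Sigma$ be an $N\times N$ Hermitian positive-definite matrix (i.e. $x^*\Sigma x>0$ for all non-zero $x\in\mathbb{C}^N$), and let $p\in\{1,2,\dots,N\}\cup(N,\infty)$. A random $N\times N$ Hermitian matrix $\mathbf{W}$ has the complex Wishart law with shape parameter $p$ and scale parameter $\Sigma$, written $\mathbf{W}\in\mathcal{W}_N(\Sigma,p)$, if $$E\big(\exp(\mathrm{tr}(\theta\mathbf{W}))\big)=(\det(I-\theta\Sigma))^{-p}$$ for all Hermitian matrices $\theta$ such that $\Sigma^{-1}-\theta$ is positive-definite. (Thus in the claim each $\mathbf{C}_r$ is an $N\times N$ Hermitian positive-definite matrix and $N\lambda_r$ is an admissible shape parameter.) $\mathrm{tr}$ is the unnormalized trace and $\mathrm{tr}_N=\frac1N\mathrm{tr}$. Multi-index notation: $\mathbf{k}=(k_1,\dots,k_m)$ with integers $k_j\ge0$, $\mathbf{k}!=k_1!\cdots k_m!$, $(-\mathbf{u})^{\mathbf{k}}=(-u_1)^{k_1}\cdots(-u_m)^{k_m}$. A monomial is a word $\mathbf{x}_{i_1}\mathbf{x}_{i_2}\cdots\mathbf{x}_{i_n}$ (coefficient $1$). Formal series: define the formal power series $$\widetilde{Z}_N(\mathbf{u})=\sum_{k_1,\dots,k_m\ge0}N^{k_1+\dots+k_m}\frac{(-\mathbf{u})^{\mathbf{k}}}{\mathbf{k}!}E\Big(\prod_{j=1}^m\big(\mathrm{tr}\,q_j(\mathbf{W}_1,\dots,\mathbf{W}_s)\big)^{k_j}\Big),$$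 whose constant term is $1$, and let $\widetilde{\ln Z}_N(\mathbf{u})=\widetilde{L}(\widetilde{Z}_N(\mathbf{u})-1)$ be the composition of formal power series with $\widetilde{L}(z)=\sum_{n\ge1}(-1)^{n+1}\frac{z^n}{n}$. Hypermaps: for a permutation $\pi$, $\mathcal{C}(\pi)$ denotes its set of cycles (including fixed points), and products of permutations are compositions, $\sigma\alpha=\sigma\circ\alpha$. A hypermap is an ordered pair $(\sigma,\alpha)\in\mathcal{S}_n\times\mathcal{S}_n$ such that the group $\langle\sigma,\alpha\rangle$ acts transitively on $\{1,\dots,n\}$. Its genus $g$ is the non-negative integer defined by $$\#\mathcal{C}(\alpha)+\#\mathcal{C}(\sigma)+\#\mathcal{C}(\sigma\alpha)=n+2-2g.$$ Given $\mathbf{k}$ with $k_1+\dots+k_m\ge1$, list the monomials $(Q_1,\dots,Q_\ell)=(q_1,\dots,q_1,q_2,\dots,q_2,\dots,q_m,\dots,q_m)$, where $q_j$ is repeated $k_j$ times and $\ell=k_1+\dots+k_m$. Let $n=n_{\mathbf{k}}=k_1n_1+\dots+k_mn_m$ be the degree of the product $Q_1Q_2\cdots Q_\ell$, and let $t=t_{\mathbf{k}}:\{1,\dots,n\}\to\{1,\dots,s\}$ be such that the $j$-th letter of the word $Q_1Q_2\cdots Q_\ell$ is $\mathbf{x}_{t(j)}$. Let $\sigma=\sigma_{\mathbf{k}}\in\mathcal{S}_n$ be the permutation with $\ell$ cycles of consecutive integers $$\sigma=(1,\dots,d_1)(d_1+1,\dots,d_1+d_2)\cdots(d_1+\dots+d_{\ell-1}+1,\dots,d_1+\dots+d_\ell),\qquad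 d_i=\deg Q_i.$$ $\mathcal{H}(g,\mathbf{k})$ (hypermaps of genus $g$ with $k_j$ stars of type $q_j$, $j=1,\dots,m$) is the set of all hypermaps $(\sigma,\alpha)$ of genus $g$ in which $\sigma$ is fixed to be the permutation $\sigma_{\mathbf{k}}=(1,\dots,d_1)(d_1+1,\dots,d_1+d_2)\cdots(d_1+\dots+d_{\ell-1}+1,\dots,d_1+\dots+d_\ell)$ and $\alpha\in\mathcal{S}_n$ is color-preserving, i.e. $t\circ\alpha=t$. A hypermap $(\sigma,\alpha)\in\mathcal{H}(g,\mathbf{k})$ is identified with a bipartite map $(V,E,F)$, where $V=V_0\cup\bigcup_{r=1}^sV_r$, $V_0=\mathcal{C}(\sigma)$, $V_r$ is the set of cycles of $\alpha$ contained in $t^{-1}(r)$ for $r=1,\dots,s$, $E=\{1,\dots,n\}$, and $F=\mathcal{C}(\sigma\alpha)$. The sum defining $c(\mathbf{k},g,\mathbf{C})$ is thus over all such pairs $(\sigma,\alpha)$. If $f\in F$ is the face corresponding to the cycle $(j_1,j_2,\dots,j_k)$ of $\sigma\alpha$ (so $j_{i+1}=\sigma\alpha(j_i)$), then $\mathrm{tr}_N\mathbf{C}^{f,t}=\frac1N\mathrm{tr}\big(\mathbf{C}_{t(j_1)}\mathbf{C}_{t(j_2)}\cdots\mathbf{C}_{t(j_k)}\big)$. *)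

(* Defs.v *)
From HB Require Import structures.
From mathcomp Require Import all_boot all_order all_algebra all_fingroup.
From mathcomp Require Import complex.
From mathcomp Require Import all_classical all_reals all_analysis.

Set Implicit Arguments.
Unset Strict Implicit.
Unset Printing Implicit Defensive.

Import Order.TTheory GRing.Theory Num.Theory.

Local Open Scope ring_scope.
Local Open Scope complex_scope.
Local Open Scope sesquilinear_scope.

(** Formal power series in [m] commuting indeterminates, as coefficient
    families.  Univariate series are sequences [nat -> K]. *)

Definition mindex (m : nat) := {ffun 'I_m -> nat}.

Definition mdeg m (k : mindex m) : nat := (\sum_j k j)%N.

Lemma leq_mdeg m (k : mindex m) (j : 'I_m) : (k j <= mdeg k)%N.
Proof. by rewrite /mdeg (bigD1 j) //= leq_addr. Qed.

Definition mfact m (k : mindex m) : nat := (\prod_j (k j)`!)%N.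

Definition fps (K : Type) (m : nat) := mindex m -> K.

Section FormalPowerSeries.
Variables (K : comNzRingType) (m : nat).
Implicit Types f g h : fps K m.

Definition fps_one : fps K m := fun k => (mdeg k == 0%N)%:R.

Definition fps_sub f g : fps K m := fun k => f k - g k.

Definition fps_scale (a : K) f : fps K m := fun k => a * f k.

(* Two multi-indices adding up to [k] have all their entries at most
   [mdeg k], so the range below contains every decomposition of [k]. *)
Definition fps_mul f g : fps K m := fun k =>
  \sum_(ab : {ffun 'I_m -> 'I_(mdeg k).+1} * {ffun 'I_m -> 'I_(mdeg k).+1}
         | [forall j, (ab.1 j + ab.2 j == k j)%N])
     f [ffun j => nat_of_ord (ab.1 j)] * g [ffun j => nat_of_ord (ab.2 j)].

Definition fps_exp f (n : nat) : fps K m := iter n (fps_mul f) fps_one.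

(* The sum of a sequence of series, each coefficient of which is nonzero in
   finitely many terms only: [\sum_(n \in _)] is the finitely supported sum
   (and is 0 on infinite supports). *)
Definition fps_sum (F : nat -> fps K m) : fps K m :=
  fun k => \sum_(n \in [set: nat]%classic) F n k.

Definition fps_comp (L : nat -> K) f : fps K m :=
  fps_sum (fun n => fps_scale (L n) (fps_exp f n)).

(* When [f] has no constant term, all terms of [fps_comp L f] of index
   greater than [mdeg k] vanish at [k]. *)
Lemma fps_exp_small f (n : nat) (k : mindex m) :
  f [ffun=> 0%N] = 0 -> (mdeg k < n)%N -> fps_exp f n k = 0.
Proof.
move=> f0; elim: n k => // n IHn k ltkn.
rewrite /fps_exp iterS -/(fps_exp f n) /fps_mul big1 // => -[a b] /= /forallP ab.
have defk : mdeg k = (mdeg [ffun j => nat_of_ord (a j)]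
                      + mdeg [ffun j => nat_of_ord (b j)])%N.
  rewrite /mdeg -big_split /=; apply: eq_bigr => j _.
  by rewrite !ffunE -(eqP (ab j)).
have [a0|a0] := posnP (mdeg [ffun j => nat_of_ord (a j)]); last first.
  have ltbk : (mdeg [ffun j => nat_of_ord (b j)] < mdeg k)%N.
    by rewrite [X in (_ < X)%N]defk -[X in (X < _)%N]add0n ltn_add2r.
  by rewrite IHn ?mulr0 // (leq_trans ltbk) // -ltnS.
have -> : [ffun j => nat_of_ord (a j)] = [ffun=> 0%N].
  apply/ffunP => j; apply/eqP; rewrite [X in _ == X]ffunE -leqn0 -a0.
  exact: leq_mdeg.
by rewrite f0 mul0r.
Qed.

End FormalPowerSeries.

Definition fps_ln1p {F : fieldType} : nat -> F :=
  fun n => if n == 0%N then 0 else (-1) ^+ n.+1 / n%:R.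

(** Random Hermitian matrices. *)

Definition posdefmx (R : rcfType) n (A : 'M[R[i]]_n) : Prop :=
  A \is hermsymmx /\
  forall x : 'cV[R[i]]_n, x != 0 -> 0 < (x ^t* *m A *m x) 0 0.

Local Open Scope classical_set_scope.

(* The Borel sigma-algebra of the space of complex matrices. *)
Definition mx_borel (R : realType) n : set (set 'M[R[i]]_n) :=
  <<s [set A | exists (i j : 'I_n) (B : set R), measurable B /\
        (A = [set M : 'M[R[i]]_n | B (complex.Re (M i j))] \/
         A = [set M : 'M[R[i]]_n | B (complex.Im (M i j))])] >>.

Section Random.
Context (R : realType) (d : measure_display) (T : measurableType d).
Variable P : probability T R.

Definition random_hermitian n (W : T -> 'M[R[i]]_n) : Prop :=
  (forall A, mx_borel A -> measurable (W @^-1` A)) /\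
  forall w, W w \is hermsymmx.

Definition wishart_shape (n : nat) (p : R) : Prop :=
  (exists2 k : nat, (1 <= k <= n)%N & p = k%:R) \/ n%:R < p.

(* For Hermitian [theta] and [W w], the trace below is real; and
   [\det (1 - theta * Sigma) = \det (Sigma^-1 - theta) * \det Sigma] is real
   and positive. *)
Definition wishart n (Sigma : 'M[R[i]]_n) (p : R) (W : T -> 'M[R[i]]_n) : Prop :=
  [/\ posdefmx Sigma, wishart_shape n p, random_hermitian W &
   forall theta : 'M[R[i]]_n, theta \is hermsymmx ->
     posdefmx (invmx Sigma - theta) ->
     'E_P[fun w => expR (complex.Re (\tr (theta *m W w)))]%E
       = ((complex.Re (\det (1%:M - theta *m Sigma))) `^ (- p))%:E].

Definition mutually_independent n (I : finType) (W : I -> T -> 'M[R[i]]_n) : Prop :=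
  forall (J : {set I}) (A : I -> set 'M[R[i]]_n),
    (forall r, r \in J -> mx_borel (A r)) ->
    P (\bigcap_(r in [set` J]) (W r @^-1` A r))
      = (\prod_(r in J) P (W r @^-1` A r))%E.

Definition complex_expectation (X : T -> R[i]) : R[i] :=
  fine 'E_P[fun w => complex.Re (X w)]%E +i* fine 'E_P[fun w => complex.Im (X w)]%E.

End Random.

Local Close Scope classical_set_scope.

(** A monomial in non-commuting variables [x_r], [r : 'I_s], is the word of its
    letters. *)

Definition mx_word (K : pzRingType) n s (A : 'I_s -> 'M[K]_n) (q : seq 'I_s) :
    'M[K]_n :=
  \big[mulmx/1%:M]_(r <- q) A r.

Definition partition_series (R : realType) d (T : measurableType d)
    (P : probability T R) (N s m : nat) (q : 'I_m -> seq 'I_s)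
    (W : 'I_s -> T -> 'M[R[i]]_N) : fps R[i] m :=
  fun k => N%:R ^+ mdeg k * ((-1) ^+ mdeg k / (mfact k)%:R)
    * complex_expectation P
        (fun w => \prod_j (\tr (mx_word (fun r => W r w) (q j))) ^+ k j).

Definition log_partition_series (R : realType) d (T : measurableType d)
    (P : probability T R) (N s m : nat) (q : 'I_m -> seq 'I_s)
    (W : 'I_s -> T -> 'M[R[i]]_N) : fps R[i] m :=
  fps_comp fps_ln1p (fps_sub (partition_series P q W) (@fps_one R[i] m)).

(** Hypermaps.  The product [alpha * sigma] of permutations applies [alpha]
    first: it is the composition [sigma \o alpha]. *)

Definition hypermap n (sigma alpha : 'S_n) : bool :=
  [transitive <<[set sigma; alpha]>>%g, on [set: 'I_n] | 'P].

Definition has_genus n (sigma alpha : 'S_n) (g : nat) : bool :=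
  (#|porbits alpha| + #|porbits sigma| + #|porbits (alpha * sigma)%g| + 2 * g
     == n + 2)%N.

Section Stars.

(* The permutation of [{0, ..., sumn ds - 1}] whose cycles are the consecutive
   blocks of lengths [ds]: it moves every point to the next one of its block,
   cyclically. *)
Definition block_next (ds : seq nat) (i : nat) : nat :=
  flatten_index ds (reshape_index ds i)
    ((reshape_offset ds i).+1 %% nth 0 ds (reshape_index ds i)).

Lemma block_next_offset (ds : seq nat) (i : nat) : (i < sumn ds)%N ->
  ((reshape_offset ds i).+1 %% nth 0 ds (reshape_index ds i)
    < nth 0 ds (reshape_index ds i))%N.
Proof. by move=> /reshape_offsetP lti; rewrite ltn_mod (leq_ltn_trans _ lti). Qed.

Definition block_next_ord (ds : seq nat) (i : 'I_(sumn ds)) : 'I_(sumn ds) :=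
  Ordinal (flatten_indexP (block_next_offset (ltn_ord i))).

Lemma block_next_ord_inj (ds : seq nat) : injective (@block_next_ord ds).
Proof.
move=> i1 i2 /(congr1 val) /= eq12; apply: val_inj => /=.
have lt1 := block_next_offset (ltn_ord i1).
have lt2 := block_next_offset (ltn_ord i2).
have eqr : reshape_index ds i1 = reshape_index ds i2.
  by have := congr1 (reshape_index ds) eq12; rewrite !flatten_indexKl.
have := congr1 (reshape_offset ds) eq12; rewrite !flatten_indexKr // -eqr => eqc.
rewrite -[LHS](reshape_indexK ds) -[RHS](reshape_indexK ds) -eqr; congr flatten_index.
have o1 := reshape_offsetP (ltn_ord i1).
have := reshape_offsetP (ltn_ord i2); rewrite -eqr => o2.
apply/eqP; rewrite -(modn_small o1) -(modn_small o2) -(eqn_modDr 1) !addn1.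
exact/eqP.
Qed.

Definition block_perm (ds : seq nat) : 'S_(sumn ds) :=
  perm (@block_next_ord_inj ds).

Variables (s m : nat) (q : 'I_m -> seq 'I_s) (k : mindex m).

Definition stars : seq (seq 'I_s) :=
  flatten [seq nseq (k j) (q j) | j <- enum 'I_m].

Definition nstars : nat := sumn (shape stars).

Definition sigmak : 'S_nstars := block_perm (shape stars).

Definition color (i : 'I_nstars) : 'I_s :=
  tnth (in_tuple (flatten stars)) (cast_ord (esym (size_flatten stars)) i).

Definition hypermaps (g : nat) : {set 'S_nstars} :=
  [set alpha | [&& hypermap sigmak alpha, has_genus sigmak alpha g
                 & [forall i, color (alpha i) == color i]]].

Lemma hypermaps_large (g : nat) : (nstars + 2 < 2 * g)%N -> hypermaps g = finset.set0.
Proof.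
move=> ltg; apply/finset.setP => alpha; rewrite !inE; apply/negbTE/negP.
by case/and3P=> _ /eqP eqg _; move: ltg; rewrite -eqg ltnNge leq_addl.
Qed.

Definition vertices_of_color (alpha : 'S_nstars) (r : 'I_s) :
    {set {set 'I_nstars}} :=
  [set v in porbits alpha | v \subset [set i | color i == r]].

Definition faces (alpha : 'S_nstars) : {set {set 'I_nstars}} :=
  porbits (alpha * sigmak)%g.

(* A face is listed in cyclic order from an arbitrary point, on which the
   trace of the associated product of matrices does not depend. *)
Definition face_cycle (alpha : 'S_nstars) (f : {set 'I_nstars}) : seq 'I_nstars :=
  if [pick j in f] is Some j then fingraph.orbit (alpha * sigmak)%g j else [::].

Definition face_trace (K : fieldType) (N : nat) (C : 'I_s -> 'M[K]_N)
    (alpha : 'S_nstars) (f : {set 'I_nstars}) : K :=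
  N%:R^-1 * \tr (mx_word C [seq color j | j <- face_cycle alpha f]).

Definition hypermap_sum (R : rcfType) (N : nat) (lambda : 'I_s -> R)
    (C : 'I_s -> 'M[R[i]]_N) (g : nat) : R[i] :=
  \sum_(alpha in hypermaps g)
    (\prod_r (lambda r)%:C ^+ #|vertices_of_color alpha r|)
    * \prod_(f in faces alpha) face_trace C alpha f.

End Stars.

Definition genus_series (R : rcfType) (N s m : nat) (q : 'I_m -> seq 'I_s)
    (lambda : 'I_s -> R) (C : 'I_s -> 'M[R[i]]_N) (g : nat) : fps R[i] m :=
  fun k => if (1 <= mdeg k)%N
           then (-1) ^+ mdeg k / (mfact k)%:R * hypermap_sum q k lambda C g
           else 0.

(* Main.v *)
Require Import Defs.
From HB Require Import structures.
From mathcomp Require Import all_boot all_order all_algebra all_fingroup.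
From mathcomp Require Import complex.
From mathcomp Require Import all_classical all_reals all_analysis.
From mathcomp Require Import measurable_realfun ring lra zify.
From mathcomp Require finmap.

(** A coefficient of the logarithm of the partition function is a sum over
    hypermaps because of two facts: moments of Wishart matrices are sums over
    permutations, and taking the logarithm selects the connected ones.

    Moments.  Let [W] be a Wishart matrix of scale [Sigma] and shape [p].
    Differentiating the Laplace transform [det (1 - theta Sigma)^-p] in a
    Hermitian direction [H] puts a factor [tr (H W)] into the expectation.  With
    [G = (Sigma^-1 - theta)^-1], the derivative of the power of the determinant is
    its product with [p tr (H G)], and that of [G] is [G H G].  So the new factor
    either comes with [p tr (H G)], or has [H G] inserted behind a factor that is
    already there: this is the way in which a new point enters a permutation, as a
    new cycle or behind an older point ([wickS], [wick_pencil]).  By induction on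
    the number of traces ([tilted_moments]) and at [theta = 0]
    ([wishart_moments]), the expectation of a product of traces [tr (A_i W)] is
    the sum over all permutations [alpha] of [p] to the number of cycles of
    [alpha] times the product over these cycles of the traces of the products of
    the [A_i Sigma].  The differentiation under the expectation rests on the
    exponential integrability of [W] ([wishart_tiltable]), and a family of
    independent matrices ([expectation_prod]) only restricts [alpha] to the
    permutations that preserve the colour.

    Expansion of the stars.  The trace of a word is a sum over index functions [b]
    of products of entries, one for each dart, which [sigma] puts in cyclic order.
    An entry is a trace against an elementary matrix, and these couple the indices
    along [alpha * sigma] ([wick_delta]); the sum over [b] then becomes the
    product over the faces of the traces of words in the scale matrices
    ([sum_prod_porbits], [permutation_weight_faces]).

    The logarithm.  Expectations in the [kappa]-th power of the partition function
    are expectations over [kappa] independent replicas of the matrices, and its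
    coefficients distribute the stars over the replicas ([fps_exp_type]).  A
    permutation contributes when it does not mix replicas, that is, once for each
    labelling of its connected components, so that it is counted
    [kappa ^ components] times ([fps_exp_partition_series]).  The coefficient of
    the logarithm is the coefficient of degree 1 in [kappa] ([fps_log_coef]): it
    retains the permutations with one component, which are the hypermaps.

    The genus.  The powers of [N] carried by stars, vertices, darts and faces
    combine into [N ^ (2 - 2 g)] ([genus_power]).  That every hypermap has a genus
    is Euler's inequality together with a parity argument ([hypermap_genus]). *)

Set Implicit Arguments.
Unset Strict Implicit.
Unset Printing Implicit Defensive.

Import Order.TTheory GRing.Theory Num.Theory.

Local Open Scope ring_scope.
Local Open Scope complex_scope.

(** * Sums over permutations and the insertion of a point *)

Lemma porbit_trans (T : finType) (s : {perm T}) (x y z : T) :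
  y \in porbit s x -> z \in porbit s y -> z \in porbit s x.
Proof. by rewrite -eq_porbit_mem => /eqP ->. Qed.

Lemma mem_porbit1 (T : finType) (s : {perm T}) (x : T) : s x \in porbit s x.
Proof. by have := mem_porbit s 1 x; rewrite expg1. Qed.

(** Marks one point in every cycle, so that a product over the marked points is a
    product over the cycles.  The largest point is marked because a new smallest
    point can then be inserted into the permutation without moving any mark. *)
Definition cycle_max n (alpha : 'S_n) (i : 'I_n) : bool :=
  [forall (j | j \in porbit alpha i), (j <= i)%N].

(** Inserts a new point [ord0] into the cycle of [j], right after [j]; for
    [j = ord0] the new point is a cycle of its own.  Every permutation of [n + 1]
    points arises once in this way. *)
Definition insert_perm n (j : 'I_n.+1) (alpha : 'S_n) : 'S_n.+1 :=
  (tperm ord0 j * lift_perm ord0 ord0 alpha)%g.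

Lemma insert_perm_target n (j : 'I_n.+1) (alpha : 'S_n) :
  insert_perm j alpha j = ord0.
Proof. by rewrite /insert_perm permM tpermR lift_perm_id. Qed.

Lemma insert_perm0 n (i : 'I_n) (alpha : 'S_n) :
  insert_perm (lift ord0 i) alpha ord0 = lift ord0 (alpha i).
Proof. by rewrite /insert_perm permM tpermL lift_perm_lift. Qed.

Lemma insert_perm_lift n (j : 'I_n.+1) (k : 'I_n) (alpha : 'S_n) :
  lift ord0 k != j -> insert_perm j alpha (lift ord0 k) = lift ord0 (alpha k).
Proof. by move=> kj; rewrite /insert_perm permM tpermD ?lift_perm_lift// eq_sym. Qed.

Lemma insert_perm_bij n :
  bijective (fun ja : 'I_n.+1 * 'S_n => insert_perm ja.1 ja.2).
Proof.
apply: inj_card_bij; last by rewrite card_prod card_ord !card_Sn factS.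
move=> [j a] [j' a'] /= eqp.
have ejj : j = j'.
  by apply: (@perm_inj _ (insert_perm j a)); rewrite {2}eqp !insert_perm_target.
rewrite -ejj in eqp *; congr pair.
have /permP eql : lift_perm ord0 ord0 a = lift_perm ord0 ord0 a'.
  by move/(mulgI (tperm ord0 j)) : eqp.
by apply/permP => k; apply: (@lift_inj _ ord0); have := eql (lift ord0 k); rewrite !lift_perm_lift.
Qed.

Lemma porbit_insert n (j : 'I_n.+1) (alpha : 'S_n) (k l : 'I_n) :
  (lift ord0 l \in porbit (insert_perm j alpha) (lift ord0 k)) = (l \in porbit alpha k).
Proof.
apply/idP/idP => [/porbitP[m]|/porbitP[m ->]].
- pose pi x := odflt (odflt k (unlift ord0 j)) (unlift ord0 x).
  suff H x : pi (insert_perm j alpha x) \in porbit alpha (pi x).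
    move=> e; have: pi (((insert_perm j alpha) ^+ m)%g (lift ord0 k)) \in porbit alpha (pi (lift ord0 k)).
      elim: m {e} => [|m IH]; first by rewrite expg0 perm1 porbit_id.
      rewrite expgSr permM.
      by apply: (porbit_trans IH) (H _).
    by rewrite -e /pi !liftK.
  case: (unliftP ord0 x) => [y|] -> {x}.
    have [e|ne] := eqVneq (lift ord0 y) j.
      by rewrite e insert_perm_target /pi -e liftK unlift_none /= porbit_id.
    by rewrite insert_perm_lift// /pi !liftK mem_porbit1.
  case: (unliftP ord0 j) => [i|] ej; rewrite ej.
    by rewrite insert_perm0 /pi !liftK unlift_none ej liftK mem_porbit1.
  by rewrite insert_perm_target porbit_id.
- elim: m => [|m IH]; first by rewrite expg0 perm1 porbit_id.
  rewrite expgSr permM; set y := ((alpha ^+ m)%g k) in IH *.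
  apply: (porbit_trans IH).
  have [e|ne] := eqVneq (lift ord0 y) j; last first.
    by rewrite -(insert_perm_lift alpha ne) mem_porbit1.
  rewrite -insert_perm0 -[X in insert_perm (lift ord0 y) alpha X](insert_perm_target (lift ord0 y) alpha) -e.
  by rewrite (porbit_trans (mem_porbit1 _ _) (mem_porbit1 _ _)).
Qed.

(** The value taken by the moment of the traces [\tr (A i *m W i)] of Wishart
    matrices, [B i] being [A i] times the scale of [W i] and [p] the shape: the
    permutation [alpha] contributes a factor [p] for each of its cycles, and the
    inner sum is the product over these cycles of the traces of the products of
    the [B i].  The label [t i] tells which of several independent matrices occurs
    in the trace [i]. *)
Definition wick (Gm : eqType) (K : comNzRingType) N n (p : Gm -> K)
    (t : 'I_n -> Gm) (B : 'I_n -> 'M[K]_N) : K :=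
  \sum_(alpha : 'S_n | [forall i, t (alpha i) == t i])
    (\prod_(i | cycle_max alpha i) p (t i))
    * \sum_(a : {ffun 'I_n -> 'I_N}) \prod_i B i (a i) (a (alpha i)).

Lemma cycle_max_insert n (j : 'I_n.+1) (alpha : 'S_n) (k : 'I_n) :
  cycle_max (insert_perm j alpha) (lift ord0 k) = cycle_max alpha k.
Proof.
apply/'forall_implyP/'forall_implyP => H l.
  by rewrite -(porbit_insert j) => /H; rewrite /= /bump /= ltnS.
case: (unliftP ord0 l) => [l'|] -> //.
by rewrite porbit_insert => /H; rewrite /= /bump /= ltnS.
Qed.

Lemma cycle_max_insert0 n (j : 'I_n.+1) (alpha : 'S_n) :
  cycle_max (insert_perm j alpha) ord0 = (j == ord0).
Proof.
case: (unliftP ord0 j) => [i|] ->.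
  apply/negbTE/negP => /'forall_implyP/(_ (lift ord0 (alpha i))).
  by rewrite -(insert_perm0 i alpha) mem_porbit1 => /(_ isT); rewrite insert_perm0.
rewrite eqxx; apply/'forall_implyP => l /porbitP[m ->].
suff -> : ((insert_perm ord0 alpha) ^+ m)%g ord0 = ord0 by [].
elim: m => [|m IH]; first by rewrite perm1.
by rewrite expgSr permM IH insert_perm_target.
Qed.

Lemma sum_ffun_ordS (K : nmodType) (X : finType) n (F : {ffun 'I_n.+1 -> X} -> K) :
  \sum_a F a = \sum_(a : {ffun 'I_n -> X}) \sum_x
     F [ffun i => if unlift ord0 i is Some k then a k else x].
Proof.
rewrite pair_big /=.
rewrite (reindex (fun ax : {ffun 'I_n -> X} * X =>
   [ffun i => if unlift ord0 i is Some k then ax.1 k else ax.2])) //=.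
apply: onW_bij.
exists (fun b : {ffun 'I_n.+1 -> X} => ([ffun k => b (lift ord0 k)], b ord0)).
  move=> [a x] /=; congr pair; last by rewrite ffunE unlift_none.
  by apply/ffunP => k; rewrite !ffunE liftK.
move=> b; apply/ffunP => i; rewrite !ffunE /=.
by case: (unliftP ord0 i) => [k|] -> //; rewrite ffunE.
Qed.

Definition fupd (I : eqType) (V : Type) (f : I -> V) (i : I) (v : V) : I -> V :=
  fun j => if j == i then v else f j.

(** Inserting the point [ord0] into a permutation either creates a cycle, hence a
    factor [p * \tr (B ord0)], or splices it behind a point [i] of the same label,
    hence [B ord0] multiplies [B i] on the right.  This is how a moment of Wishart
    matrices changes when one more trace is put in, see [wick_pencil]. *)
Lemma wickS (Gm : eqType) (K : comNzRingType) N n (p : Gm -> K)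
    (t : 'I_n.+1 -> Gm) (B : 'I_n.+1 -> 'M[K]_N) :
  wick p t B = p (t ord0) * \tr (B ord0)
      * wick p (t \o lift ord0) (B \o lift ord0)
    + \sum_(i | t (lift ord0 i) == t ord0)
        wick p (t \o lift ord0)
          (fupd (B \o lift ord0) i (B (lift ord0 i) *m B ord0)).
Proof.
pose F (al : 'S_n.+1) : K := (\prod_(i | cycle_max al i) p (t i))
    * \sum_(a : {ffun 'I_n.+1 -> 'I_N}) \prod_i B i (a i) (a (al i)).
have wt j al : \prod_(i | cycle_max (insert_perm j al) i) p (t i) =
   (if j == ord0 then p (t ord0) else 1) * \prod_(i | cycle_max al i) p (t (lift ord0 i)).
  rewrite big_mkcond big_ord_recl cycle_max_insert0 [in RHS]big_mkcond.
  by congr (_ * _); apply: eq_bigr => k _; rewrite cycle_max_insert.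
rewrite {1}/wick -/F (reindex _ (onW_bij _ (insert_perm_bij n))) /= -/F.
rewrite (eq_bigl (fun ja : 'I_n.+1 * 'S_n => (t ja.1 == t ord0)
   && [forall i, t (lift ord0 (ja.2 i)) == t (lift ord0 i)])); last first.
  move=> [j al] /=; apply/forallP/andP => [H|[/eqP H1 /forallP H] i].
    split; first by have := H j; rewrite insert_perm_target eq_sym.
    apply/forallP => k; have [e|ne] := eqVneq (lift ord0 k) j; last first.
      by have := H (lift ord0 k); rewrite insert_perm_lift.
    have := H ord0; rewrite -e insert_perm0 => /eqP ->.
    by have := H j; rewrite insert_perm_target -e.
  have [->|ne] := eqVneq i j; first by rewrite insert_perm_target H1.
  case: (unliftP ord0 i) ne => [k|] -> ne; first by rewrite insert_perm_lift.
  case: (unliftP ord0 j) ne H1 => [k|] -> // ne H1.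
  by rewrite insert_perm0 -H1 (eqP (H k)).
rewrite -(pair_big_dep (fun j => t j == t ord0)
  (fun j (al : 'S_n) => [forall i, t (lift ord0 (al i)) == t (lift ord0 i)])
  (fun j al => F (insert_perm j al))) /=.
rewrite big_mkcond big_ord_recl eqxx; congr (_ + _).
  rewrite /wick mulr_sumr; apply: eq_bigr => al _.
  rewrite /F wt eqxx -!mulrA; congr (_ * _); rewrite mulrCA; congr (_ * _).
  rewrite sum_ffun_ordS exchange_big /= /mxtrace mulr_suml.
  apply: eq_bigr => x _; rewrite mulr_sumr; apply: eq_bigr => a _.
  rewrite big_ord_recl !ffunE insert_perm_target unlift_none; congr (_ * _).
  apply: eq_bigr => k _; rewrite !ffunE insert_perm_lift// !liftK //.
rewrite -big_mkcond /=; apply: eq_bigr => i _.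
rewrite /wick; apply: eq_bigr => al _.
rewrite /F wt /= mul1r; congr (_ * _).
rewrite sum_ffun_ordS /=; apply: eq_bigr => a _.
rewrite [RHS](bigD1 i) //= /fupd eqxx mxE mulr_suml.
apply: eq_bigr => x _; rewrite big_ord_recl !ffunE insert_perm0 unlift_none liftK.
rewrite (bigD1 i) //= !ffunE insert_perm_target liftK unlift_none mulrCA mulrA.
congr (_ * _); apply: eq_bigr => k ki.
by rewrite (negbTE ki) !ffunE insert_perm_lift ?liftK// (inj_eq lift_inj).
Qed.

(** * Derivatives of permutation sums along a matrix pencil *)

Lemma wick0 (Gm : eqType) (K : comNzRingType) N (p : Gm -> K)
    (t : 'I_0 -> Gm) (B : 'I_0 -> 'M[K]_N) : wick p t B = 1.
Proof.
rewrite /wick (big_pred1 1%g); last first.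
  by move=> s; rewrite [RHS](_ : _ = true) ?(permS0 s) /= ?eqxx //; apply/forallP; case.
rewrite big_pred0; last by case.
rewrite mul1r (eq_bigr (fun=> 1)); last by move=> a _; rewrite big_ord0.
by rewrite sumr_const card_ffun !card_ord.
Qed.

Lemma eq_wick (Gm : eqType) (K : comNzRingType) N n (p : Gm -> K)
    (t : 'I_n -> Gm) (B B' : 'I_n -> 'M[K]_N) :
  B =1 B' -> wick p t B = wick p t B'.
Proof. by move=> /funext ->. Qed.

Lemma wick_lin (Gm : eqType) (K : comNzRingType) N n (p : Gm -> K)
    (t : 'I_n -> Gm) (B : 'I_n -> 'M[K]_N) i c U V :
  wick p t (fupd B i (c *: U + V)) =
  c * wick p t (fupd B i U) + wick p t (fupd B i V).
Proof.
rewrite /wick mulr_sumr -big_split /=; apply: eq_bigr => al _.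
rewrite mulrCA -mulrDr; congr (_ * _); rewrite mulr_sumr -big_split /=.
apply: eq_bigr => a _.
rewrite (bigD1 i)//= [X in _ = c * X + _](bigD1 i)//= [X in _ = _ + X](bigD1 i)//= /fupd eqxx !mxE mulrDl mulrA.
by congr (_ * _ + _ * _); apply: eq_bigr => j /negbTE ->.
Qed.

Lemma wick_slot0 (Gm : eqType) (K : comNzRingType) N n (p : Gm -> K)
    (t : 'I_n -> Gm) (B : 'I_n -> 'M[K]_N) i : wick p t (fupd B i 0) = 0.
Proof. by have := wick_lin p t B i (-1) 0 0; rewrite scaler0 addr0 mulN1r addNr. Qed.

Lemma wick_slotZ (Gm : eqType) (K : comNzRingType) N n (p : Gm -> K)
    (t : 'I_n -> Gm) (B : 'I_n -> 'M[K]_N) i c U :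
  wick p t (fupd B i (c *: U)) = c * wick p t (fupd B i U).
Proof. by have := wick_lin p t B i c U 0; rewrite addr0 wick_slot0 addr0. Qed.

Lemma wick_slotD (Gm : eqType) (K : comNzRingType) N n (p : Gm -> K)
    (t : 'I_n -> Gm) (B : 'I_n -> 'M[K]_N) i U V :
  wick p t (fupd B i (U + V)) = wick p t (fupd B i U) + wick p t (fupd B i V).
Proof. by rewrite -[U]scale1r wick_lin mul1r scale1r. Qed.

Lemma fupd_id (I : eqType) (V : Type) (f : I -> V) i : fupd f i (f i) = f.
Proof. by apply/funext => j; rewrite /fupd; case: eqP => [->|]. Qed.

Lemma wick_scale (Gm : eqType) (K : comNzRingType) N n (p : Gm -> K)
    (t : 'I_n -> Gm) (B : 'I_n -> 'M[K]_N) (c : 'I_n -> K) :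
  wick p t (fun i => c i *: B i) = (\prod_i c i) * wick p t B.
Proof.
rewrite /wick mulr_sumr; apply: eq_bigr => al _.
rewrite mulrCA; congr (_ * _); rewrite mulr_sumr; apply: eq_bigr => a _.
by rewrite -big_split /=; apply: eq_bigr => j _; rewrite mxE.
Qed.

Lemma rmorph_wick (Gm : eqType) (K L : comNzRingType) (f : {rmorphism K -> L})
    N n (p : Gm -> K) (t : 'I_n -> Gm) (B : 'I_n -> 'M[K]_N) :
  f (wick p t B) = wick (f \o p) t (fun i => map_mx f (B i)).
Proof.
rewrite /wick rmorph_sum; apply: eq_bigr => al _.
rewrite rmorphM rmorph_prod rmorph_sum; congr (_ * _).
by apply: eq_bigr => a _; rewrite rmorph_prod; apply: eq_bigr => j _; rewrite mxE.
Qed.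

Lemma deriv_prod (K : comNzRingType) (I : finType) (F : I -> {poly K}) :
  (\prod_i F i)^`() = \sum_i (F i)^`() * \prod_(j | j != i) F j.
Proof.
have H (s : seq I) : uniq s -> (\prod_(i <- s) F i)^`()
    = \sum_(i <- s) (F i)^`() * \prod_(j <- s | j != i) F j.
  elim: s => [|x s IH] /=; first by rewrite !big_nil derivC.
  case/andP=> xs us; rewrite big_cons derivM IH// big_cons; congr (_ + _).
    congr (_ * _); rewrite big_cons eqxx /= big_seq [RHS]big_seq_cond.
    by apply: eq_bigl => y; case ys: (y \in s) => //=; apply/esym; apply: contraNneq xs => <-.
  rewrite mulr_sumr !big_seq; apply: eq_bigr => y ys.
  rewrite big_cons ifT; first by rewrite mulrCA.
  by apply: contraNneq xs => ->.
by have := H _ (index_enum_uniq I).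
Qed.

Lemma wick_deriv (Gm : eqType) (K : comNzRingType) N n (p : Gm -> K)
    (t : 'I_n -> Gm) (B : 'I_n -> 'M[{poly K}]_N) :
  (wick (polyC \o p) t B)^`()
  = \sum_i wick (polyC \o p) t (fupd B i (map_mx (@deriv K) (B i))).
Proof.
rewrite /wick raddf_sum exchange_big /=; apply: eq_bigr => al _.
rewrite -mulr_sumr -rmorph_prod mul_polyC derivZ -mul_polyC; congr (_ * _).
rewrite raddf_sum exchange_big /=; apply: eq_bigr => a _.
rewrite deriv_prod; apply: eq_bigr => i _.
rewrite [RHS](bigD1 i) //= /fupd eqxx !mxE; congr (_ * _).
by apply: eq_bigr => j /negbTE ->.
Qed.

(** Jacobi's formula. *)
Lemma deriv_det (K : comNzRingType) n (M : 'M[{poly K}]_n) :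
  (\det M)^`() = \tr (map_mx (@deriv K) M *m \adj M).
Proof.
transitivity (\sum_i \det (\matrix_(k, l) if k == i then (M k l)^`() else M k l)).
  rewrite /determinant raddf_sum exchange_big /=; apply: eq_bigr => s _.
  rewrite -mulr_sumr.
  have -> : (-1) ^+ s = ((-1) ^+ s)%:P :> {poly K} by rewrite rmorphXn rmorphN1.
  rewrite mul_polyC derivZ -mul_polyC; congr (_ * _).
  rewrite deriv_prod; apply: eq_bigr => i _.
  rewrite [RHS](bigD1 i) //= !mxE eqxx; congr (_ * _).
  by apply: eq_bigr => j /negbTE ji; rewrite mxE ji.
apply: eq_bigr => i _; rewrite (expand_det_row _ i) mxE; apply: eq_bigr => j _.
rewrite !mxE eqxx; congr (_ * _); rewrite /cofactor; congr (_ * \det _).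
by apply/matrixP => k l; rewrite !mxE eq_sym (negbTE (neq_lift _ _)).
Qed.

Lemma deriv_mulmx (K : comNzRingType) m n p (A : 'M[{poly K}]_(m, n)) (B : 'M[{poly K}]_(n, p)) :
  map_mx (@deriv K) (A *m B)
  = map_mx (@deriv K) A *m B + A *m map_mx (@deriv K) B.
Proof.
apply/matrixP => i j; rewrite !mxE raddf_sum -big_split /=.
by apply: eq_bigr => k _; rewrite derivM !mxE.
Qed.

Lemma deriv_mx_polyC (K : comNzRingType) m n (A : 'M[K]_(m, n)) :
  map_mx (@deriv K) (map_mx polyC A) = 0.
Proof. by apply/matrixP => i j; rewrite !mxE derivC. Qed.

Section Resolvent.
Variables (K : comNzRingType) (N : nat) (A H : 'M[K]_N).

Definition pencil : 'M[{poly K}]_N := map_mx polyC A - 'X *: map_mx polyC H.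

Lemma deriv_pencil : map_mx (@deriv K) pencil = - map_mx polyC H.
Proof.
apply/matrixP => i j; rewrite !mxE derivB derivC derivM derivX derivC.
by rewrite mulr0 addr0 mul1r sub0r.
Qed.

Lemma deriv_det_pencil :
  (\det pencil)^`() = - \tr (map_mx polyC H *m \adj pencil).
Proof. by rewrite deriv_det deriv_pencil mulNmx raddfN. Qed.

(** The derivative of [adj / det], that is of the inverse of the pencil,
    cleared of its denominator. *)
Lemma deriv_adj_pencil :
  \det pencil *: map_mx (@deriv K) (\adj pencil)
  = \adj pencil *m map_mx polyC H *m \adj pencil
    + (\det pencil)^`() *: \adj pencil.
Proof.
have e := congr1 (map_mx (@deriv K)) (mul_mx_adj pencil).
have dM : map_mx (@deriv K) ((\det pencil)%:M : 'M[{poly K}]_N) = ((\det pencil)^`())%:M.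
  by apply/matrixP => i j; rewrite !mxE raddfMn.
rewrite deriv_mulmx deriv_pencil dM in e.
have := congr1 (mulmx (\adj pencil)) e.
rewrite mulmxDr [X in _ + X]mulmxA mul_adj_mx mul_scalar_mx mul_mx_scalar => e2.
apply: (addrI (\adj pencil *m (- map_mx polyC H *m \adj pencil))); rewrite e2.
by rewrite addrA mulNmx mulmxN mulmxA addNr add0r.
Qed.

(** Differentiation of [wick p t (M * G)] with [G] the inverse of the pencil in the
    slots of label [g], multiplied by the powers of the determinant that make it a
    polynomial.  Each slot contributes the derivative [G * H * G] of the resolvent,
    which splices [H * G] behind it; the power [- p g] of the determinant, which
    multiplies the sum in a Laplace transform, contributes [p g * \tr (H * G)].
    The right-hand side is thus the recursion [wickS]. *)
Lemma wick_pencil (Gm : eqType) n (p : Gm -> K) (t : 'I_n -> Gm) (g : Gm)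
    (S : 'I_n -> 'M[{poly K}]_N) :
  (forall i, t i == g -> exists M : 'M[K]_N, S i = map_mx polyC M *m \adj pencil) ->
  (forall i, t i != g -> exists M : 'M[K]_N, S i = map_mx polyC M) ->
  let Q := wick (polyC \o p) t S in
  \det pencil * Q^`() - ((p g)%:P + (#|[set i | t i == g]|)%:R) * (\det pencil)^`() * Q
  = (p g)%:P * \tr (map_mx polyC H *m \adj pencil) * Q
    + \sum_(i | t i == g) wick (polyC \o p) t
         (fupd S i (S i *m (map_mx polyC H *m \adj pencil))).
Proof.
move=> Sg Sng Q.
rewrite {1}/Q wick_deriv mulr_sumr (bigID (fun i => t i == g)) /=.
rewrite [X in _ + X - _]big1 ?addr0; last first.
  by move=> i /Sng[M ->]; rewrite deriv_mx_polyC wick_slot0 mulr0.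
set c := \tr _; have dD : (\det pencil)^`() = - c := deriv_det_pencil.
have -> : \sum_(i | t i == g) wick (polyC \o p) t (fupd S i (S i *m (map_mx polyC H *m \adj pencil)))
  = \sum_(i | t i == g) (\det pencil * wick (polyC \o p) t (fupd S i (map_mx (@deriv K) (S i))) + c * Q).
  apply: eq_bigr => i /Sg[M SE].
  rewrite -wick_slotZ SE deriv_mulmx deriv_mx_polyC mul0mx add0r scalemxAr.
  rewrite deriv_adj_pencil dD mulmxDr wick_slotD -scalemxAr -SE wick_slotZ fupd_id -/Q.
  by rewrite mulNr -addrA addNr addr0 SE !mulmxA.
rewrite big_split /= -mulr_sumr sumr_const.
have <- : #|[set i | t i == g]| = #|[pred i | t i == g]|.
  by apply: eq_card => i; rewrite inE.
by rewrite dD -mulr_natl; ring.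
Qed.
End Resolvent.

(** * Index sums along cycles *)

(** Functions supported in [Q] stand for the functions defined on [Q] only: the
    value [x0] off [Q] makes each of them occur once in a sum. *)
Definition off_support (I X : finType) (x0 : X) (Q : pred I) (b : {ffun I -> X}) : bool :=
  [forall (i | ~~ Q i), b i == x0].

Lemma off_supportP (I X : finType) (x0 : X) (Q : pred I)
    (b : {ffun I -> X}) :
  reflect (forall i, ~~ Q i -> b i = x0) (off_support x0 Q b).
Proof. by apply: (iffP forall_inP) => h i /h // /eqP. Qed.

Lemma off_supportT (I X : finType) (x0 : X) (b : {ffun I -> X}) :
  off_support x0 xpredT b.
Proof. by apply/off_supportP. Qed.

(** A choice, for every [c], of a function on the fibre of [chi] over [c] is one
    function on the union of these fibres. *)
Lemma prod_sum_regroup (K : comPzSemiRingType) (I J X : finType) (x0 : X)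
    (chi : I -> J) (Q : pred J) (phi : J -> {ffun I -> X} -> K) :
  (forall c (b b' : {ffun I -> X}), Q c -> (forall i, chi i = c -> b i = b' i) -> phi c b = phi c b') ->
  \prod_(c | Q c) \sum_(b | off_support x0 (fun i => chi i == c) b) phi c b
  = \sum_(b | off_support x0 (fun i => Q (chi i)) b) \prod_(c | Q c) phi c b.
Proof.
move=> loc; pose b0 : {ffun I -> X} := [ffun=> x0].
rewrite (big_distr_big_dep b0 _ (fun c => off_support x0 (fun i => chi i == c))).
pose h (b : {ffun I -> X}) : {ffun J -> {ffun I -> X}} :=
  [ffun c => if Q c then [ffun i => if chi i == c then b i else x0] else b0].
pose h' (B : {ffun J -> {ffun I -> X}}) : {ffun I -> X} := [ffun i => B (chi i) i].
rewrite (reindex_onto h h') /=; last first.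
  move=> B /pfamilyP[/supportP sB fB]; apply/ffunP => c; rewrite ffunE.
  case: (boolP (Q c)) => Qc; last by rewrite sB.
  apply/ffunP => i; rewrite !ffunE; case: eqP => [->//|/eqP ic].
  by have /off_supportP -> := fB c Qc.
apply: eq_big => [b|b _].
  apply/andP/off_supportP => [[_ /eqP hb] i Qi|hb].
    by rewrite -hb !ffunE (negbTE Qi) ffunE.
  split.
    apply/pfamilyP; split.
      apply/supportP => c nQc; have Qc : Q c = false := negbTE nQc.
      by rewrite ffunE Qc.
    move=> c Qc; apply/off_supportP => i ic; rewrite ffunE.
    have Qc' : Q c := Qc; by rewrite Qc' ffunE (negbTE ic).
  apply/eqP/ffunP => i; rewrite !ffunE; case: ifP => Qi; rewrite ffunE ?eqxx//.
  by rewrite hb// Qi.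
apply: eq_bigr => c Qc; apply: loc => // i ic.
by rewrite ffunE Qc ffunE ic eqxx.
Qed.

Section CycleTrace.
Variables (K : comNzRingType) (N : nat) (D : finType) (M : D -> 'M[K]_N).
Variable x0 : 'I_N.

Let word (l : seq D) : 'M[K]_N := \big[mulmx/1%:M]_(d <- l) M d.

Lemma sum_off_support_cons (e : D) (l : seq D) (F : {ffun D -> 'I_N} -> K) :
  e \notin l ->
  \sum_z \sum_(b | off_support x0 (mem l) b) F [ffun d => if d == e then z else b d]
  = \sum_(b | off_support x0 (mem (e :: l)) b) F b.
Proof.
move=> el; rewrite pair_big /=.
pose h (b : {ffun D -> 'I_N}) : 'I_N * {ffun D -> 'I_N} :=
  (b e, [ffun d => if d == e then x0 else b d]).
pose h' (p : 'I_N * {ffun D -> 'I_N}) : {ffun D -> 'I_N} :=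
  [ffun d => if d == e then p.1 else p.2 d].
rewrite (reindex_onto h h') /=; last first.
  move=> [z b] /= /off_supportP hb; rewrite /h /h' !ffunE eqxx; congr pair.
  by apply/ffunP => d; rewrite !ffunE; case: eqP => // ->; rewrite hb.
apply: eq_big => [b|b _]; last by congr F; apply/ffunP => d; rewrite !ffunE; case: eqP => // ->.
apply/andP/off_supportP => [[/off_supportP hb _] d|hb].
  rewrite /= inE negb_or => /andP[de dl].
  by have := hb d dl; rewrite ffunE (negbTE de).
split.
  apply/off_supportP => d dl; rewrite ffunE; case: eqP => // /eqP de.
  by rewrite hb//= inE negb_or de.
by apply/eqP/ffunP => d; rewrite !ffunE; case: eqP => // ->.
Qed.

Fixpoint path_weight (b : {ffun D -> 'I_N}) (x : 'I_N) (d : D) (l : seq D) (y : 'I_N) : K :=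
  if l is e :: l' then M d x (b e) * path_weight b (b e) e l' y else M d x y.

Lemma eq_path_weight (b b' : {ffun D -> 'I_N}) x d l y : {in l, b =1 b'} ->
  path_weight b x d l y = path_weight b' x d l y.
Proof.
elim: l x d => //= e l IH x d h.
rewrite (h e) ?mem_head// IH// => f fl; apply: h; by rewrite inE fl orbT.
Qed.

Lemma word_entry d l x y : uniq (d :: l) ->
  word (d :: l) x y = \sum_(b | off_support x0 (mem l) b) path_weight b x d l y.
Proof.
elim: l d x => [|e l IH] d x.
  move=> _; rewrite /word big_cons big_nil mulmx1 (big_pred1 [ffun=> x0])//= => b.
  apply/off_supportP/eqP => [h|-> i _]; last by rewrite ffunE.
  by apply/ffunP => i; rewrite ffunE h.
move=> u; have ue : uniq (e :: l) by case/andP: u.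
have el : e \notin l by case/andP: ue.
rewrite -(sum_off_support_cons (fun b => path_weight b x d (e :: l) y) el).
rewrite /word big_cons -/(word (e :: l)) mxE; apply: eq_bigr => z _.
rewrite (IH e z ue) mulr_sumr; apply: eq_bigr => b _ /=.
rewrite ffunE eqxx; congr (_ * _); apply: eq_path_weight => f fl.
rewrite ffunE; case: eqP => // fe; by rewrite -fe fl in el.
Qed.

Lemma path_weight_cycle (s : D -> D) b d l : fpath s d l ->
  path_weight b (b d) d l (b (s (last d l))) = \prod_(e <- d :: l) M e (b e) (b (s e)).
Proof.
elim: l d => [|e l IH] d /=; first by rewrite big_seq1.
by case/andP=> /eqP sd pe; rewrite big_cons sd IH.
Qed.

(** Expanding the trace of a product yields one index per factor; the factor [e]
    joins its own index to that of the next factor, and the last factor returns to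
    the first index because the sequence is a cycle. *)
Lemma tr_cycle (s : D -> D) (c : seq D) : c != [::] -> uniq c -> fcycle s c ->
  \tr (word c) = \sum_(b | off_support x0 (mem c) b) \prod_(e <- c) M e (b e) (b (s e)).
Proof.
case: c => // d l _ u cy.
have dl : d \notin l by case/andP: u.
have [pl sl] : fpath s d l /\ s (last d l) = d.
  by move: cy; rewrite /= rcons_path => /andP[? /eqP].
rewrite -(sum_off_support_cons (fun b => \prod_(e <- d :: l) M e (b e) (b (s e))) dl).
rewrite /mxtrace; apply: eq_bigr => x _; rewrite word_entry//.
apply: eq_bigr => b _; rewrite -(path_weight_cycle _ pl) sl ffunE eqxx.
apply: eq_path_weight => f fl; rewrite ffunE; case: eqP => // fd.
by rewrite -fd fl in dl.
Qed.

Lemma mem_orbit_porbit (s : {perm D}) x d : (d \in fingraph.orbit s x) = (d \in porbit s x).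
Proof.
rewrite -fconnect_orbit; apply/idP/porbitP => [/iter_findex <-|[i ->]].
  by exists (findex s x d); rewrite permX.
by rewrite permX fconnect_iter.
Qed.

(** The factor at [d] only involves the values of [a] at [d] and [s d], which lie
    in one cycle, so that the sum splits over the cycles, where [tr_cycle]
    applies. *)
Lemma sum_prod_porbits (s : {perm D}) (cyc : {set D} -> seq D) :
  (forall f, f \in porbits s -> exists2 j, j \in f & cyc f = fingraph.orbit s j) ->
  \sum_(a : {ffun D -> 'I_N}) \prod_d M d (a d) (a (s d))
  = \prod_(f in porbits s) \tr (word (cyc f)).
Proof.
move=> cycP.
have porb f d : f \in porbits s -> (porbit s d == f) = (d \in f).
  by case/imsetP=> e _ ->; rewrite eq_porbit_mem.
have orb f : f \in porbits s ->
    [/\ cyc f != [::], uniq (cyc f), fcycle s (cyc f) & cyc f =i f].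
  move=> fP; have [j jf ->] := cycP f fP; split.
  - by apply/eqP => e; have := fingraph.in_orbit s j; rewrite e.
  - exact: orbit_uniq.
  - exact/cycle_orbit/perm_inj.
  - move=> d; rewrite mem_orbit_porbit; move: jf; rewrite -porb// => /eqP <-.
    by [].
transitivity (\prod_(f in porbits s)
    \sum_(b | off_support x0 (fun d => porbit s d == f) b)
      \prod_(d in f) M d (b d) (b (s d))); last first.
  apply: eq_bigr => f fP; have [cn cu cc cf] := orb f fP.
  rewrite (tr_cycle cn cu cc); apply: eq_big => [b|b _].
    by rewrite /off_support; apply: eq_forallb => d; rewrite porb// /= cf.
  by rewrite [RHS]big_uniq//=; apply: eq_bigl => d; rewrite cf.
rewrite (@prod_sum_regroup K D _ _ x0 (porbit s) (fun f => f \in porbits s)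
  (fun f b => \prod_(d in f) M d (b d) (b (s d)))); last first.
  move=> f b b' fP h; apply: eq_bigr => d df.
  have e : porbit s d = f by apply/eqP; rewrite porb.
  by rewrite h// h// -e; apply/eqP; rewrite eq_porbit_mem mem_porbit1.
apply: eq_big => [b|b _]; first by apply/esym/off_supportP => d; rewrite /= imset_f.
rewrite (partition_big (porbit s) (fun f => f \in porbits s))/=; last by move=> d _; rewrite imset_f.
apply: eq_bigr => f fP; apply: eq_bigl => d; by rewrite porb.
Qed.
End CycleTrace.

(** * Elementary matrices and cycle counts *)

(** An elementary matrix in slot [d] forces the summation index [a d] to be
    [b (s d)], and the inner sum collapses to a single term, where the index
    function [b] is coupled along the composite of [alpha] and [s]. *)
Lemma wick_delta (Gm : eqType) (K : comNzRingType) N n (p : Gm -> K)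
    (t : 'I_n -> Gm) (s : 'S_n) (S : 'I_n -> 'M[K]_N) (b : {ffun 'I_n -> 'I_N}) :
  wick p t (fun d => delta_mx (b (s d)) (b d) *m S d)
  = \sum_(alpha : 'S_n | [forall i, t (alpha i) == t i])
      (\prod_(i | cycle_max alpha i) p (t i)) * \prod_d S d (b d) (b ((alpha * s)%g d)).
Proof.
have E i j (A : 'M[K]_N) x y : (delta_mx i j *m A) x y = (x == i)%:R * A j y.
  rewrite mxE (bigD1 j)//= big1 ?addr0 => [|k kj]; first by rewrite mxE eqxx andbT.
  by rewrite mxE (negbTE kj) andbF mul0r.
rewrite /wick; apply: eq_bigr => al _; congr (_ * _).
(* The only index function not killed by the elementary matrices. *)
rewrite (bigD1 [ffun d => b (s d)])//= [X in _ + X]big1 ?addr0.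
  by apply: eq_bigr => d _; rewrite E !ffunE eqxx mul1r permM.
move=> a ab; have [d ad] : exists d, a d != b (s d).
  apply/existsP; rewrite -negb_forall; apply: contra ab => /forallP h.
  by apply/eqP/ffunP => d; rewrite ffunE (eqP (h d)).
by rewrite (bigD1 d)//= E (negbTE ad) !mul0r.
Qed.

Lemma porbit_invariant (T : finType) (X : Type) (s : {perm T}) (t : T -> X) x y :
  (forall i, t (s i) = t i) -> y \in porbit s x -> t y = t x.
Proof.
move=> h /porbitP[i ->]; elim: i => [|i IH]; first by rewrite perm1.
by rewrite expgSr permM h.
Qed.

Lemma cycle_max_exists n (alpha : 'S_n) v : v \in porbits alpha ->
  exists2 i, cycle_max alpha i & v = porbit alpha i.
Proof.
case/imsetP=> x _ ->.
have [i ix imax] := arg_maxnP (fun i : 'I_n => val i) (porbit_id alpha x).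
have e : porbit alpha i = porbit alpha x by apply/eqP; rewrite eq_porbit_mem.
exists i => //; apply/forall_inP => j; rewrite e => jx; exact: imax.
Qed.

Lemma cycle_max_inj n (alpha : 'S_n) i j : cycle_max alpha i -> cycle_max alpha j ->
  porbit alpha i = porbit alpha j -> i = j.
Proof.
move=> /forall_inP hi /forall_inP hj e; apply: val_inj; apply/eqP; rewrite eqn_leq /=.
by rewrite hj ?hi// -?e -?eq_porbit_mem -?e.
Qed.

Lemma card_cycles_of_color n (Gm : finType) (alpha : 'S_n) (t : 'I_n -> Gm) r :
  (forall i, t (alpha i) = t i) ->
  #|[set i | cycle_max alpha i && (t i == r)]|
  = #|[set v in porbits alpha | v \subset [set i | t i == r]]|.
Proof.
move=> tal; have -> : [set v in porbits alpha | v \subset [set i | t i == r]]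
    = porbit alpha @: [set i | cycle_max alpha i && (t i == r)].
  apply/finset.setP => v; rewrite inE; apply/andP/imsetP => [ [/cycle_max_exists[i im ->] /fintype.subsetP h] | [k] ].
    exists i => //; rewrite inE im /=.
    by have := h i (porbit_id _ _); rewrite inE.
  rewrite inE => /andP[im /eqP <-] ->; split; first exact: imset_f.
  by apply/fintype.subsetP => j ji; rewrite inE (porbit_invariant tal ji).
rewrite card_in_imset// => i j; rewrite !inE => /andP[im _] /andP[jm _].
exact: cycle_max_inj.
Qed.

Lemma prod_cycle_max (K : comNzRingType) n (Gm : finType) (alpha : 'S_n)
    (t : 'I_n -> Gm) (p : Gm -> K) :
  (forall i, t (alpha i) = t i) ->
  \prod_(i | cycle_max alpha i) p (t i)
  = \prod_r p r ^+ #|[set v in porbits alpha | v \subset [set i | t i == r]]|.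
Proof.
move=> tal; rewrite (partition_big t xpredT)//=; apply: eq_bigr => r _.
rewrite -card_cycles_of_color// (eq_bigr (fun=> p r)); last by move=> i /andP[_ /eqP ->].
by rewrite prodr_const; congr (_ ^+ _); apply: eq_card => i; rewrite inE.
Qed.

Lemma card_cycle_max n (alpha : 'S_n) : #|[set i | cycle_max alpha i]| = #|porbits alpha|.
Proof.
have := @card_cycles_of_color n unit alpha (fun=> tt) tt (fun=> erefl).
rewrite (_ : [set i | cycle_max alpha i && (tt == tt)] = [set i | cycle_max alpha i]).
  move=> ->; apply: eq_card => v; rewrite inE andb_idr// => _.
  by apply/fintype.subsetP => i _; rewrite inE.
by apply/finset.setP => i; rewrite !inE andbT.
Qed.

(** * The cycles of the star permutation *)

Lemma path_succ_mod d a k : (a + k.+1)%N = d ->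
  path (fun x y => y == x.+1 %% d)%N a (rcons (iota a.+1 k) 0%N).
Proof.
elim: k a => [|k IH] a e /=; first by rewrite andbT -e addn1 modnn.
rewrite IH ?addSnnS// andbT modn_small// -e -addSnnS -[X in (X < _)%N]addn0 ltn_add2l.
by [].
Qed.

Section Blocks.
Variable ds : seq nat.
Hypothesis ds_gt0 : forall r, (r < size ds)%N -> (0 < nth 0 ds r)%N.

Definition block_of (d : 'I_(sumn ds)) : 'I_(size ds) :=
  Ordinal (reshape_indexP (ltn_ord d)).

Definition dart r (o : 'I_(nth 0%N ds r)) : 'I_(sumn ds) :=
  Ordinal (flatten_indexP (ltn_ord o)).

Definition block (r : 'I_(size ds)) : seq 'I_(sumn ds) :=
  [seq dart o | o <- enum 'I_(nth 0%N ds r)].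

Lemma block_permE r (o o' : 'I_(nth 0%N ds r)) :
  val o' = ((val o).+1 %% nth 0 ds r)%N -> block_perm ds (dart o) = dart o'.
Proof.
move=> e; apply: val_inj; rewrite permE /= /block_next.
by rewrite flatten_indexKl// flatten_indexKr// -e.
Qed.

Lemma size_block r : size (block r) = nth 0%N ds r.
Proof. by rewrite size_map -cardE card_ord. Qed.

Lemma block_neq0 r : block r != [::].
Proof.
rewrite -size_eq0 size_map -cardE card_ord -lt0n; exact: ds_gt0.
Qed.

Lemma block_uniq r : uniq (block r).
Proof.
rewrite map_inj_uniq ?enum_uniq// => o o' /(congr1 val) /= e; apply: val_inj => /=.
by have := congr1 (reshape_offset ds) e; rewrite !flatten_indexKr.
Qed.

Lemma block_fcycle r : fcycle (block_perm ds) (block r).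
Proof.
pose e' (x y : nat) := y == (x.+1 %% nth 0 ds r)%N.
have : path.cycle e' (map val (enum 'I_(nth 0%N ds r))).
  rewrite val_enum_ord; have := ds_gt0 (ltn_ord r); rewrite /e'.
  case E : (nth 0 ds r) => [//|d'] _ /=.
  exact: path_succ_mod.
rewrite /block !cycle_map; apply: sub_cycle => o o' /= /eqP h.
by apply/eqP; exact: block_permE.
Qed.

Lemma mem_block r d : (d \in block r) = (block_of d == r).
Proof.
apply/mapP/eqP => [ [j _ ->] | <-].
  by apply: val_inj; rewrite /= flatten_indexKl.
exists (Ordinal (reshape_offsetP (ltn_ord d))); first by rewrite mem_enum.
by apply: val_inj; rewrite /= reshape_indexK.
Qed.

(** The star permutation acts transitively on each block, so that its cycles are
    the stars. *)
Lemma porbit_block d d' : (d' \in porbit (block_perm ds) d) = (block_of d' == block_of d).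
Proof.
apply/idP/idP => [/porbitP[k ->]|/eqP h].
  elim: k => [|k IH]; first by rewrite perm1.
  rewrite expgSr permM -(eqP IH); apply/eqP; apply: val_inj => /=.
  by rewrite permE /= flatten_indexKl// block_next_offset.
have din : d \in block (block_of d) by rewrite mem_block.
have d'in : d' \in block (block_of d) by rewrite mem_block h.
rewrite -mem_orbit_porbit -fconnect_orbit.
by rewrite (fconnect_cycle (block_fcycle _) din).
Qed.

Lemma block_of_perm d : block_of (block_perm ds d) = block_of d.
Proof. by apply/eqP; rewrite -porbit_block mem_porbit1. Qed.

Lemma block_of_surj r : exists d, block_of d = r.
Proof.
have := block_neq0 r; have := mem_block r; case: (block r) => // d l h _.
by exists d; apply/eqP; rewrite -h mem_head.
Qed.

Lemma card_porbits_block : #|porbits (block_perm ds)| = size ds.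
Proof.
pose fib (r : 'I_(size ds)) := [set d | block_of d == r].
have -> : porbits (block_perm ds) = fib @: [set: 'I_(size ds)].
  have pf d : porbit (block_perm ds) d = fib (block_of d).
    by apply/finset.setP => d'; rewrite porbit_block inE.
  apply/finset.setP => v; apply/imsetP/imsetP => [ [d _ ->] | [r _ ->] ].
    by exists (block_of d); rewrite ?inE.
  by have [d <-] := block_of_surj r; exists d; rewrite ?inE.
rewrite card_imset ?cardsT ?card_ord// => r r' e.
have [d dr] := block_of_surj r; have : d \in fib r by rewrite inE dr.
by rewrite e inE dr => /eqP.
Qed.

End Blocks.

Section StarWords.
Variables (s m : nat) (q : 'I_m -> seq 'I_s) (k : mindex m).
Hypothesis hq : forall j, (1 <= size (q j))%N.

Lemma stars_words w : w \in stars q k -> exists j, w = q j.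
Proof.
move=> /flattenP[x /mapP[j _ ->]] /nseqP[-> _]; by exists j.
Qed.

Lemma stars_gt0 r : (r < size (shape (stars q k)))%N -> (0 < nth 0 (shape (stars q k)) r)%N.
Proof.
rewrite size_map => lt; rewrite (nth_map [::])//.
by have [j ->] := stars_words (mem_nth [::] lt).
Qed.

Lemma star_colors r : map (@color s m q k) (block r) = nth [::] (stars q k) r.
Proof.
have lr : (r < size (stars q k))%N by rewrite -(size_map size); exact: ltn_ord.
have sz : nth 0%N (shape (stars q k)) r = size (nth [::] (stars q k) r).
  by rewrite (nth_map [::]).
have s0 : 'I_s.
  have := stars_gt0 (ltn_ord r); rewrite sz; case: (nth [::] _ _) => // x *; exact: x.
have sb : size (map (@color s m q k) (block r)) = size (block r) by rewrite size_map.
apply: (@eq_from_nth _ s0); first by rewrite sb size_block.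
move=> o; rewrite sb size_block => lo.
rewrite (nth_map (dart (Ordinal lo))); last by rewrite size_block.
rewrite (nth_map (Ordinal lo)); last by rewrite -cardE card_ord.
rewrite /color (tnth_nth s0) /= nth_enum_ord//.
by rewrite nth_flatten flatten_indexKl// flatten_indexKr.
Qed.

Lemma size_stars : size (stars q k) = mdeg k.
Proof.
rewrite size_flatten /shape -map_comp /mdeg sumnE big_map big_enum /=.
by apply: eq_bigr => j _; rewrite size_nseq.
Qed.
End StarWords.

(** * Connected components and the genus *)

Section Components.
Variables (n : nat) (sigma : 'S_n).
Implicit Types alpha : 'S_n.

(** The symmetric closure of the actions of [sigma] and [alpha], the connected
    components of which are the orbits of the group they generate. *)
Definition dart_edge alpha : rel 'I_n := fun x y =>
  [|| y == sigma x, y == alpha x, x == sigma y | x == alpha y].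

Lemma dart_edge_sym alpha : symmetric (dart_edge alpha).
Proof.
by move=> x y; rewrite /dart_edge; do 4 case: (_ == _).
Qed.

Lemma dart_connect_sym alpha : connect_sym (dart_edge alpha).
Proof. exact/sym_connect_sym/dart_edge_sym. Qed.

Definition components alpha : nat := #|roots (dart_edge alpha)|.

(** Labellings constant on the components.  Counting them is an algebraic way of
    counting components: replicas are distributed over the stars in this way, and
    labellings by booleans measure how the number of components varies with
    [alpha]. *)
Definition invariant_labels (X : finType) alpha : {set {ffun 'I_n -> X}} :=
  [set chi : {ffun 'I_n -> X} |
    [forall x, (chi (sigma x) == chi x) && (chi (alpha x) == chi x)]].

Lemma invariant_labelsP (X : finType) alpha (chi : {ffun 'I_n -> X}) :
  reflect (forall x, chi (sigma x) = chi x /\ chi (alpha x) = chi x)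
    (chi \in invariant_labels X alpha).
Proof.
rewrite inE; apply: (iffP forallP) => h x.
  by case/andP: (h x) => /eqP ? /eqP.
by have [-> ->] := h x; rewrite !eqxx.
Qed.

Lemma invariant_connect (X : finType) alpha (chi : {ffun 'I_n -> X}) x y :
  chi \in invariant_labels X alpha -> connect (dart_edge alpha) x y -> chi x = chi y.
Proof.
move/invariant_labelsP => h /connectP[p + ->]; elim: p x => //= z p IH x /andP[xz pz].
rewrite -(IH _ pz); case/or4P: xz => /eqP ->; first by rewrite (h x).1.
- by rewrite (h x).2.
- by rewrite (h z).1.
- by rewrite (h z).2.
Qed.

(** One label is chosen freely at the root of each component. *)
Lemma card_invariant_labels (X : finType) alpha :
  #|invariant_labels X alpha| = (#|X| ^ components alpha)%N.
Proof.
pose e := dart_edge alpha; pose S := {x | roots e x}.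
have rr x : roots e (fingraph.root e x) by apply: roots_root; exact: dart_connect_sym.
pose rt x : S := exist _ (fingraph.root e x) (rr x).
pose h (F : {ffun S -> X}) : {ffun 'I_n -> X} := [ffun x => F (rt x)].
have hinj : injective h.
  move=> F F' /ffunP eF; apply/ffunP => -[x rx].
  have := eF x; rewrite !ffunE.
  by have -> : rt x = exist _ x rx by apply: val_inj; apply/eqP.
have -> : invariant_labels X alpha = h @: [set: {ffun S -> X}].
  apply/finset.setP => chi; apply/idP/imsetP => [ic|[F _ ->]].
    exists [ffun s : S => chi (val s)]; first by rewrite inE.
    apply/ffunP => x; rewrite !ffunE /=; apply: (invariant_connect ic).
    exact: connect_root.
  apply/invariant_labelsP => x; rewrite !ffunE.
  by split; congr (F _); apply: val_inj => /=; apply/eqP;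
    rewrite root_connect ?connect1//; try exact: dart_connect_sym;
    rewrite /e /dart_edge eqxx ?orbT.
by rewrite card_imset// cardsT card_ffun card_sig.
Qed.

Lemma leq_porbits_components1 : (#|porbits sigma| <= components 1%g)%N.
Proof.
pose e := dart_edge 1%g.
have inv : [ffun x => porbit sigma x] \in invariant_labels {set 'I_n} 1%g.
  apply/invariant_labelsP => x; rewrite !ffunE perm1; split=> //.
  by apply/eqP; rewrite eq_porbit_mem mem_porbit1.
have -> : porbits sigma = porbit sigma @: [set x | roots e x].
  apply/finset.setP => v; apply/imsetP/imsetP => [ [x _ ->] | [x _ ->] ]; last by exists x.
  exists (fingraph.root e x); first by rewrite inE roots_root//; exact: dart_connect_sym.
  by have := invariant_connect inv (connect_root e x); rewrite !ffunE.
by rewrite (leq_trans (leq_imset_card _ _))// cardsE.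
Qed.

Lemma invariant_tperm (X : finType) (x y : 'I_n) alpha (chi : {ffun 'I_n -> X}) :
  chi \in invariant_labels X (tperm x y * alpha)%g -> chi x = chi y ->
  chi \in invariant_labels X alpha.
Proof.
move=> /invariant_labelsP h xy; apply/invariant_labelsP => z; split; first by have [] := h z.
have t z' : chi (tperm x y z') = chi z' by case: tpermP => // ->.
by have [_] := h (tperm x y z); rewrite permM tpermK t.
Qed.

Lemma leq_components alpha alpha' (k : nat) :
  (#|invariant_labels bool alpha| <= 2 ^ k * #|invariant_labels bool alpha'|)%N ->
  (components alpha <= k + components alpha')%N.
Proof. by rewrite !card_invariant_labels card_bool -expnD leq_exp2l. Qed.

(** A labelling invariant for the product with the transposition is invariant for
    [alpha] as soon as it takes the same value at [x] and [y]; two boolean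
    labellings that separate [x] from [y] differ by such a labelling. *)
Lemma components_tperm_le (x y : 'I_n) alpha :
  (components (tperm x y * alpha)%g <= 1 + components alpha)%N.
Proof.
apply: leq_components; rewrite expn1 mul2n -addnn.
set I1 := invariant_labels _ _; set I2 := invariant_labels _ _.
pose E := [set chi in I1 | chi x == chi y].
have EI : (#|E| <= #|I2|)%N.
  apply: subset_leq_card; apply/fintype.subsetP => chi; rewrite inE => /andP[h /eqP].
  exact: invariant_tperm.
rewrite -(cardsID E I1) leq_add//.
  by rewrite (leq_trans _ EI)// subset_leq_card// finset.subsetIr.
rewrite (leq_trans _ EI)//.
have [->|[chi0]] := finset.set_0Vmem (I1 :\: E); first by rewrite cards0.
rewrite !inE => /andP[]; rewrite negb_and => + h0; rewrite h0 /= => xy0.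
have {}h0 : chi0 \in I1 by rewrite inE.
pose f (chi : {ffun 'I_n -> bool}) : {ffun 'I_n -> bool} := [ffun z => chi z (+) chi0 z].
have finj : injective f.
  move=> c c' /ffunP e; apply/ffunP => z; have := e z; rewrite !ffunE => /eqP.
  by rewrite (inj_eq (can_inj (addbK _))) => /eqP.
rewrite -(card_imset _ finj); apply: subset_leq_card; apply/fintype.subsetP => c.
case/imsetP=> chi; rewrite finset.in_setD => /andP[cE cI] ->.
rewrite inE; apply/andP; split.
  apply/invariant_labelsP => z; rewrite !ffunE.
  have /invariant_labelsP h1 := cI; have /invariant_labelsP h2 := h0.
  by rewrite (h1 z).1 (h1 z).2 (h2 z).1 (h2 z).2.
move: cE; rewrite inE cI /= => xy.
rewrite !ffunE; move: xy xy0.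
by case: (chi x); case: (chi y); case: (chi0 x); case: (chi0 y).
Qed.

(** A labelling invariant for the product with the transposition is constant on the
    cycles of its composite with [sigma], hence has the same value at [x] and
    [y]. *)
Lemma components_tperm_same (x y : 'I_n) alpha :
  x \in porbit ((tperm x y * alpha) * sigma)%g y ->
  (components (tperm x y * alpha)%g <= components alpha)%N.
Proof.
move=> xy; rewrite -[leqRHS]add0n; apply: leq_components; rewrite expn0 mul1n.
apply: subset_leq_card; apply/fintype.subsetP => chi h.
apply: (invariant_tperm h); move: xy; apply: (@porbit_invariant _ _ _ chi) => z.
by rewrite permM; have /invariant_labelsP h' := h; rewrite (h' _).1 (h' _).2.
Qed.

(** Induction on the number of transpositions needed to write [alpha].  Splitting
    off a transposition [tperm x y] adds a cycle to [alpha].  If it splits a cycle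
    of [alpha * sigma] as well, the number of components may grow by one, which
    makes room for two; if it joins two of them, these changes cancel and the
    components do not grow. *)
Lemma euler_le alpha :
  (#|porbits alpha| + #|porbits sigma| + #|porbits (alpha * sigma)%g|
     <= n + 2 * components alpha)%N.
Proof.
have arith1 (a t at' bt c1 c2 : nat) : (at' + 0 = bt + 1 -> a.+1 + t + bt <= n + 2 * c1 ->
    c1 <= c2 -> a + t + at' <= n + 2 * c2)%N by lia.
have arith2 (a t at' bt c1 c2 : nat) : (at' + 2 = bt + 1 -> a.+1 + t + bt <= n + 2 * c1 ->
    c1 <= 1 + c2 -> a + t + at' <= n + 2 * c2)%N by lia.
have [k] := ubnP (n - #|porbits alpha|); elim: k alpha => // k IH alpha.
rewrite ltnS => lek.
have [->|a1] := eqVneq alpha 1%g.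
  rewrite mul1g.
  have -> : #|porbits (1%g : 'S_n)| = n.
    rewrite /porbits card_imset ?cardsT ?card_ord// => x y /eqP.
    by rewrite eq_porbit_mem => /porbitP[i ->]; rewrite expg1n perm1.
  by rewrite -addnA leq_add2l addnn -mul2n leq_mul2l leq_porbits_components1.
have [x ax] : exists x, alpha x != x.
  apply/existsP; rewrite -negb_forall; apply: contra a1 => /forallP h.
  by apply/eqP/permP => z; rewrite perm1 (eqP (h z)).
pose y := alpha x; pose b := (tperm x y * alpha)%g.
have xy : x != y by rewrite eq_sym.
have bc : #|porbits b| = #|porbits alpha|.+1.
  have := porbits_mul_tperm alpha x y; rewrite /= -/b xy addn1.
  by rewrite porbit_sym mem_porbit1 addn0.
have tb : (tperm x y * b = alpha)%g by rewrite /b mulgA tperm2 mul1g.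
have ble : (#|porbits b| <= n)%N by rewrite (leq_trans (leq_imset_card _ _))// card_ord.
have lt : (n - #|porbits b| < k)%N by rewrite bc; rewrite bc in ble; lia.
have := IH b lt; have := porbits_mul_tperm (b * sigma)%g x y.
rewrite /= mulgA tb xy bc.
have [xin|xout] := boolP (x \in porbit (b * sigma)%g y).
  move=> e1 e2; have := components_tperm_same xin; rewrite -/b => e3.
  exact: (arith1 _ _ _ _ _ _ e1 e2 e3).
move=> e1 e2; exact: (arith2 _ _ _ _ _ _ e1 e2 (components_tperm_le x y alpha)).
Qed.

(** The signature of a permutation is the parity of [n] minus its number of
    cycles. *)
Lemma euler_even alpha :
  ~~ odd (n + 2 + (#|porbits alpha| + #|porbits sigma| + #|porbits (alpha * sigma)%g|)).
Proof.
have := odd_permM alpha sigma; rewrite /odd_perm !card_ord !oddD /=.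
by do 4 case: (odd _).
Qed.

Hypothesis n_gt0 : (0 < n)%N.

Lemma mem_orbit_connect alpha x y :
  (y \in orbit 'P <<[set sigma; alpha]>>%g x) = connect (dart_edge alpha) x y.
Proof.
set G := <<_>>%g; have sG : sigma \in G by rewrite mem_gen// !inE eqxx.
have aG : alpha \in G by rewrite mem_gen// !inE eqxx orbT.
apply/idP/idP => [|/connectP[p + ->]].
  pose S := [set z | connect (dart_edge alpha) x z].
  have act : [acts G, on S | 'P].
    rewrite gen_subG; apply/fintype.subsetP => h hsa; rewrite !inE /=.
    apply/fintype.subsetP => z; rewrite !inE => cz.
    apply: (connect_trans cz); apply: connect1.
    by move: hsa; rewrite !inE /dart_edge /= apermE => /orP[]/eqP ->; rewrite eqxx ?orbT.
  have := acts_sub_orbit x act; rewrite inE connect0 => /fintype.subsetP h /h.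
  by rewrite inE.
elim: p x => [|z p IH] x /=; first by rewrite orbit_refl.
case/andP=> xz /IH; suff zx : z \in orbit 'P G x by rewrite (orbit_eqP zx).
case/or4P: xz => /eqP ->; first exact: mem_orbit.
- exact: mem_orbit.
- by rewrite orbit_sym; exact: mem_orbit.
- by rewrite orbit_sym; exact: mem_orbit.
Qed.

Lemma hypermap_components alpha : hypermap sigma alpha = (components alpha == 1%N).
Proof.
pose e := dart_edge alpha; pose o : 'I_n := Ordinal n_gt0.
have ro : roots e (fingraph.root e o) by rewrite roots_root//; exact: dart_connect_sym.
apply/idP/idP => [/imsetP[x _ xo]|].
  have cx y : connect e x y by rewrite -mem_orbit_connect -xo inE.
  apply/eqP; apply: (@fintype.eq_card1 _ (fingraph.root e x)) => y; rewrite [in RHS]inE.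
  apply/idP/eqP => [|->]; last by apply: roots_root; exact: dart_connect_sym.
  rewrite /in_mem /= /roots => /eqP <-; apply/esym/eqP.
  by rewrite root_connect ?cx//; exact: dart_connect_sym.
move=> /eqP/mem_card1[r rP].
apply/imsetP; exists o; rewrite ?inE//; apply/finset.setP => y.
rewrite inE mem_orbit_connect -root_connect; last exact: dart_connect_sym.
have h z : fingraph.root e z = r.
  have : roots e (fingraph.root e z) by rewrite roots_root//; exact: dart_connect_sym.
  by move=> rz; have := rP (fingraph.root e z); rewrite [in RHS]inE => hr; apply/eqP; rewrite -hr; exact: rz.
by rewrite !h eqxx.
Qed.

(** Euler's characteristic is even by [euler_even] and at most 2, for one
    component, by [euler_le]. *)
Lemma hypermap_genus alpha : hypermap sigma alpha -> exists g, has_genus sigma alpha g.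
Proof.
rewrite hypermap_components => /eqP c1; have := euler_le alpha; have := euler_even alpha.
rewrite c1 muln1 /has_genus.
have ar (b : nat) : ~~ odd (n + 2 + b) -> (b <= n + 2)%N ->
    (b + 2 * ((n + 2 - b)./2))%N = (n + 2)%N by lia.
move=> ev le; eexists; apply/eqP; exact: (ar _ ev le).
Qed.
End Components.

(** * The logarithm of a formal power series *)

Section FpsExp.
Variables (K : numFieldType) (m : nat).
Implicit Types f g h Z : fps K m.

Let ev (B : nat) (a : {ffun 'I_m -> 'I_B}) : mindex m := [ffun j => nat_of_ord (a j)].

Lemma mdeg0P (k : mindex m) : (mdeg k == 0%N) = (k == [ffun=> 0%N]).
Proof.
rewrite /mdeg sum_nat_eq0; apply/forallP/eqP => [h|-> j]; last by rewrite ffunE.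
by apply/ffunP => j; rewrite ffunE; apply/eqP; exact: h.
Qed.

Lemma fps_mul1 g : fps_mul (@fps_one K m) g =1 g.
Proof.
move=> k; rewrite /fps_mul.
have kb j : (k j < (mdeg k).+1)%N by rewrite ltnS leq_mdeg.
pose a0 : {ffun 'I_m -> 'I_(mdeg k).+1} := [ffun=> ord0].
pose b0 : {ffun 'I_m -> 'I_(mdeg k).+1} := [ffun j => Ordinal (kb j)].
rewrite (bigD1 (a0, b0))/=; last by apply/forallP => j; rewrite !ffunE.
rewrite big1 ?addr0 => [|[a b] /andP[/forallP ab ne] /=].
  have -> : [ffun j => nat_of_ord (b0 j)] = k by apply/ffunP => j; rewrite !ffunE.
  have /eqP -> : [ffun j => nat_of_ord (a0 j)] == [ffun=> 0%N] :> mindex m.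
    by apply/eqP/ffunP => j; rewrite !ffunE.
  by rewrite /fps_one mdeg0P eqxx mul1r.
rewrite /fps_one mdeg0P; case: eqP => [a00|_]; last by rewrite mul0r.
case/negP: ne; apply/eqP; congr pair.
  by apply/ffunP => j; apply: val_inj; have /ffunP/(_ j) := a00; rewrite !ffunE.
apply/ffunP => j; apply: val_inj; rewrite !ffunE /= -(eqP (ab j)) /=.
by have /ffunP/(_ j) := a00; rewrite !ffunE => ->.
Qed.

Lemma eq_fps_mul f f' g g' : f =1 f' -> g =1 g' -> fps_mul f g =1 fps_mul f' g'.
Proof. by move=> ef eg k; apply: eq_bigr => ab _; rewrite ef eg. Qed.

Lemma fps_mulDl f g h k :
  fps_mul (fun k => f k + g k) h k = fps_mul f h k + fps_mul g h k.
Proof. by rewrite /fps_mul -big_split; apply: eq_bigr => ab _; rewrite mulrDl. Qed.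

Lemma fps_mul_sumr f (B : nat) (c : 'I_B -> K) (G : 'I_B -> fps K m) k :
  fps_mul f (fun k => \sum_n c n * G n k) k = \sum_n c n * fps_mul f (G n) k.
Proof.
rewrite /fps_mul; under eq_bigr do rewrite mulr_sumr.
rewrite exchange_big; apply: eq_bigr => n _; rewrite mulr_sumr.
by apply: eq_bigr => ab _; rewrite mulrCA.
Qed.

(** The binomial formula, with a common bound [B] of the summation that allows for
    the same polynomial expression in all exponents. *)
Lemma fps_exp_binomial f kappa B k : (kappa < B)%N ->
  fps_exp (fun k => @fps_one K m k + f k) kappa k
  = \sum_(n < B) 'C(kappa, n)%:R * fps_exp f n k.
Proof.
elim: kappa B k => [|kappa IH] [//|B] k.
  move=> _; rewrite big_ord_recl big1 ?addr0 => [|n _]; first by rewrite bin0 mul1r.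
  by rewrite bin0n mul0r.
rewrite ltnS => kB; rewrite /fps_exp iterS -/(fps_exp _ kappa).
rewrite fps_mulDl fps_mul1 (IH B.+1)//; last exact: ltnW.
rewrite (@eq_fps_mul f f _ (fun k => \sum_(n < B) 'C(kappa, n)%:R * fps_exp f n k))//; last first.
  by move=> k'; exact: IH.
rewrite fps_mul_sumr big_ord_recl [RHS]big_ord_recl !bin0 -addrA; congr (_ + _).
rewrite -big_split; apply: eq_bigr => n _.
by rewrite !lift0 binS natrD mulrDl.
Qed.

Lemma fps_sum_finite (F : nat -> fps K m) k B :
  (forall n, (B <= n)%N -> F n k = 0) -> fps_sum F k = \sum_(n < B) F n k.
Proof.
move=> FB; rewrite /fps_sum (fsbig_ord _ B (F ^~ k)); apply/esym/fsbig_widen => //.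
by move=> n /= [_ /negP]; rewrite -leqNgt; exact: FB.
Qed.

(** The binomial coefficient ['C(X, n)] as a polynomial in [X]. *)
Definition falling_poly (n : nat) : {poly K} :=
  (n`!%:R)^-1 *: \prod_(i < n) ('X - i%:R%:P).

Lemma fact_neq0 n : n`!%:R != 0 :> K.
Proof. by rewrite pnatr_eq0 -lt0n fact_gt0. Qed.

Lemma horner_falling n kappa : (falling_poly n).[kappa%:R] = 'C(kappa, n)%:R.
Proof.
rewrite /falling_poly hornerZ horner_prod.
have -> : \prod_(i < n) ('X - i%:R%:P).[kappa%:R] = (kappa ^_ n)%:R :> K.
  elim: n => [|n IH]; first by rewrite big_ord0 ffactn0.
  rewrite big_ord_recr /= IH ffactnSr natrM hornerXsubC.
  have [le|lt] := leqP n kappa; first by rewrite natrB.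
  by rewrite ffact_small// !mul0r.
by rewrite -bin_ffact natrM mulrC mulfK// fact_neq0.
Qed.

(** The logarithm is the derivative at [0] of the power in its exponent: the
    coefficients of [ln (1 + z)] are the linear coefficients of the binomial
    coefficients ['C(X, n)]. *)
Lemma coef1_falling n : (falling_poly n)`_1 = fps_ln1p n.
Proof.
rewrite /falling_poly coefZ /fps_ln1p; case: n => [|n].
  by rewrite big_ord0 coefC mulr0.
rewrite big_ord_recl subr0 coefXM /= -horner_coef0 horner_prod.
have -> : \prod_(i < n) ('X - (bump 0 i)%:R%:P).[0] = (-1) ^+ n * n`!%:R :> K.
  elim: n => [|n IH]; first by rewrite big_ord0 expr0 mul1r.
  by rewrite big_ord_recr /= IH hornerXsubC sub0r factS natrM exprS /bump leq0n add1n; ring.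
rewrite factS natrM invfM !exprS.
have := fact_neq0 n; have : n.+1%:R != 0 :> K by rewrite pnatr_eq0. 
by move: (n.+1%:R : K) (n`!%:R : K) => a b h1 h2; field; rewrite h1 h2.
Qed.

(** As [(1 + f) ^ X = exp (X * ln (1 + f))], a coefficient of a power of [1 + f] is
    a polynomial in the exponent, the linear term of which is the coefficient of
    the logarithm.  The polynomial is determined by its values at the positive
    integers, so that any [p] with these values will do. *)
Lemma fps_log_coef f k (p : {poly K}) : f [ffun=> 0%N] = 0 ->
  (forall kappa, fps_exp (fun k => @fps_one K m k + f k) kappa.+1 k = p.[kappa.+1%:R]) ->
  fps_comp fps_ln1p f k = p`_1.
Proof.
move=> f0 hp; pose B := (mdeg k).+1.
have small n : (B <= n)%N -> fps_exp f n k = 0 by move=> h; exact: fps_exp_small.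
rewrite /fps_comp (@fps_sum_finite _ _ B) => [|n /small h]; last by rewrite /fps_scale h mulr0.
pose q : {poly K} := \sum_(n < B) fps_exp f n k *: falling_poly n.
have qE kappa : q.[kappa.+1%:R] = p.[kappa.+1%:R].
  rewrite -hp horner_sum; pose M := maxn B kappa.+2.
  rewrite (@fps_exp_binomial _ _ M) ?leq_maxr//.
  have BM : (B <= M)%N by rewrite leq_maxl.
  rewrite (big_ord_widen _ (fun n => (fps_exp f n k *: falling_poly n).[kappa.+1%:R]) BM).
  rewrite big_mkcond; apply: eq_bigr => n _; case: ltnP => [_|/small ->]; last by rewrite mulr0.
  by rewrite hornerZ horner_falling mulrC.
have -> : p = q.
  apply/eqP; rewrite -subr_eq0; apply/negPn/negP => ne.
  (* Two polynomials that agree at more points than the size of their difference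
   are equal. *)
pose s := [seq (i.+1)%:R : K | i <- iota 0 (size (p - q))].
  have us : uniq s by rewrite map_inj_uniq ?iota_uniq// => x y /eqP; rewrite eqr_nat eqSS => /eqP.
  have rs : all (root (p - q)) s.
    by apply/allP => x /mapP[i _ ->]; rewrite /root hornerD hornerN qE subrr.
  by have := max_poly_roots ne rs us; rewrite size_map size_iota ltnn.
rewrite coef_sum; apply: eq_bigr => n _.
by rewrite coefZ coef1_falling /fps_scale mulrC.
Qed.
End FpsExp.

(** * Powers of exponential generating series *)

Section Types.
Variables (L : finType) (m : nat) (tau : L -> 'I_m).

(** The multi-index of a set of stars, when [tau] tells the monomial of each
    star. *)
Definition type_of (S : {set L}) : mindex m := [ffun j => #|[set i in S | tau i == j]|].

Lemma mdeg_type_of (S : {set L}) : mdeg (type_of S) = #|S|.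
Proof.
rewrite /mdeg -sum1_card (partition_big tau xpredT)//=; apply: eq_bigr => j _.
by rewrite ffunE -sum1_card; apply: eq_bigl => i; rewrite inE.
Qed.

Lemma type_ofD (A S : {set L}) (j : 'I_m) : S \subset A -> type_of (A :\: S) j = (type_of A j - type_of S j)%N.
Proof.
move=> SA; rewrite !ffunE -(cardsID S [set i in A | tau i == j]).
have -> : [set i in A | tau i == j] :&: S = [set i in S | tau i == j].
  apply/finset.setP => i; rewrite !inE; case: (boolP (i \in S)) => // iS; rewrite ?andbF// ?andbT.
  by rewrite (fintype.subsetP SA).
rewrite addKn; apply: eq_card => i; rewrite !inE -andbA; congr (_ && _).
Qed.

Lemma leq_type_of (A S : {set L}) (j : 'I_m) : S \subset A -> (type_of S j <= type_of A j)%N.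
Proof.
move=> SA; rewrite !ffunE; apply: subset_leq_card; apply/fintype.subsetP => i.
by rewrite !inE => /andP[/(fintype.subsetP SA) -> ->].
Qed.

Lemma sum_sets (K : nmodType) (F : {ffun L -> bool} -> K) (Q : pred {ffun L -> bool}) :
  \sum_(b | Q b) F b
  = \sum_(S : {set L} | Q [ffun i => i \in S]) F [ffun i => i \in S].
Proof.
rewrite (reindex (fun S : {set L} => [ffun i => i \in S]))//.
apply: onW_bij; exists (fun b : {ffun L -> bool} => [set i | b i]) => [S|b].
  by apply/finset.setP => i; rewrite inE ffunE.
by apply/ffunP => i; rewrite ffunE inE.
Qed.

Let fib (j : 'I_m) : {set L} := [set i | tau i == j].

(** A subset of [A] is chosen independently inside each fibre of [tau]. *)
Lemma card_type_of (A : {set L}) (a : mindex m) :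
  #|[set S : {set L} | (S \subset A) && (type_of S == a)]|
  = (\prod_j 'C(type_of A j, a j))%N.
Proof.
have bigN (J : finType) (u v : pred J) :
    (\sum_(j | u j) (v j : nat) = #|[set j | u j && v j]|)%N.
  by rewrite -sum1dep_card big_mkcondr; apply: eq_bigr => j _; case: (v j).
pose phi j (b : {ffun L -> bool}) : nat :=
  ([set i | b i && (tau i == j)] \subset A) && (#|[set i | b i && (tau i == j)]| == a j).
have loc j (b b' : {ffun L -> bool}) : xpredT j ->
    (forall i, tau i = j -> b i = b' i) -> phi j b = phi j b'.
  move=> _ h; rewrite /phi.
  have -> // : [set i | b i && (tau i == j)] = [set i | b' i && (tau i == j)].
  apply/finset.setP => i; rewrite !inE.
  by case: eqP => [/h ->|]; rewrite ?andbF.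
have := prod_sum_regroup false loc; rewrite /= => /esym h.
have setid (S : {set L}) j : [set i | [ffun i => i \in S] i && (tau i == j)] = S :&: fib j.
  by apply/finset.setP => i; rewrite !inE ffunE.
apply: etrans (etrans h _) => {h}.
  rewrite sum_sets -sum1dep_card [LHS]big_mkcond [RHS]big_mkcond.
  apply: eq_bigr => S _; rewrite off_supportT.
  have -> : (S \subset A) && (type_of S == a) = [forall j, (S :&: fib j \subset A) && (#|S :&: fib j| == a j)].
    apply/andP/forallP => [[SA /eqP <-] j|hj].
      rewrite (fintype.subset_trans (finset.subsetIl _ _) SA) ffunE.
      by apply/eqP/eq_card => i; rewrite !inE.
    split.
      apply/fintype.subsetP => i iS; have /andP[/fintype.subsetP hA _] := hj (tau i).
      by apply: hA; rewrite !inE iS eqxx.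
    apply/eqP/ffunP => j; rewrite ffunE; have /andP[_ /eqP <-] := hj j.
    by apply: eq_card => i; rewrite !inE.
  rewrite /phi; under [RHS]eq_bigr do rewrite setid.
  case: forallP => [hj|hj]; first by rewrite big1// => j _; rewrite hj.
  have [j jP] : exists j, ~~ ((S :&: fib j \subset A) && (#|S :&: fib j| == a j)).
    by apply/existsP; rewrite -negb_forall; apply/forallP.
  by rewrite (bigD1 j)//= (negbTE jP) mul0r.
apply: eq_bigr => j _; rewrite sum_sets bigN.
have -> : type_of A j = #|A :&: fib j| by rewrite ffunE; apply: eq_card => i; rewrite !inE.
rewrite -cards_draws; apply: eq_card => S; rewrite !inE setid finset.subsetI.
apply/andP/andP => [[/off_supportP hS /andP[SA /eqP <-]]|[/andP[SA Sj] /eqP <-]].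
  have Sj : S \subset fib j.
    apply/fintype.subsetP => i iS; rewrite inE; apply/negP => /negP /hS.
    by rewrite ffunE iS.
  by rewrite -{1 3}(finset.setIidPl Sj) SA Sj.
rewrite (finset.setIidPl Sj) SA eqxx; split=> //; apply/off_supportP => i ij.
by rewrite ffunE; apply: contraNF ij => /(fintype.subsetP Sj); rewrite inE.
Qed.

Variables (K : numFieldType) (z : mindex m -> K).

(** The label [ord0] stands for the elements outside of [A], so that [A] is
    labelled with [kappa] labels. *)
Definition labelled_sum kappa (A : {set L}) : K :=
  \sum_(chi : {ffun L -> 'I_kappa.+1} | [forall i, (chi i == ord0) == (i \notin A)])
    \prod_(c < kappa) z (type_of [set i | chi i == lift ord0 c]).

Lemma labelled_sum0 A : labelled_sum 0 A = (A == finset.set0)%:R.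
Proof.
rewrite /labelled_sum; under eq_bigr do rewrite big_ord0.
have [->|/set0Pn[i iA]] := eqVneq A finset.set0; last first.
  by rewrite big_pred0// => chi; apply/forallP => /(_ i); rewrite iA ord1 eqxx.
rewrite (big_pred1 [ffun=> ord0])// => chi; apply/forallP/eqP => [_|-> i].
  by apply/ffunP => i; rewrite ffunE ord1.
by rewrite ffunE inE eqxx.
Qed.

(** Splitting off the set [S] of the elements that carry the first label. *)
Lemma labelled_sumS kappa A : labelled_sum kappa.+1 A
  = \sum_(S : {set L} | S \subset A) z (type_of S) * labelled_sum kappa (A :\: S).
Proof.
pose one : 'I_kappa.+2 := lift ord0 ord0.
have one0 : (one == ord0) = false by [].
have lift0E (c : 'I_kappa.+1) : (lift one c == ord0) = (c == ord0).
  by rewrite -!val_eqE /= /bump; case: (val c).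
have lift1E (c : 'I_kappa.+1) : (lift one c == one) = false by rewrite eq_sym (negbTE (neq_lift _ _)).
have liftS (c : 'I_kappa) : lift ord0 (lift ord0 c) = lift one (lift ord0 c).
  by apply: val_inj.
have liftC (c c' : 'I_kappa.+1) : (lift one c == lift one c') = (c == c').
  by rewrite (inj_eq (@lift_inj _ _)).
rewrite /labelled_sum (partition_big (fun chi : {ffun L -> 'I_kappa.+2} => [set i | chi i == one])
  (fun S => S \subset A)) /=; last first.
  move=> chi /forallP h; apply/fintype.subsetP => i; rewrite inE => /eqP e.
  by have := h i; rewrite e one0; case: (i \in A).
apply: eq_bigr => S SA; rewrite mulr_sumr.
pose h (chi : {ffun L -> 'I_kappa.+1}) : {ffun L -> 'I_kappa.+2} :=
  [ffun i => if i \in S then one else lift one (chi i)].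
pose h' (chi : {ffun L -> 'I_kappa.+2}) : {ffun L -> 'I_kappa.+1} :=
  [ffun i => odflt ord0 (unlift one (chi i))].
have hS chi : [set i | h chi i == one] = S.
  by apply/finset.setP => i; rewrite inE ffunE; case: ifP => _; rewrite ?eqxx ?lift1E.
rewrite (reindex_onto h h') /=; last first.
  move=> chi /andP[_ /eqP eS]; apply/ffunP => i; rewrite !ffunE -eS inE.
  case: eqP => [-> //|/eqP ne].
  by rewrite eq_sym in ne; have [c ec ->] := unlift_some ne.
have hE (chi : {ffun L -> 'I_kappa.+1}) : (forall i, i \in S -> chi i = ord0) -> h' (h chi) = chi.
  move=> hc; apply/ffunP => i; rewrite !ffunE; case: ifP => [iS|_].
    by rewrite unlift_none hc.
  by rewrite liftK.
apply: eq_big => [chi|chi /andP[_ /eqP hh]].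
  rewrite hS eqxx andbT; apply/andP/forallP => [[/forallP hA /eqP hh] i|hA].
    have := hA i; rewrite !inE ffunE; case: ifP => [iS _|iS]; last by rewrite lift0E.
    by rewrite -hh !ffunE iS unlift_none eqxx.
  split.
    apply/forallP => i; have := hA i; rewrite !inE ffunE; case: ifP => [iS _|iS].
      by rewrite (fintype.subsetP SA).
    by rewrite lift0E.
  apply/eqP/hE => i iS; have := hA i; by rewrite !inE iS /= => /eqP/eqP.
rewrite big_ord_recl hS; congr (_ * _); apply: eq_bigr => c _; congr (z (type_of _)).
apply/finset.setP => i; rewrite !inE ffunE liftS; case: ifP => [iS|_]; last by rewrite liftC.
rewrite eq_sym lift1E -hh !ffunE iS unlift_none /=.
by [].
Qed.

Lemma labelled_sumT kappa : labelled_sum kappa.+1 [set: L]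
  = \sum_(chi : {ffun L -> 'I_kappa.+1}) \prod_c z (type_of [set i | chi i == c]).
Proof.
rewrite /labelled_sum.
pose h (chi : {ffun L -> 'I_kappa.+1}) : {ffun L -> 'I_kappa.+2} := [ffun i => lift ord0 (chi i)].
pose h' (chi : {ffun L -> 'I_kappa.+2}) : {ffun L -> 'I_kappa.+1} :=
  [ffun i => odflt ord0 (unlift ord0 (chi i))].
rewrite (reindex_onto h h') /=; last first.
  move=> chi /forallP hc; apply/ffunP => i; rewrite !ffunE.
  have ne : ord0 != chi i by rewrite eq_sym; move: (hc i); rewrite !inE /= => /eqP ->.
  by have [c ec ->] := unlift_some ne.
apply: eq_big => [chi|chi _].
  apply/andP; split; first by apply/forallP => i; rewrite !inE ffunE.
  by apply/eqP/ffunP => i; rewrite !ffunE liftK.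
apply: eq_bigr => c _; congr (z (type_of _)); apply/finset.setP => i.
by rewrite !inE ffunE (inj_eq (@lift_inj _ _)).
Qed.

(** Exponential generating series multiply by distributing elements: the quotient
    of the factorials in a product counts the subsets of given type, by
    [card_type_of].  Hence the [kappa]-th power distributes the elements of [A]
    over [kappa] labels. *)
Lemma fps_exp_type (Z : fps K m) (u : K) kappa (A : {set L}) :
  (forall k, Z k = u ^+ mdeg k / (mfact k)%:R * z k) ->
  fps_exp Z kappa (type_of A)
  = u ^+ mdeg (type_of A) / (mfact (type_of A))%:R * labelled_sum kappa A.
Proof.
move=> ZE; elim: kappa A => [|kappa IH] A.
  rewrite labelled_sum0 /= /fps_one mdeg_type_of cards_eq0.
  case: eqP => [->|_]; last by rewrite mulr0.
  rewrite cards0 expr0 /mfact big1 ?invr1 ?mulr1// => j _.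
  by rewrite ffunE (_ : [set i in _ | _] = finset.set0) ?cards0//; apply/finset.setP => i; rewrite !inE.
set k := type_of A.
rewrite /fps_exp iterS -/(fps_exp Z kappa) /fps_mul labelled_sumS.
pose ev (a : {ffun 'I_m -> 'I_(mdeg k).+1}) : mindex m := [ffun j => nat_of_ord (a j)].
pose cut (S : {set L}) : {ffun 'I_m -> 'I_(mdeg k).+1} := [ffun j => inord (type_of S j)].
have cutE (S : {set L}) : S \subset A -> ev (cut S) = type_of S.
  move=> SA; apply/ffunP => j; rewrite ffunE [cut S j]ffunE inordK// ltnS.
  by apply: leq_trans (leq_mdeg k j); exact: leq_type_of.
rewrite mulr_sumr.
rewrite (partition_big (fun S => (cut S, cut (A :\: S)))
  (fun ab => [forall j, (ab.1 j + ab.2 j == k j)%N])) /=; last first.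
  move=> S SA; apply/forallP => j /=.
  have e1 := cutE _ SA; have e2 := cutE _ (finset.subsetDl A S).
  have := congr1 (fun f : mindex m => f j) e1; rewrite [ev _ _]ffunE => ->.
  have := congr1 (fun f : mindex m => f j) e2; rewrite [ev _ _]ffunE => ->.
  by rewrite type_ofD// subnKC// leq_type_of.
apply: eq_bigr => -[a b] /= /forallP ab.
have evab j : (ev a j + ev b j)%N = k j by rewrite [ev a j]ffunE [ev b j]ffunE; apply/eqP; exact: ab.
have cond (S : {set L}) : (S \subset A) && ((cut S, cut (A :\: S)) == (a, b)) = (S \subset A) && (type_of S == ev a).
  case: (boolP (S \subset A)) => //= SA; rewrite xpair_eqE.
  apply/andP/eqP => [[/eqP <- _]|e]; first by rewrite cutE.
  have eb : type_of (A :\: S) = ev b.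
    by apply/ffunP => j; rewrite type_ofD// e -/k -evab addKn.
  split; apply/eqP/ffunP => j; rewrite ffunE ?e ?eb ffunE; apply: val_inj; by rewrite /= inordK.
have evb (S : {set L}) : S \subset A -> type_of S = ev a -> type_of (A :\: S) = ev b.
  by move=> SA e; apply/ffunP => j; rewrite type_ofD// e -/k -evab addKn.
under [RHS]eq_bigl do rewrite cond.
have mf0 (c : mindex m) : (mfact c)%:R != 0 :> K.
  rewrite pnatr_eq0 -lt0n; apply: prodn_gt0 => j; exact: fact_gt0.
have kE : mdeg k = (mdeg (ev a) + mdeg (ev b))%N.
  by rewrite /mdeg -big_split; apply: eq_bigr => j _ /=; rewrite evab.
have binE : mfact k = (\prod_j 'C(k j, ev a j) * (mfact (ev a) * mfact (ev b)))%N.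
  rewrite /mfact -!big_split; apply: eq_bigr => j _ /=.
  have -> : k j = (ev a j + ev b j)%N by rewrite evab.
  by rewrite -(@bin_fact _ (ev a j)) ?leq_addr// addKn.
have term (S : {set L}) : (S \subset A) && (type_of S == ev a) ->
    u ^+ mdeg k / (mfact k)%:R * (z (type_of S) * labelled_sum kappa (A :\: S))
    = u ^+ mdeg (ev a) * z (ev a) * ((mfact (ev b))%:R / (mfact k)%:R) * fps_exp Z kappa (ev b).
  case/andP=> SA /eqP e; rewrite -(evb _ SA e) IH (evb _ SA e) e kE exprD.
  have := mf0 (ev b); have := mf0 k.
  by move: (_%:R : K) (_%:R : K) => x y x0 y0; field; rewrite x0 y0.
rewrite (eq_bigr _ term) big_const -/(ev a) -/(ev b).
rewrite (_ : #|_| = (\prod_j 'C(k j, ev a j))%N); last first.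
  by rewrite -card_type_of; apply: eq_card => S; rewrite !inE.
rewrite iter_addr_0 -[_ *+ (\prod_j _)%N]mulr_natl ZE.
have := mf0 k; rewrite binE !natrM; have := mf0 (ev a); have := mf0 (ev b).
move: (mfact (ev a))%:R (mfact (ev b))%:R (\prod_j 'C(k j, ev a j))%:R => x y w x0 y0 ne.
have w0 : w != 0 by apply: contraNneq ne => ->; rewrite mul0r.
by field; rewrite x0 y0 w0.
Qed.
End Types.

Import numFieldNormedType.Exports.
Local Open Scope sesquilinear_scope.

(** * Positive definite matrices *)

Section PosDef.
Variable R : rcfType.
Local Notation C := R[i].

Lemma hermsymmx_adj n (A : 'M[C]_n) : A \is hermsymmx -> A ^t* = A.
Proof. by move/is_hermitianmxP; rewrite expr0 scale1r => <-. Qed.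

Lemma adj_hermsymmx n (A : 'M[C]_n) : A ^t* = A -> A \is hermsymmx.
Proof. by move=> e; apply/is_hermitianmxP; rewrite expr0 scale1r e. Qed.

Definition sqnorm n (x : 'cV[C]_n) : C := (x ^t* *m x) 0 0.

Lemma sqnormE n (x : 'cV[C]_n) : sqnorm x = \sum_i `|x i 0| ^+ 2.
Proof. by rewrite /sqnorm mxE; apply: eq_bigr => i _; rewrite !mxE normCK mulrC. Qed.

Lemma sqnorm_gt0 n (x : 'cV[C]_n) : x != 0 -> 0 < sqnorm x.
Proof.
move=> x0; rewrite sqnormE lt_def sumr_ge0 ?andbT; last by move=> i _; rewrite exprn_ge0.
apply: contraNneq x0 => e; apply/eqP/colP => i; rewrite mxE; apply/eqP.
move/eqP: e; rewrite psumr_eq0; last by move=> j _; rewrite exprn_ge0.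
by move=> /allP/(_ i (mem_index_enum _)); rewrite /= sqrf_eq0 normr_eq0.
Qed.

Lemma posdef_spectral n (A : 'M[C]_n) : posdefmx A ->
  exists (Q : 'M[C]_n) (D : 'rV[C]_n), [/\ Q \is unitarymx,
    forall i, 0 < D 0 i & A = Q ^t* *m diag_mx D *m Q].
Proof.
move=> [Ah Ap]; exists (spectralmx A), (spectral_diag A).
have Qu := spectral_unitarymx A.
have /hermitian_normalmx /orthomx_spectralP AE := Ah.
rewrite -invmx_unitary//; split=> // i.
set Q := spectralmx A in Qu AE *; set D := spectral_diag A in AE *.
pose x : 'cV[C]_n := invmx Q *m delta_mx i 0.
have Qun := unitarymx_unit Qu.
have x0 : x != 0.
  apply: contraTneq isT => /(congr1 (mulmx Q)); rewrite mulKVmx// mulmx0.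
  by move=> /matrixP/(_ i 0); rewrite !mxE !eqxx => /eqP; rewrite oner_eq0.
have := Ap x x0.
have -> : x^t* = delta_mx 0 i *m Q.
  rewrite /x invmx_unitary// trmx_mul map_mxM trmxCK; congr (_ *m _).
  by apply/matrixP => k l; rewrite !mxE andbC rmorph_nat.
rewrite AE /x !mulmxA mulmxK// mulmxK//.
by rewrite -rowE -colE !mxE eqxx mulr1n.
Qed.

Lemma posdef_det n (A : 'M[C]_n) : posdefmx A -> 0 < \det A.
Proof.
move=> /posdef_spectral[Q [D [Qu Dp ->]]].
rewrite !det_mulmx mulrAC -det_mulmx det_diag.
have -> : Q^t* *m Q = 1%:M by rewrite -invmx_unitary// mulVmx// unitarymx_unit.
by rewrite det1 mul1r; apply: prodr_gt0.
Qed.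

Lemma posdef_unit n (A : 'M[C]_n) : posdefmx A -> A \in unitmx.
Proof. by move/posdef_det => d; rewrite unitmxE unitfE gt_eqF. Qed.

Lemma posdef_inv n (A : 'M[C]_n) : posdefmx A -> posdefmx (invmx A).
Proof.
move=> Ap; have Au := posdef_unit Ap; have [Ah pA] := Ap.
have iAh : (invmx A) ^t* = invmx A.
  by rewrite trmx_inv map_invmx hermsymmx_adj.
split; first exact: adj_hermsymmx.
move=> x x0; have y0 : invmx A *m x != 0.
  by apply: contra_neq x0 => /(congr1 (mulmx A)); rewrite mulKVmx// mulmx0.
have := pA _ y0.
by rewrite trmx_mul map_mxM -/(_ ^t*) iAh -!mulmxA mulKVmx// !mulmxA.
Qed.

(** After diagonalization, a constant below all eigenvalues works; the inverse of
    one plus the sum of their inverses is such a constant, even in dimension 0. *)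
Lemma posdef_coercive n (A : 'M[C]_n) : posdefmx A ->
  exists2 e : C, 0 < e & forall x : 'cV_n, e * sqnorm x <= (x ^t* *m A *m x) 0 0.
Proof.
move=> /posdef_spectral[Q [D [Qu Dp ->]]].
have S0 : 0 <= \sum_i (D 0 i)^-1 by apply: sumr_ge0 => i _; rewrite invr_ge0 ltW.
exists (1 + \sum_i (D 0 i)^-1)^-1; first by rewrite invr_gt0 ltr_pwDl.
move=> x; pose y := Q *m x.
have -> : sqnorm x = sqnorm y.
  rewrite /sqnorm /y trmx_mul map_mxM -mulmxA (mulmxA (Q^t*)) -invmx_unitary//.
  by rewrite mulVmx ?mul1mx// unitarymx_unit.
have -> : (x^t* *m (Q^t* *m diag_mx D *m Q) *m x) 0 0 = \sum_i D 0 i * `|y i 0| ^+ 2.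
  have -> : x^t* *m (Q^t* *m diag_mx D *m Q) *m x = y^t* *m diag_mx D *m y.
    by rewrite /y trmx_mul map_mxM !mulmxA.
  rewrite mul_mx_diag mxE; apply: eq_bigr => i _.
  by rewrite !mxE normCK; ring.
rewrite sqnormE mulr_sumr; apply: ler_sum => i _.
apply: ler_wpM2r; first by rewrite exprn_ge0.
rewrite -[leRHS]invrK lef_pV2 ?posrE ?invr_gt0 ?ltr_pwDl//.
rewrite (bigD1 i)//= addrCA lerDl addr_ge0// sumr_ge0// => j _.
by rewrite invr_ge0 ltW.
Qed.

Lemma form_bounded n (H : 'M[C]_n) (x : 'cV[C]_n) :
  `|(x ^t* *m H *m x) 0 0| <= (\sum_i \sum_j `|H i j|) * sqnorm x.
Proof.
have le1 i : `|x i 0| ^+ 2 <= sqnorm x.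
  rewrite sqnormE (bigD1 i)//= lerDl sumr_ge0// => j _; exact: exprn_ge0.
have le2 i j : `|x i 0| * `|x j 0| <= sqnorm x.
  have : `|x i 0| * `|x j 0| *+ 2 <= `|x i 0| ^+ 2 + `|x j 0| ^+ 2.
    by rewrite real_leif_mean_square_scaled ?normr_real.
  move=> h; rewrite -(ler_pMn2r (n := 2))// (le_trans h)// mulr2n.
  by rewrite lerD.
rewrite mxE (le_trans (ler_norm_sum _ _ _))// exchange_big mulr_suml ler_sum// => j _.
rewrite normrM [X in `|X| * _]mxE mulr_suml (le_trans (ler_wpM2r _ (ler_norm_sum _ _ _)))//.
rewrite mulr_suml ler_sum// => i _; rewrite !mxE normrM norm_conjC.
by rewrite mulrAC mulrC ler_wpM2l.
Qed.

(** The bound [posdef_coercive] of the quadratic form of [A] dominates [t]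
    times the bound [form_bounded] of the form of [H] when [t] is small. *)
Lemma posdef_open n (A H : 'M[C]_n) : posdefmx A -> H \is hermsymmx ->
  exists2 e : R, 0 < e & forall t : R, `|t| < e -> posdefmx (A - t%:C *: H).
Proof.
move=> Ap Hh; have [a a0 coer] := posdef_coercive Ap.
pose c : C := 1 + \sum_i \sum_j `|H i j|.
have c0 : 0 < c by rewrite ltr_pwDl// sumr_ge0// => i _; rewrite sumr_ge0.
have ac : 0 < a / c by rewrite divr_gt0.
have acE : (complex.Re (a / c))%:C = a / c by rewrite RRe_real// gtr0_real.
exists (complex.Re (a / c)); first by rewrite -ltcR acE.
move=> t te; have {}te : `|t|%:C < a / c by rewrite -acE ltcR.
have Ahh := hermsymmx_adj Ap.1; have Hhh := hermsymmx_adj Hh.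
split.
  apply: adj_hermsymmx; rewrite -[RHS]/(A - t%:C *: H) -{2}Ahh -{2}Hhh.
  apply/matrixP => i j; rewrite !mxE rmorphB rmorphM/=; congr (_ - _ * _).
  by rewrite -[LHS]/(conjc _) conjc_real.
move=> x x0; have xp := sqnorm_gt0 x0.
rewrite mulmxBr mulmxBl -scalemxAr -scalemxAl [ltRHS]mxE [X in _ < _ + X]mxE.
rewrite subr_gt0 (lt_le_trans _ (coer x))// [ltLHS]mxE.
set h := (_ *m x) 0 0.
have hr : h \is Num.real.
  apply/CrealP; have : (x^t* *m H *m x)^t* = x^t* *m H *m x.
    by rewrite !trmx_mul !map_mxM -!/(_ ^t*) Hhh trmxCK mulmxA.
  move=> e; rewrite /h -{2}e.
  transitivity (((x^t* *m H *m x)^T 0 0)^*); last by rewrite [RHS]mxE.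
  by rewrite [in RHS]mxE.
have thr : t%:C * h \is Num.real.
  by rewrite realM//; apply/complex_realP; exists t.
rewrite (le_lt_trans (real_ler_norm thr))// normrM.
have -> : `|t%:C| = `|t|%:C :> C by rewrite normc_def /= expr0n addr0 sqrtr_sqr.
apply: (@le_lt_trans _ _ (`|t|%:C * (c * sqnorm x))).
  rewrite ler_wpM2l ?ler0c// (le_trans (form_bounded H x))// ler_wpM2r ?(ltW xp)//.
  by rewrite lerDr.
by rewrite mulrA ltr_pM2r// -ltr_pdivlMr.
Qed.

End PosDef.

(** * Complex random variables *)

Lemma cReM (R : rcfType) (x y : R[i]) :
  complex.Re (x * y) = complex.Re x * complex.Re y - complex.Im x * complex.Im y.
Proof. by case: x y => [a b] [a' b']. Qed.

Lemma cImM (R : rcfType) (x y : R[i]) :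
  complex.Im (x * y) = complex.Re x * complex.Im y + complex.Im x * complex.Re y.
Proof. by case: x y => [a b] [a' b']. Qed.

Section Diff.
Context (R : realType) (d : measure_display) (T : measurableType d).
Variable P : probability T R.
Local Open Scope classical_set_scope.

Lemma integrable_dominated (Z G : T -> R) :
  measurable_fun setT Z -> P.-integrable setT (EFin \o G) ->
  (forall w, `|Z w| <= G w) -> P.-integrable setT (EFin \o Z).
Proof.
move=> mZ iG le; apply: (le_integrable _ _ _ iG) => //; first exact/measurable_EFinP.
move=> w _ /=; rewrite lee_fin (le_trans (le w))//; exact: ler_norm.
Qed.

(** The derivative in [t] of the integrand is bounded by [G] uniformly in [t] up to
    [u] in absolute value, and dominated convergence applies. *)
Lemma derive_laplace (Z X G : T -> R) (u : R) :
  0 < u -> measurable_fun setT Z -> measurable_fun setT X ->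
  P.-integrable setT (EFin \o G) ->
  (forall w, `|Z w| * expR (u * `|X w|) <= G w) ->
  (forall w, `|Z w * X w| * expR (u * `|X w|) <= G w) ->
  is_derive (0 : R) (1 : R) (fun t : R => (\int[P]_w (Z w * expR (t * X w)))%R)
    (\int[P]_w (Z w * X w))%R.
Proof.
move=> u0 mZ mX iG le0 le1.
pose f (t : R) w := Z w * expR (t * X w).
have df t w : is_derive t (1 : R) (f ^~ w) (Z w * X w * expR (t * X w)).
  rewrite /f; apply: is_derive_eq.
  by rewrite /GRing.scale /=; ring.
have d1 t w : partial1of2 f t w = Z w * X w * expR (t * X w).
  by rewrite partial1of2E; have [_ ->] := df t w.
have ex t w : `|t| < u -> expR (t * X w) <= expR (u * `|X w|).
  move=> tu; rewrite ler_expR (le_trans (ler_norm _))// normrM.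
  by rewrite ler_wpM2r// ltW.
have mf t : measurable_fun setT (f t).
  apply: measurable_funM => //; apply: measurableT_comp => //.
  exact: measurable_funM.
have I0 : `]- u, u[%classic (0 : R) by rewrite /= in_itv /= u0 oppr_lt0 u0.
have It t : `]- u, u[%classic t -> `|t| < u by rewrite /= in_itv/= ltr_norml.
have int_f t : `]- u, u[%classic t -> P.-integrable setT (EFin \o f t).
  move=> /It tu; apply: (integrable_dominated _ iG) => //= w.
  rewrite (le_trans _ (le0 w))// /f normrM ler_wpM2l//.
  by rewrite (ger0_norm (expR_ge0 _)) ex.
have G0 w : 0 <= G w by rewrite (le_trans _ (le0 w))// mulr_ge0// expR_ge0.
have Gub t w : `]- u, u[%classic t -> setT w -> `|partial1of2 f t w| <= G w.
  move=> /It tu _; rewrite d1 (le_trans _ (le1 w))// normrM ler_wpM2l//.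
  by rewrite (ger0_norm (expR_ge0 _)) ex.
have dv t w : `]- u, u[%classic t -> setT w -> derivable (f ^~ w) t 1.
  by move=> _ _; have [] := df t w.
have H1 := derivable_under_integral measurableT I0 int_f dv G0 iG Gub.
have H2 := differentiation_under_integral measurableT I0 int_f dv G0 iG Gub.
split=> //.
rewrite -derive1E H2; apply: eq_Rintegral => w _.
by rewrite d1 mul0r expR0 mulr1.
Qed.

Lemma RexpE (X : T -> R) : fine ('E_P[X])%E = (\int[P]_w X w)%R.
Proof. by rewrite unlock. Qed.

Lemma complex_expectationE (X : T -> R[i]) : complex_expectation P X
  = (\int[P]_w complex.Re (X w))%R +i* (\int[P]_w complex.Im (X w))%R.
Proof. by rewrite /complex_expectation !RexpE. Qed.

Definition cintegrable (X : T -> R[i]) : Prop :=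
  P.-integrable setT (EFin \o (fun w => complex.Re (X w))) /\
  P.-integrable setT (EFin \o (fun w => complex.Im (X w))).

Lemma cintegrable0 : cintegrable (fun=> 0).
Proof. by split; exact: integrable0. Qed.

Lemma cintegrableD X Y : cintegrable X -> cintegrable Y ->
  cintegrable (fun w => X w + Y w).
Proof.
move=> [X1 X2] [Y1 Y2]; split.
  rewrite (_ : _ \o _ = (EFin \o (fun w => complex.Re (X w))) \+ (EFin \o (fun w => complex.Re (Y w))))%E.
    exact: integrableD.
  by apply/funext => w /=; rewrite raddfD /= EFinD.
rewrite (_ : _ \o _ = (EFin \o (fun w => complex.Im (X w))) \+ (EFin \o (fun w => complex.Im (Y w))))%E.
  exact: integrableD.
by apply/funext => w /=; rewrite raddfD /= EFinD.
Qed.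

Lemma complex_expectationD X Y : cintegrable X -> cintegrable Y ->
  complex_expectation P (fun w => X w + Y w) =
  complex_expectation P X + complex_expectation P Y.
Proof.
move=> [X1 X2] [Y1 Y2]; rewrite !complex_expectationE.
under eq_Rintegral do rewrite raddfD /=.
under [X in _ +i* X]eq_Rintegral do rewrite raddfD /=.
by rewrite !RintegralD.
Qed.

Lemma integrable_scale (X : T -> R) (c : R) : P.-integrable setT (EFin \o X) ->
  P.-integrable setT (EFin \o (fun w => c * X w)).
Proof. by move=> iX; have := integrableZl measurableT c iX. Qed.

Lemma cintegrableZ (c : R[i]) X : cintegrable X -> cintegrable (fun w => c * X w).
Proof.
case: c => a b [X1 X2]; split.
  rewrite (_ : _ \o _ = (EFin \o (fun w => (a * complex.Re (X w))%R)) \- (EFin \o (fun w => (b * complex.Im (X w))%R)))%E.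
    by apply: integrableB => //; exact: integrable_scale.
  by apply/funext => w /=; case: (X w).
rewrite (_ : _ \o _ = (EFin \o (fun w => (a * complex.Im (X w))%R)) \+ (EFin \o (fun w => (b * complex.Re (X w))%R)))%E.
  by apply: integrableD => //; exact: integrable_scale.
by apply/funext => w /=; case: (X w).
Qed.

Lemma complex_expectationZ (c : R[i]) X : cintegrable X ->
  complex_expectation P (fun w => c * X w) = c * complex_expectation P X.
Proof.
case: c => a b [X1 X2]; rewrite !complex_expectationE.
under eq_Rintegral do rewrite cReM.
under [X in _ +i* X]eq_Rintegral do rewrite cImM.
by rewrite RintegralB ?RintegralD ?RintegralZl//; exact: integrable_scale.
Qed.

Lemma cintegrable_sum (I : Type) (s : seq I) (p : pred I) (X : I -> T -> R[i]) :
  (forall i, p i -> cintegrable (X i)) -> cintegrable (fun w => \sum_(i <- s | p i) X i w).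
Proof.
move=> iX; elim: s => [|i s IH].
  by under eq_fun do rewrite big_nil; exact: cintegrable0.
under eq_fun do rewrite big_cons.
case: (boolP (p i)) => // pi; apply: cintegrableD => //; exact: iX.
Qed.

Lemma complex_expectation_sum (I : Type) (s : seq I) (p : pred I) (X : I -> T -> R[i]) :
  (forall i, p i -> cintegrable (X i)) ->
  complex_expectation P (fun w => \sum_(i <- s | p i) X i w)
  = \sum_(i <- s | p i) complex_expectation P (X i).
Proof.
move=> iX; elim: s => [|i s IH].
  under eq_fun do rewrite big_nil.
  by rewrite big_nil complex_expectationE/= /Rintegral integral0.
under eq_fun do rewrite big_cons.
rewrite big_cons; case: (boolP (p i)) => // pi.
rewrite complex_expectationD ?IH//; first exact: iX.
exact: cintegrable_sum.
Qed.

End Diff.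

Section CMeasurable.
Context (R : realType) (d : measure_display) (T : measurableType d).
Local Open Scope classical_set_scope.

Definition cmeasurable (X : T -> R[i]) : Prop :=
  measurable_fun setT (fun w => complex.Re (X w)) /\
  measurable_fun setT (fun w => complex.Im (X w)).

Lemma cmeasurable_cst c : cmeasurable (fun=> c).
Proof. by split; exact: measurable_cst. Qed.

Lemma cmeasurableD X Y : cmeasurable X -> cmeasurable Y -> cmeasurable (fun w => X w + Y w).
Proof.
move=> [X1 X2] [Y1 Y2]; split.
  under eq_fun do rewrite raddfD /=; exact: measurable_funD.
under eq_fun do rewrite raddfD /=; exact: measurable_funD.
Qed.

Lemma cmeasurableM X Y : cmeasurable X -> cmeasurable Y -> cmeasurable (fun w => X w * Y w).
Proof.
move=> [X1 X2] [Y1 Y2]; split.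
  rewrite (_ : (fun w => _) = (fun w => complex.Re (X w) * complex.Re (Y w) - complex.Im (X w) * complex.Im (Y w))).
    by apply: measurable_funB; exact: measurable_funM.
  by apply/funext => w; case: (X w) (Y w) => [a b] [a' b'].
rewrite (_ : (fun w => _) = (fun w => complex.Re (X w) * complex.Im (Y w) + complex.Im (X w) * complex.Re (Y w))).
  by apply: measurable_funD; exact: measurable_funM.
by apply/funext => w; case: (X w) (Y w) => [a b] [a' b'].
Qed.

Lemma cmeasurable_sum (I : Type) (s : seq I) (p : pred I) (X : I -> T -> R[i]) :
  (forall i, p i -> cmeasurable (X i)) -> cmeasurable (fun w => \sum_(i <- s | p i) X i w).
Proof.
move=> iX; elim: s => [|i s IH].
  by under eq_fun do rewrite big_nil; exact: cmeasurable_cst.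
under eq_fun do rewrite big_cons.
case: (boolP (p i)) => // pi; apply: cmeasurableD => //; exact: iX.
Qed.

Lemma cmeasurable_prod (I : Type) (s : seq I) (p : pred I) (X : I -> T -> R[i]) :
  (forall i, p i -> cmeasurable (X i)) -> cmeasurable (fun w => \prod_(i <- s | p i) X i w).
Proof.
move=> iX; elim: s => [|i s IH].
  by under eq_fun do rewrite big_nil; exact: cmeasurable_cst.
under eq_fun do rewrite big_cons.
case: (boolP (p i)) => // pi; apply: cmeasurableM => //; exact: iX.
Qed.

End CMeasurable.

(** * Exponentially tilted expectations *)

Lemma tr_adj (R : rcfType) n (A : 'M[R[i]]_n) : \tr (A ^t*) = Num.conj (\tr A).
Proof. by rewrite /mxtrace rmorph_sum; apply: eq_bigr => a _; rewrite !mxE. Qed.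

Lemma adj_mulmx (R : rcfType) m n p (A : 'M[R[i]]_(m, n)) (B : 'M[R[i]]_(n, p)) :
  (A *m B) ^t* = B ^t* *m A ^t*.
Proof. by rewrite trmx_mul map_mxM. Qed.

Section L1.
Variable R : rcfType.
Implicit Types x y : R[i].

(** Used in place of the modulus because it is a sum of absolute values of real
    random variables, to which the theorems on real integrals apply. *)
Definition l1norm x : R := `|complex.Re x| + `|complex.Im x|.

Lemma l1norm_ge0 x : 0 <= l1norm x.
Proof. by rewrite addr_ge0. Qed.

Lemma l1normD x y : l1norm (x + y) <= l1norm x + l1norm y.
Proof. by rewrite /l1norm !raddfD /= addrACA lerD// ler_normD. Qed.

Lemma l1normM x y : l1norm (x * y) <= l1norm x * l1norm y.
Proof.
rewrite /l1norm cReM cImM mulrDl !mulrDr -!normrM.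
have := ler_normB (complex.Re x * complex.Re y) (complex.Im x * complex.Im y).
have := ler_normD (complex.Re x * complex.Im y) (complex.Im x * complex.Re y).
lra.
Qed.

Lemma l1norm_sum (I : Type) (s : seq I) (F : I -> R[i]) :
  l1norm (\sum_(i <- s) F i) <= \sum_(i <- s) l1norm (F i).
Proof.
elim/big_rec2: _ => [|i y z _ h]; first by rewrite /l1norm /= normr0 addr0.
by rewrite (le_trans (l1normD _ _))// lerD2l.
Qed.

Lemma Re_l1norm x : `|complex.Re x| <= l1norm x.
Proof. by rewrite lerDl. Qed.

Lemma Im_l1norm x : `|complex.Im x| <= l1norm x.
Proof. by rewrite lerDr. Qed.
End L1.

Lemma powD1_le_expR (R : realType) (k : nat) (e : R) : 0 < e ->
  exists2 c : R, 0 <= c & forall s, 0 <= s -> (1 + s) ^+ k <= c * expR (e * s).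
Proof.
move=> e0; pose f := e / k.+1%:R.
have f0 : 0 < f by rewrite divr_gt0.
exists ((1 + f^-1) ^+ k) => [|s s0]; first by rewrite exprn_ge0// addr_ge0// invr_ge0 ltW.
have h : 1 + s <= (1 + f^-1) * expR (f * s).
  rewrite (@le_trans _ _ ((1 + f^-1) * (1 + f * s)))//; last first.
    by rewrite ler_wpM2l ?expR_ge1Dx// addr_ge0// invr_ge0 ltW.
  rewrite mulrDl mul1r mulrDr mulr1 mulKf ?gt_eqF//.
  have : 0 <= f * s by rewrite mulr_ge0// ltW.
  have : 0 <= f^-1 by rewrite invr_ge0 ltW.
  lra.
rewrite (@le_trans _ _ (((1 + f^-1) * expR (f * s)) ^+ k))//.
  by rewrite lerXn2r// nnegrE; rewrite ?addr_ge0// ?mulr_ge0 ?expR_ge0 ?addr_ge0// invr_ge0 ltW.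
rewrite exprMn -expRM_natl ler_wpM2l//.
  by rewrite exprn_ge0// addr_ge0// invr_ge0 ltW.
rewrite ler_expR mulrCA mulrA ler_wpM2r// /f -mulrA ler_piMr ?(ltW e0)// mulrC.
by rewrite ler_pdivrMr// mul1r ler_nat.
Qed.

Section Tilt.
Context (R : realType) (d : measure_display) (T : measurableType d).
Variable P : probability T R.
Variables (N : nat) (W : T -> 'M[R[i]]_N).
Hypothesis hW : random_hermitian W.
Local Open Scope classical_set_scope.

Lemma random_entry a b : cmeasurable (fun w => W w a b).
Proof.
have [mW _] := hW; split => _ B mB; rewrite setTI.
  apply: (mW [set M : 'M[R[i]]_N | B (complex.Re (M a b))]).
  by apply: sub_sigma_algebra; exists a, b, B; split => //; left.
apply: (mW [set M : 'M[R[i]]_N | B (complex.Im (M a b))]).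
by apply: sub_sigma_algebra; exists a, b, B; split => //; right.
Qed.

Definition mass (w : T) : R := \sum_a \sum_b l1norm (W w a b).

Lemma mass_ge0 w : 0 <= mass w.
Proof. by apply: sumr_ge0 => a _; apply: sumr_ge0 => b _; exact: l1norm_ge0. Qed.

Lemma measurable_l1norm (X : T -> R[i]) : cmeasurable X ->
  measurable_fun setT (fun w => l1norm (X w)).
Proof.
by move=> [m1 m2]; apply: measurable_funD; apply: measurableT_comp.
Qed.

Lemma measurable_mass : measurable_fun setT mass.
Proof.
apply: measurable_sum => a; apply: measurable_sum => b.
exact/measurable_l1norm/random_entry.
Qed.

Lemma cmeasurable_tr (M : 'M[R[i]]_N) : cmeasurable (fun w => \tr (M *m W w)).
Proof.
apply: cmeasurable_sum => a _.
under eq_fun do rewrite mxE.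
apply: cmeasurable_sum => b _; apply: cmeasurableM; first exact: cmeasurable_cst.
exact: random_entry.
Qed.

Lemma l1norm_tr (M : 'M[R[i]]_N) : exists2 c : R, 0 <= c &
  forall w, l1norm (\tr (M *m W w)) <= c * mass w.
Proof.
exists (\sum_a \sum_b l1norm (M a b)) => [|w].
  by apply: sumr_ge0 => a _; apply: sumr_ge0 => b _; exact: l1norm_ge0.
rewrite (le_trans (l1norm_sum _ _))// mulr_suml ler_sum// => a _.
rewrite mxE (le_trans (l1norm_sum _ _))// mulr_suml ler_sum// => b _.
rewrite (le_trans (l1normM _ _))// ler_wpM2l ?l1norm_ge0//.
rewrite /mass (bigD1 b)//= (bigD1 a)//= -addrA lerDl addr_ge0//.
  by apply: sumr_ge0 => j _; exact: l1norm_ge0.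
by apply: sumr_ge0 => j _; apply: sumr_ge0 => k _; exact: l1norm_ge0.
Qed.

(** Polynomial growth in the entries of [W] is preserved by products, and is
    absorbed by an exponential of [mass]. *)
Definition tempered (Y : T -> R[i]) : Prop := cmeasurable Y /\
  exists (c : R) (k : nat), 0 <= c /\ forall w, l1norm (Y w) <= c * (1 + mass w) ^+ k.

Lemma tempered_cst z : tempered (fun=> z).
Proof.
split; first exact: cmeasurable_cst.
by exists (l1norm z), 0%N; split=> [|w]; [exact: l1norm_ge0|rewrite expr0 mulr1].
Qed.

Lemma tempered_tr M : tempered (fun w => \tr (M *m W w)).
Proof.
split; first exact: cmeasurable_tr.
have [c c0 h] := l1norm_tr M; exists c, 1%N; split=> // w.
by rewrite expr1 (le_trans (h w))// ler_wpM2l// lerDr.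
Qed.

Lemma temperedM Y Z : tempered Y -> tempered Z -> tempered (fun w => Y w * Z w).
Proof.
move=> [mY [c [k [c0 hY]]]] [mZ [e [l [e0 hZ]]]]; split; first exact: cmeasurableM.
exists (c * e), (k + l)%N; split=> [|w]; first exact: mulr_ge0.
rewrite (le_trans (l1normM _ _))// exprD mulrACA ler_pM ?l1norm_ge0//.
Qed.

Lemma tempered_prod (I : Type) (s : seq I) (p : pred I) (Y : I -> T -> R[i]) :
  (forall i, p i -> tempered (Y i)) -> tempered (fun w => \prod_(i <- s | p i) Y i w).
Proof.
move=> iX; elim: s => [|i s IH].
  by under eq_fun do rewrite big_nil; exact: tempered_cst.
under eq_fun do rewrite big_cons.
case: (boolP (p i)) => // pi; apply: temperedM => //; exact: iX.
Qed.

(** The density of the exponentially tilted law; its expectation is the Laplace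
    transform at [theta]. *)
Definition tilt (theta : 'M[R[i]]_N) (w : T) : R :=
  expR (complex.Re (\tr (theta *m W w))).

Lemma measurable_tilt theta : measurable_fun setT (tilt theta).
Proof. by apply: measurableT_comp => //; have [] := cmeasurable_tr theta. Qed.

Lemma tilt_line theta H (t : R) w :
  tilt (theta + t%:C *: H) w = tilt theta w * expR (t * complex.Re (\tr (H *m W w))).
Proof.
rewrite /tilt -expRD mulmxDl mxtraceD raddfD /= -scalemxAl mxtraceZ cReM /=.
by rewrite mul0r subr0.
Qed.

(** The integrability that permits differentiation of the Laplace transform at
    [theta], in all directions at once and any number of times. *)
Definition tiltable theta : Prop :=
  exists2 e : R, 0 < e & P.-integrable setT (EFin \o (fun w => expR (e * mass w) * tilt theta w)).

(** One half of the exponent available in [tiltable] absorbs the polynomial growth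
    of [Y], and the other half is kept for differentiation. *)
Lemma tempered_bound theta Y : tiltable theta -> tempered Y ->
  exists (u : R) (G : T -> R), [/\ 0 < u, P.-integrable setT (EFin \o G) &
   forall w, l1norm (Y w) * expR (u * mass w) * tilt theta w <= G w].
Proof.
move=> [e e0 ie] [mY [c [k [c0 hY]]]].
have e2 : 0 < e / 2 by rewrite divr_gt0.
have [c' c'0 hc'] := powD1_le_expR k e2.
exists (e / 2), (fun w => (c * c') * (expR (e * mass w) * tilt theta w)).
split=> //; first by have := integrable_scale (c * c') ie.
move=> w; rewrite mulrA ler_wpM2r ?expR_ge0//.
have -> : expR (e * mass w) = expR (e / 2 * mass w) * expR (e / 2 * mass w).
  by rewrite -expRD; congr expR; field.
rewrite mulrA ler_wpM2r ?expR_ge0// (le_trans (hY w))// -mulrA ler_wpM2l// hc'//.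
exact: mass_ge0.
Qed.

Lemma tempered_integrable theta Y : tiltable theta -> tempered Y ->
  cintegrable P (fun w => Y w * (tilt theta w)%:C).
Proof.
move=> th tY; have [u [G [u0 iG hG]]] := tempered_bound th tY.
have mt : cmeasurable (fun w => (tilt theta w)%:C).
  by split; [exact: measurable_tilt|exact: measurable_cst].
have [mRe mIm] := cmeasurableM tY.1 mt.
have le w : l1norm (Y w * (tilt theta w)%:C) <= G w.
  rewrite (le_trans (l1normM _ _))// (le_trans _ (hG w))//.
  rewrite [X in _ * X](_ : _ = tilt theta w); last first.
    by rewrite /l1norm /= normr0 addr0 ger0_norm ?expR_ge0.
  rewrite ler_wpM2r ?expR_ge0// ler_peMr ?l1norm_ge0// -expR0 ler_expR.
  by rewrite mulr_ge0// ?mass_ge0// ltW.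
by split; apply: (integrable_dominated _ iG) => // w; rewrite (le_trans _ (le w))//;
  [exact: Re_l1norm|exact: Im_l1norm].
Qed.

(** Differentiating the exponential in the direction [H] brings down the factor
    [\tr (H *m W)], which is real as [H] and [W] are Hermitian. *)
Lemma derive_tilt theta Y H : tiltable theta -> tempered Y -> H \is hermsymmx ->
  let F t := complex_expectation P (fun w => Y w * (tilt (theta + t%:C *: H) w)%:C) in
  let F' := complex_expectation P (fun w => Y w * \tr (H *m W w) * (tilt theta w)%:C) in
  is_derive (0 : R) (1 : R) (fun t => complex.Re (F t)) (complex.Re F') /\
  is_derive (0 : R) (1 : R) (fun t => complex.Im (F t)) (complex.Im F').
Proof.
move=> th tY Hh F F'.
pose X w := complex.Re (\tr (H *m W w)).
have trX w : \tr (H *m W w) = (X w)%:C.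
  rewrite /X RRe_real//; apply/CrealP; rewrite -tr_adj.
  have hh := hW.2 w.
  by rewrite adj_mulmx (hermsymmx_adj Hh) (hermsymmx_adj hh) mxtrace_mulC.
have mX : measurable_fun setT X by have [] := cmeasurable_tr H.
have [cH cH0 hH] := l1norm_tr H.
have [u1 [G1 [u10 iG1 hG1]]] := tempered_bound th tY.
have [u2 [G2 [u20 iG2 hG2]]] := tempered_bound th (temperedM tY (tempered_tr H)).
have c10 : 0 < 1 + cH by rewrite ltr_pwDl.
pose u := Num.min u1 u2 / (1 + cH).
have u0 : 0 < u by rewrite divr_gt0// lt_min u10.
have uX v w : Num.min u1 u2 <= v -> expR (u * `|X w|) <= expR (v * mass w).
  move=> h; rewrite ler_expR (@le_trans _ _ (u * (cH * mass w)))//.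
    by rewrite ler_wpM2l ?(ltW u0)// (le_trans _ (hH w))// Re_l1norm.
  rewrite mulrA ler_wpM2r ?mass_ge0// (le_trans _ h)// /u mulrAC ler_pdivrMr//.
  by rewrite ler_wpM2l ?lerDr// ltW// lt_min u10.
have uX1 w : expR (u * `|X w|) <= expR (u1 * mass w) by apply: uX; rewrite ge_min lexx.
have uX2 w : expR (u * `|X w|) <= expR (u2 * mass w) by apply: uX; rewrite ge_min lexx orbT.
have iG : P.-integrable setT (EFin \o (fun w => G1 w + G2 w)).
  rewrite (_ : _ \o _ = (EFin \o G1) \+ (EFin \o G2))%E; first exact: integrableD.
  by apply/funext.
have l1YX w : l1norm (Y w * \tr (H *m W w)) = l1norm (Y w) * `|X w|.
  by rewrite trX /l1norm cReM cImM /= !mulr0 subr0 add0r !normrM mulrDl.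
have main (y : T -> R) : measurable_fun setT y -> (forall w, `|y w| <= l1norm (Y w)) ->
  is_derive (0 : R) (1 : R) (fun t : R => (\int[P]_w (y w * tilt theta w * expR (t * X w)))%R)
    (\int[P]_w (y w * tilt theta w * X w))%R.
  move=> my ly; apply: (derive_laplace u0 _ mX iG).
  - by apply: measurable_funM => //; exact: measurable_tilt.
  - move=> w; have G20 : 0 <= G2 w.
      by rewrite (le_trans _ (hG2 w))// !mulr_ge0 ?expR_ge0 ?l1norm_ge0.
    rewrite (le_trans (y := G1 w)) ?lerDl// (le_trans _ (hG1 w))//.
    rewrite normrM (ger0_norm (expR_ge0 _)) mulrAC ler_wpM2r ?expR_ge0//.
    by rewrite ler_pM// expR_ge0.
  - move=> w; have G10 : 0 <= G1 w.
      by rewrite (le_trans _ (hG1 w))// !mulr_ge0 ?expR_ge0 ?l1norm_ge0.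
    rewrite (le_trans (y := G2 w)) ?lerDr// (le_trans _ (hG2 w))// l1YX.
    rewrite !normrM (ger0_norm (expR_ge0 _)) mulrAC [leLHS]mulrAC -[_ * `|X w| * _]mulrAC.
    rewrite mulrAC [leRHS]mulrAC [leLHS](_ : _ = `|y w| * `|X w| * expR (u * `|X w|) * tilt theta w); last first.
      by rewrite /tilt; ring.
    rewrite [leRHS](_ : _ = l1norm (Y w) * `|X w| * expR (u2 * mass w) * tilt theta w); last by rewrite /tilt; ring.
    by rewrite ler_wpM2r ?expR_ge0// ler_pM ?mulr_ge0 ?expR_ge0// ler_wpM2r.
rewrite /F /F'; split.
  under eq_fun do rewrite complex_expectationE /=.
  rewrite complex_expectationE /=.
  under eq_fun do under eq_Rintegral do rewrite cReM /= mulr0 subr0 tilt_line mulrA.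
  under eq_Rintegral do rewrite trX cReM /= mulr0 subr0 cReM /= mulr0 subr0 mulrAC.
  by apply: main; [exact: tY.1.1|move=> w; exact: Re_l1norm].
under eq_fun do rewrite complex_expectationE /=.
rewrite complex_expectationE /=.
under eq_fun do under eq_Rintegral do rewrite cImM /= mulr0 add0r tilt_line mulrA.
under eq_Rintegral do rewrite trX cImM /= mulr0 add0r cImM /= mulr0 add0r mulrAC.
by apply: main; [exact: tY.1.2|move=> w; exact: Im_l1norm].
Qed.
End Tilt.

(** * Exponential moments of a Wishart matrix *)

Section WishartTilt.
Context (R : realType) (d : measure_display) (T : measurableType d).
Variable P : probability T R.
Variables (N : nat) (Sigma : 'M[R[i]]_N) (p : R) (W : T -> 'M[R[i]]_N).
Hypothesis wW : wishart P Sigma p W.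
Local Open Scope classical_set_scope.

Let hW : random_hermitian W. Proof. by case: wW. Qed.

Lemma wishart_tilt_integrable theta : theta \is hermsymmx ->
  posdefmx (invmx Sigma - theta) -> P.-integrable setT (EFin \o tilt W theta).
Proof.
move=> ht pt; have [_ _ _ /(_ theta ht pt)] := wW.
rewrite unlock => e; apply/integrableP; split.
  exact/measurable_EFinP/(measurable_tilt hW).
under eq_integral do rewrite /= ger0_norm ?expR_ge0//.
by rewrite /tilt e ltry.
Qed.

(** Hermitian matrices dual to the real and imaginary parts of the entries of a
    Hermitian matrix. *)
Definition coord_mx (j : 'I_N * 'I_N * bool) : 'M[R[i]]_N :=
  let: (a, b, c) := j in
  if c then 2^-1 *: (delta_mx a b + delta_mx b a)
  else ('i%C / 2) *: (delta_mx a b - delta_mx b a).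

Lemma tr_delta_mul (K : comNzRingType) n (a b : 'I_n) (A : 'M[K]_n) :
  \tr (delta_mx a b *m A) = A b a.
Proof.
rewrite /mxtrace (bigD1 a)//= big1 ?addr0 => [|i ia].
  rewrite mxE (bigD1 b)//= big1 ?addr0 => [|j jb]; first by rewrite mxE !eqxx mul1r.
  by rewrite mxE (negbTE jb) andbF mul0r.
by rewrite mxE big1// => j _; rewrite mxE (negbTE ia) mul0r.
Qed.

Lemma coord_mx_herm j : coord_mx j \is hermsymmx.
Proof.
case: j => [[a b] []]; apply: adj_hermsymmx; apply/matrixP => k l; rewrite !mxE.
  rewrite rmorphM rmorphD !rmorph_nat /= fmorphV rmorph_nat; congr (_ * _).
  by rewrite addrC; congr (_%:R + _%:R); rewrite andbC.
rewrite rmorphM rmorphB !rmorph_nat rmorphM fmorphV rmorph_nat.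
transitivity (- 'i%C / 2 * (((l == a) && (k == b))%:R - ((l == b) && (k == a))%:R) : R[i]).
  by congr (_ / _ * _); rewrite -[LHS]/(Num.conj ('i%C : R[i])) complexiE conjCi.
by rewrite !mulNr -mulrN opprB; congr (_ * (_%:R - _%:R)); rewrite andbC.
Qed.

Lemma coord_mxE (A : 'M[R[i]]_N) a b c : A \is hermsymmx ->
  complex.Re (\tr (coord_mx (a, b, c) *m A))
  = if c then complex.Re (A a b) else complex.Im (A a b).
Proof.
move=> /hermsymmx_adj hA.
have e : A b a = (A a b)^*%C by rewrite -{1}hA !mxE.
rewrite /coord_mx; case: c; rewrite -scalemxAl mxtraceZ.
  rewrite mulmxDl mxtraceD !tr_delta_mul e.
  case: (A a b) => x y.
  have -> : (2^-1 : R[i]) = (2^-1)%:C by rewrite fmorphV rmorph_nat.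
  by rewrite cReM /= mul0r subr0; field.
rewrite mulmxBl [X in complex.Re (_ * X)]raddfB /= !tr_delta_mul e.
case: (A a b) => x y.
have -> : (2^-1 : R[i]) = (2^-1)%:C by rewrite fmorphV rmorph_nat.
by rewrite cReM /=; simpc => /=; field.
Qed.

(** The exponential of an absolute value is at most the sum of the exponentials of
    both signs.  So the exponential of a small multiple of the largest coordinate of
    [W] is bounded by a sum of tilts at [theta] plus or minus multiples of the
    [coord_mx]; these have finite expectation because [theta] is interior to the
    domain of the Laplace transform, by [posdef_open]. *)
Lemma wishart_tiltable theta : theta \is hermsymmx ->
  posdefmx (invmx Sigma - theta) -> tiltable P W theta.
Proof.
move=> ht pt.
pose J := ('I_N * 'I_N * bool)%type.
pose l (j : J) w := complex.Re (\tr (coord_mx j *m W w)).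
have [t t0 pos] : exists2 t : R, 0 < t & forall j (s : R), `|s| <= t ->
    posdefmx (invmx Sigma - (theta + s%:C *: coord_mx j)).
  have ex j := posdef_open pt (coord_mx_herm j).
  pose e j : R := projT1 (cid2 (ex j)).
  have e0 j : 0 < e j by rewrite /e; case: cid2.
  have eP j s : `|s| < e j -> posdefmx (invmx Sigma - theta - s%:C *: coord_mx j).
    by rewrite /e; case: cid2 => /= x _; apply.
  pose m := \big[Order.min/1]_j e j.
  have m0 : 0 < m by apply/lt_bigmin.
  exists (m / 2); first by rewrite divr_gt0.
  move=> j s sm; rewrite opprD addrA; apply: eP; rewrite (le_lt_trans sm)//.
  rewrite (lt_le_trans (y := m)) ?bigmin_le//.
  by rewrite ltr_pdivrMr// mulr2n mulrDr mulr1 ltrDl.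
have herm j (s : R) : theta + s%:C *: coord_mx j \is hermsymmx.
  apply: adj_hermsymmx; rewrite -{2}(hermsymmx_adj ht) -{2}(hermsymmx_adj (coord_mx_herm j)).
  apply/matrixP => a b; rewrite !mxE rmorphD rmorphM/=; congr (_ + _ * _).
  by rewrite -[LHS]/(conjc _) conjc_real.
pose c : R := (#|{: J}|).+1%:R.
exists (t / c); first by rewrite divr_gt0// ltr0n.
have massE w : mass W w = \sum_j `|l j w|.
  have <- : \sum_(ab : 'I_N * 'I_N) \sum_(c : bool) `|l (ab, c) w| = \sum_j `|l j w|.
    by rewrite pair_big; apply: eq_bigr => -[].
  rewrite /mass pair_big /=.
  have hw := hW.2 w; apply: eq_bigr => -[a b] _.
  have e1 : l (a, b, true) w = complex.Re (W w a b) := coord_mxE a b true hw.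
  have e2 : l (a, b, false) w = complex.Im (W w a b) := coord_mxE a b false hw.
  by rewrite big_bool e1 e2.
pose G w := tilt W theta w + \sum_j (tilt W (theta + t%:C *: coord_mx j) w
   + tilt W (theta + (- t)%:C *: coord_mx j) w).
have iG : P.-integrable setT (EFin \o G).
  rewrite (_ : _ \o _ = (EFin \o tilt W theta) \+ (fun w => \sum_j
     ((EFin \o tilt W (theta + t%:C *: coord_mx j)) \+
     (EFin \o tilt W (theta + (- t)%:C *: coord_mx j))) w))%E; last first.
    by apply/funext => w; rewrite /G /= EFinD -sumEFin.
  apply: (integrableD measurableT (wishart_tilt_integrable ht pt)).
  apply: integrable_sum => // j _.
  have i1 : P.-integrable setT (EFin \o tilt W (theta + t%:C *: coord_mx j)).
    by apply: (wishart_tilt_integrable (herm j t)); apply: pos; rewrite ger0_norm// ltW.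
  have i2 : P.-integrable setT (EFin \o tilt W (theta + (- t)%:C *: coord_mx j)).
    by apply: (wishart_tilt_integrable (herm j (- t))); apply: pos; rewrite normrN ger0_norm// ltW.
  exact: (integrableD measurableT i1 i2).
apply: (integrable_dominated _ iG).
  apply: measurable_funM; last exact: measurable_tilt.
  apply: measurableT_comp => //; apply: measurable_funM => //; exact: measurable_mass.
move=> w; rewrite ger0_norm ?mulr_ge0 ?expR_ge0// /G.
under eq_bigr do rewrite !tilt_line -mulrDr.
rewrite -mulr_sumr -[X in X + _]mulr1 -mulrDr mulrC ler_wpM2l ?expR_ge0//.
rewrite -!/(l _ w).
have sge0 (s : seq J) : 0 <= \sum_(j <- s) (expR (t * l j w) + expR (- t * l j w)).
  by apply: sumr_ge0 => j _; rewrite addr_ge0// expR_ge0.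
have [m0|m0] := leP (mass W w) 0.
  rewrite (le_trans (y := 1)) ?lerDl ?sge0// -expR0 ler_expR.
  by rewrite mulr_ge0_le0// divr_ge0// ltW.
(* As [c] exceeds the number of coordinates, they cannot all be smaller than
   [mass W w / c] in absolute value. *)
have [j hj] : exists j, mass W w <= c * `|l j w|.
  apply/not_existsP => H; suff: c * mass W w < c * mass W w by rewrite ltxx.
  rewrite {1}massE mulr_sumr.
  have h j : true -> c * `|l j w| <= mass W w.
    by move=> _; rewrite ltW// ltNge; apply/negP/H.
  rewrite (le_lt_trans (ler_sum _ h))// sumr_const -[ltLHS]mulr_natl ltr_pM2r//.
  by rewrite ltr_nat.
rewrite (bigD1 j)//= (le_trans (y := expR (t * `|l j w|)))//.
  by rewrite ler_expR -mulrA ler_wpM2l ?(ltW t0)// ler_pdivrMl ?ltr0n.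
rewrite addrCA -[leLHS]addr0 lerD//; last first.
  by rewrite addr_ge0// sumr_ge0// => k _; rewrite addr_ge0// expR_ge0.
have [lj|lj] := leP 0 (l j w).
  by rewrite (ger0_norm lj) lerDl expR_ge0.
by rewrite (ltr0_norm lj) mulrN -mulNr lerDr expR_ge0.
Qed.

End WishartTilt.

(** * Derivatives of complex functions of a real variable *)

Lemma cReD (R : rcfType) (x y : R[i]) :
  complex.Re (x + y) = complex.Re x + complex.Re y.
Proof. by case: x y => [a b] [a' b']. Qed.

Lemma cImD (R : rcfType) (x y : R[i]) :
  complex.Im (x + y) = complex.Im x + complex.Im y.
Proof. by case: x y => [a b] [a' b']. Qed.

Section CDerive.
Variable R : realType.

(** The derivative at 0 only: the curves of interest are lines through the point
    where the derivative is taken. *)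
Definition cderive (f : R -> R[i]) (l : R[i]) : Prop :=
  is_derive (0 : R) (1 : R) (fun t => complex.Re (f t)) (complex.Re l) /\
  is_derive (0 : R) (1 : R) (fun t => complex.Im (f t)) (complex.Im l).

Lemma cderive_eq f l l' : cderive f l -> l = l' -> cderive f l'.
Proof. by move=> h <-. Qed.

Lemma cderive_cst c : cderive (fun=> c) 0.
Proof. by split; exact: is_derive_cst. Qed.

Lemma cderiveD f g l m : cderive f l -> cderive g m ->
  cderive (fun t => f t + g t) (l + m).
Proof.
move=> [f1 f2] [g1 g2]; split.
  by under eq_fun do rewrite cReD; rewrite cReD; exact: is_deriveD.
by under eq_fun do rewrite cImD; rewrite cImD; exact: is_deriveD.
Qed.

Lemma cderiveM f g l m : cderive f l -> cderive g m ->
  cderive (fun t => f t * g t) (l * g 0 + f 0 * m).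
Proof.
move=> [f1 f2] [g1 g2]; split.
  under eq_fun do rewrite cReM.
  apply: is_derive_eq; rewrite cReD !cReM /GRing.scale /=; ring.
under eq_fun do rewrite cImM.
apply: is_derive_eq; rewrite cImD !cImM /GRing.scale /=; ring.
Qed.

Lemma cderive_real (f : R -> R) (l : R) : is_derive (0 : R) (1 : R) f l ->
  cderive (fun t => (f t)%:C) l%:C.
Proof. by move=> h; split => //=; exact: is_derive_cst. Qed.

Lemma cderive_horner (Q : {poly R[i]}) :
  cderive (fun t => Q.[t%:C]) (Q^`()).[0].
Proof.
elim/poly_ind: Q => [|Q c IH].
  rewrite derivC horner0; under eq_fun do rewrite horner0; exact: cderive_cst.
under eq_fun do rewrite hornerD hornerM hornerX hornerC.
have hid : cderive (fun t : R => t%:C) 1.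
  exact: (cderive_real (is_derive_id (0 : R^o) (1 : R^o))).
apply: (cderive_eq (cderiveD (cderiveM IH hid) (cderive_cst c))).
by rewrite derivD derivM derivX derivC !hornerE.
Qed.

Lemma cderive_unique f g l m (e : R) : 0 < e ->
  (forall t, `|t| < e -> f t = g t) -> cderive f l -> cderive g m -> l = m.
Proof.
move=> e0 fg [f1 f2] [g1 g2].
have near0 : \forall t \near (0 : R), `|t| < e by exact: (nbhs0_lt e0).
have h1 : \forall t \near (0 : R), complex.Re (f t) = complex.Re (g t).
  by near=> t; rewrite fg//; near: t.
have h2 : \forall t \near (0 : R), complex.Im (f t) = complex.Im (g t).
  by near=> t; rewrite fg//; near: t.
have [_ e1] := near_eq_is_derive h1 f1; have [_ e1'] := g1.
have [_ e2] := near_eq_is_derive h2 f2; have [_ e2'] := g2.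
apply/eqP; rewrite eq_complex; apply/andP; split; apply/eqP; [exact: (etrans (esym e1))|exact: (etrans (esym e2))].
Unshelve. all: by end_near. Qed.

(** The logarithmic derivative of [f ^ (p + n)], up to the constant [k ^ p],
    multiplied by [f] to avoid a quotient. *)
Lemma derive_powR_prod (f : R -> R) (f' k p : R) n :
  is_derive (0 : R) (1 : R) f f' -> 0 < f 0 -> 0 < k ->
  exists2 l, is_derive (0 : R) (1 : R) (fun t => (f t * k) `^ p * f t ^+ n) l &
    l * f 0 = (p + n%:R) * f' * ((f 0 * k) `^ p * f 0 ^+ n).
Proof.
move=> df f0 k0.
have fk0 : 0 < f 0 * k by rewrite mulr_gt0.
have d1 : is_derive (0 : R) (1 : R) (fun t => f t * k) (f' * k).
  by apply: is_derive_eq; rewrite /GRing.scale /=; ring.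
have d2 : is_derive (0 : R) (1 : R) (fun t => (f t * k) `^ p)
    (p * (f 0 * k) `^ (p - 1) * (f' * k)).
  apply: (is_derive_eq (@is_derive1_comp R (fun x => x `^ p) (fun t => f t * k) 0 _ _ (is_derive1_powR p fk0) d1)). by [].
have d3 : is_derive (0 : R) (1 : R) (fun t => f t ^+ n) (n%:R * f 0 ^+ n.-1 * f').
  rewrite (_ : (fun t => f t ^+ n) = f ^+ n :> (R -> R)); last by apply/funext => t; rewrite exprfctE.
  exact: is_deriveX.
eexists; first exact: is_deriveM.
rewrite /GRing.scale /=.
have -> : (f 0 * k) `^ p = (f 0 * k) * (f 0 * k) `^ (p - 1).
  by rewrite -{2}[f 0 * k]powRr1 ?(ltW fk0)// -powRD ?subrKC// ?(gt_eqF fk0)// implybT.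
by case: n {d3} => [|n]; rewrite /= ?expr0 ?exprS; ring.
Qed.
End CDerive.

(** * Permutation sums at a resolvent *)

Section Slots.
Variables (F : fieldType) (Gm : eqType) (N : nat).
Variables (g : Gm) (G : Gm -> 'M[F]_N) (A H : 'M[F]_N).

(** The slots of the matrix [g] carry the adjugate of the pencil instead of its
    inverse, which makes the sum over permutations a polynomial. *)
Definition pencil_slots n (t : 'I_n -> Gm) (M : 'I_n -> 'M[F]_N) (i : 'I_n) : 'M[{poly F}]_N :=
  if t i == g then map_mx polyC (M i) *m \adj (pencil A H)
  else map_mx polyC (M i *m G (t i)).

Lemma horner_pencil x : map_mx (horner_eval x) (pencil A H) = A - x *: H.
Proof. by apply/matrixP => i j; rewrite !mxE /horner_eval !hornerE mulrC. Qed.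

Lemma horner_det_pencil x : (\det (pencil A H)).[x] = \det (A - x *: H).
Proof. by rewrite -/(horner_eval x _) -det_map_mx horner_pencil. Qed.

(** Each of the slots of label [g] contributes one factor of the determinant, as
    the inverse is the adjugate divided by the determinant. *)
Lemma horner_pencil_slots (p : Gm -> F) n (t : 'I_n -> Gm) (M : 'I_n -> 'M[F]_N) (x : F) :
  A - x *: H \in unitmx ->
  wick p t (fun i => M i *m (if t i == g then invmx (A - x *: H) else G (t i)))
  = \det (A - x *: H) ^- #|[set i | t i == g]|
    * (wick (polyC \o p) t (pencil_slots t M)).[x].
Proof.
move=> u.
have hp := horner_pencil x.
have hC (B : 'M[F]_N) : map_mx (horner_eval x) (map_mx polyC B) = B.
  by apply/matrixP => i j; rewrite !mxE /horner_eval hornerC.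
rewrite -/(horner_eval x _) rmorph_wick.
pose c i : F := if t i == g then (\det (A - x *: H))^-1 else 1.
have -> : (\det (A - x *: H)) ^- #|[set i | t i == g]| = \prod_i c i.
  rewrite /c -big_mkcond prodr_const exprVn; congr (_ ^- _).
  by apply: eq_card => i; rewrite inE.
rewrite -wick_scale.
have -> : horner_eval x \o (polyC \o p) = p.
  by apply/funext => y /=; rewrite /horner_eval hornerC.
apply: eq_wick => i; rewrite /pencil_slots /c; case: eqP => _; last by rewrite hC scale1r.
by rewrite map_mxM hC map_mx_adj hp /invmx u scalemxAr.
Qed.

(** The derivative in the direction [H] is the sum with one more slot, that of [H]
    itself. *)
Lemma wick_pencil_slots (p : Gm -> F) n (t : 'I_n.+1 -> Gm) (M : 'I_n.+1 -> 'M[F]_N) :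
  t ord0 = g -> M ord0 = H ->
  let Q := wick (polyC \o p) (t \o lift ord0) (pencil_slots (t \o lift ord0) (M \o lift ord0)) in
  \det (pencil A H) * Q^`()
   - ((p g)%:P + (#|[set i | t (lift ord0 i) == g]|)%:R) * (\det (pencil A H))^`() * Q
  = wick (polyC \o p) t (pencil_slots t M).
Proof.
move=> t0 M0 Q; rewrite wick_pencil; last 2 first.
- by move=> i tig; exists (M (lift ord0 i)); rewrite /pencil_slots tig.
- by move=> i tig; exists (M (lift ord0 i) *m G (t (lift ord0 i))); rewrite /pencil_slots (negbTE tig).
by rewrite wickS t0 [in RHS]/pencil_slots t0 eqxx M0.
Qed.

End Slots.

(** * Moments of Wishart matrices *)

(** The elimination that ends the differentiation of a moment: from the equation
    [u * r * v = rl * Q], from its derivative and from the logarithmic derivative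
    of [v], the derivative [u'] is computed in terms of the derivative of the
    polynomial [Q]. *)
Lemma derivative_step_solve (F : fieldType) (u u' r v v' rl Q Q' dt D' q S pw : F) n :
  dt != 0 -> pw != 0 -> v = pw * dt ^+ n ->
  u * r * v = rl * Q ->
  (u' * r + u * 0) * v + u * r * v' = 0 * Q + rl * Q' ->
  v' * dt = q * D' * v ->
  dt * Q' - q * D' * Q = S ->
  u' * r = pw^-1 * rl * (dt ^- n.+1 * S).
Proof.
move=> dt0 pw0 vE key eqd v'E slots.
have v0 : v != 0 by rewrite vE mulf_neq0// expf_neq0.
apply: (mulIf (mulf_neq0 v0 dt0)).
have -> : pw^-1 * rl * (dt ^- n.+1 * S) * (v * dt) = rl * S.
  by rewrite vE exprS; field; rewrite dt0 pw0 expf_neq0.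
have e : u' * r * v = rl * Q' - u * r * v'.
  by apply/eqP; rewrite eq_sym subr_eq; apply/eqP; rewrite -[LHS](add0r) -(mul0r Q) -eqd; ring.
rewrite mulrA e -slots mulrBl -(mulrA _ v') v'E.
have -> : u * r * (q * D' * v) = q * D' * (u * r * v) by ring.
by rewrite key; ring.
Qed.

Lemma card_ordS n (Q : pred 'I_n.+1) :
  #|[set i | Q i]| = (Q ord0 + #|[set i | Q (lift ord0 i)]|)%N.
Proof.
rewrite -!sum1dep_card big_mkcond big_ord_recl -big_mkcond /=.
by case: (Q ord0).
Qed.

Lemma hermitian_decomposition (R : rcfType) n (X : 'M[R[i]]_n) :
  exists H1 H2, [/\ H1 \is hermsymmx, H2 \is hermsymmx & X = 'i%R *: H2 + H1].
Proof.
pose H1 := 2^-1 *: (X + X ^t*); pose H2 := ('i%R / 2) *: (X ^t* - X).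
exists H1, H2.
have c2 : Num.conj (2^-1 : R[i]) = 2^-1 by rewrite fmorphV rmorph_nat.
have adjZ c (A : 'M[R[i]]_n) : (c *: A) ^t* = Num.conj c *: A ^t*.
  by rewrite linearZ /= map_mxZ.
have adjD (A B : 'M[R[i]]_n) : (A + B) ^t* = A ^t* + B ^t*.
  by rewrite linearD /= map_mxD.
have adjN (A : 'M[R[i]]_n) : (- A) ^t* = - A ^t*.
  by rewrite -scaleN1r adjZ rmorphN1 scaleN1r.
split.
- by apply: adj_hermsymmx; rewrite adjZ adjD trmxCK c2 addrC.
- apply: adj_hermsymmx; rewrite adjZ adjD adjN trmxCK.
  have -> : Num.conj ('i%R / 2 : R[i]) = - ('i%R / 2).
    by rewrite rmorphM /= c2 conjCi mulNr.
  by rewrite scaleNr -scalerN opprB.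
have ii : 'i%R * 'i%R = -1 :> R[i] by rewrite -expr2 sqrCi.
rewrite /H1 /H2 scalerA mulrA ii mulN1r scaleNr -scalerN opprB -scalerDr.
rewrite addrACA addNr addr0.
have e : 2^-1 + 2^-1 = 1 :> R[i] by field.
by rewrite scalerDr -scalerDl e scale1r.
Qed.

Section Moments.
Context (R : realType) (d : measure_display) (T : measurableType d).
Variable P : probability T R.
Variables (Gm : finType) (N : nat) (Sigma : Gm -> 'M[R[i]]_N) (p : Gm -> R).
Variable W : Gm -> T -> 'M[R[i]]_N.
Hypothesis wW : forall g, wishart P (Sigma g) (p g) (W g).

Let hW g : random_hermitian (W g). Proof. by case: (wW g). Qed.
Let pS g : posdefmx (Sigma g). Proof. by case: (wW g). Qed.

Definition tilt_domain (g : Gm) (theta : 'M[R[i]]_N) : Prop :=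
  theta \is hermsymmx /\ posdefmx (invmx (Sigma g) - theta).

Definition trace_moment n (t : 'I_n -> Gm) (M : 'I_n -> 'M[R[i]]_N)
    (theta : Gm -> 'M[R[i]]_N) (g : Gm) : R[i] :=
  complex_expectation P (fun w => (\prod_(i | t i == g) \tr (M i *m W g w))
                                  * (tilt (W g) (theta g) w)%:C).

Lemma eq_trace_moment n (t : 'I_n -> Gm) M theta theta' g :
  theta g = theta' g -> trace_moment t M theta g = trace_moment t M theta' g.
Proof. by rewrite /trace_moment => ->. Qed.

Definition laplace (g : Gm) (theta : 'M[R[i]]_N) : R :=
  complex.Re (\det (1%:M - theta *m Sigma g)) `^ (- p g).

(** Permutation formula for the moments of the tilted laws.  The tilted law of
    parameter [theta] is the Wishart law of scale [(Sigma^-1 - theta)^-1], not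
    normalized; knowing the formula for all tilts is what makes differentiation
    possible.  A product of expectations stands for the expectation over
    independent matrices. *)
Definition moment_formula n (t : 'I_n -> Gm) (M : 'I_n -> 'M[R[i]]_N)
    (theta : Gm -> 'M[R[i]]_N) : Prop :=
  \prod_g trace_moment t M theta g
  = (\prod_g (laplace g (theta g))%:C)
    * wick (fun g => (p g)%:C) t (fun i => M i *m invmx (invmx (Sigma (t i)) - theta (t i))).

Lemma moment_formula0 t M theta : (forall g, tilt_domain g (theta g)) ->
  @moment_formula 0 t M theta.
Proof.
move=> dom; rewrite /moment_formula wick0 mulr1; apply: eq_bigr => g _.
have [_ _ _ /(_ _ (dom g).1 (dom g).2)] := wW g.
rewrite /trace_moment (_ : (fun w => _) = (fun w => (tilt (W g) (theta g) w)%:C)); last first.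
  by apply/funext => w; rewrite big1 ?mul1r// => -[].
by rewrite /complex_expectation /= /tilt => ->; rewrite expectation_cst.
Qed.

Section Step.
Variables (n : nat) (t : 'I_n.+1 -> Gm) (M : 'I_n.+1 -> 'M[R[i]]_N).
Variable theta : Gm -> 'M[R[i]]_N.
Hypothesis dom : forall g, tilt_domain g (theta g).
Let g := t ord0.
Let t' := t \o lift ord0.
Let M' := M \o lift ord0.
Let Y w := \prod_(i | t' i == g) \tr (M' i *m W g w).
Let Rest := \prod_(h | h != g) trace_moment t' M' theta h.

Let tY : tempered (W g) Y.
Proof. by apply: tempered_prod => i _; exact: tempered_tr. Qed.

Lemma trace_moment_split X : \prod_h trace_moment t (fupd M ord0 X) theta h
  = complex_expectation P (fun w => Y w * \tr (X *m W g w) * (tilt (W g) (theta g) w)%:C)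
    * Rest.
Proof.
rewrite (bigD1 g)//=; congr (_ * _).
  rewrite /trace_moment; congr complex_expectation; apply/funext => w; congr (_ * _).
  by rewrite big_mkcond big_ord_recl eqxx /= -big_mkcond mulrC.
apply: eq_bigr => h hg; rewrite /trace_moment; congr complex_expectation.
apply/funext => w; congr (_ * _).
by rewrite big_mkcond big_ord_recl eq_sym (negbTE hg) /= mul1r -big_mkcond.
Qed.

(** The derivative of the formula for [n] traces, in the direction [H] of the
    parameter [theta g], is the formula for [n + 1] traces.  On the left it brings
    down a trace by [derive_tilt]; on the right it inserts a point into the
    permutations by [wick_pencil_slots]. *)
Lemma moment_formula_step_herm (H : 'M[R[i]]_N) :
  H \is hermsymmx ->
  (forall theta', (forall g, tilt_domain g (theta' g)) -> moment_formula t' M' theta') ->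
  moment_formula t (fupd M ord0 H) theta.
Proof.
move=> Hh IH.
pose K := invmx (Sigma g) - theta g.
have [e e0 Kpos] := posdef_open (dom g).2 Hh; rewrite -/K in Kpos.
pose D := \det (pencil K H).
pose dd (s : R) := complex.Re D.[s%:C].
pose k := complex.Re (\det (Sigma g)).
have kE : \det (Sigma g) = k%:C by rewrite /k RRe_real// gtr0_real// posdef_det.
have k0 : 0 < k by rewrite -ltcR -kE; exact: posdef_det.
have DE s : D.[s] = \det (K - s *: H) := horner_det_pencil K H s.
have dE s : `|s| < e -> D.[s%:C] = (dd s)%:C.
  by move=> se; rewrite /dd RRe_real// gtr0_real// DE posdef_det//; exact: Kpos.
have d0 s : `|s| < e -> 0 < dd s.
  by move=> se; rewrite -ltcR -dE// DE; apply: posdef_det; exact: Kpos.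
pose th s := fun h => if h == g then theta g + s%:C *: H else theta h.
have thdom s : `|s| < e -> forall h, tilt_domain h (th s h).
  move=> se h; rewrite /th; case: eqP => [->|_]; last exact: dom.
  split; last by rewrite opprD addrA; exact: Kpos.
  apply: adj_hermsymmx; rewrite -{2}(hermsymmx_adj (dom g).1) -{2}(hermsymmx_adj Hh).
  apply/matrixP => a b; rewrite !mxE rmorphD rmorphM/=; congr (_ + _ * _).
  by rewrite -[LHS]/(conjc _) conjc_real.
pose G h := invmx (invmx (Sigma h) - theta h).
pose n0 := #|[set i | t' i == g]|.
pose pc h : R[i] := (p h)%:C.
pose Q := wick (polyC \o pc) t' (pencil_slots g G K H t' M').
pose RestLap : R[i] := \prod_(h | h != g) (laplace h (theta h))%:C.
pose u s := complex_expectation P (fun w => Y w * (tilt (W g) (theta g + s%:C *: H) w)%:C).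
(* The factor [v] clears the denominators of the formula for [n] traces along the
   line of direction [H]: the power of the determinant in the Laplace transform,
   and one determinant for each slot of label [g]. *)
pose v s := (dd s * k) `^ (p g) * dd s ^+ n0.
have lapE s : `|s| < e -> laplace g (theta g + s%:C *: H) = (dd s * k) `^ (- p g).
  move=> se; rewrite /laplace.
  have -> : 1%:M - (theta g + s%:C *: H) *m Sigma g = (K - s%:C *: H) *m Sigma g.
    by rewrite /K -addrA -opprD mulmxBl mulVmx// posdef_unit.
  by rewrite det_mulmx -DE dE// kE -rmorphM.
have unitK s : `|s| < e -> K - s%:C *: H \in unitmx by move=> /Kpos /posdef_unit.
have key s : `|s| < e -> u s * Rest * (v s)%:C = RestLap * Q.[s%:C].
  move=> se; have := IH _ (thdom s se); rewrite /moment_formula.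
  have bD (F : Gm -> R[i]) : \prod_h F h = F g * \prod_(h | h != g) F h by exact: bigD1.
  have -> : \prod_h trace_moment t' M' (th s) h = u s * Rest.
    have e1 : th s g = theta g + s%:C *: H by rewrite /th eqxx.
    have e2 : trace_moment t' M' (th s) g = u s by rewrite /trace_moment e1.
    apply: (etrans (bD _)); apply: (f_equal2 _ e2); apply: eq_bigr => h hg.
    have e3 : th s h = theta h by rewrite /th (negbTE hg).
    exact: (eq_trace_moment _ _ e3).
  have -> : \prod_h (laplace h (th s h))%:C = ((dd s * k) `^ (- p g))%:C * RestLap.
    have e1 : th s g = theta g + s%:C *: H by rewrite /th eqxx.
    have e2 : (laplace g (th s g))%:C = ((dd s * k) `^ (- p g))%:C by rewrite e1 (lapE _ se).
    apply: (etrans (bD _)); apply: (f_equal2 _ e2); apply: eq_bigr => h hg.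
    have e3 : th s h = theta h by rewrite /th (negbTE hg).
    by rewrite e3.
  move=> ->.
  rewrite (_ : (fun i => _) = (fun i => M' i *m
      (if t' i == g then invmx (K - s%:C *: H) else G (t' i)))); last first.
    apply/funext => i; rewrite /th /G; case: eqP => // ->.
    by rewrite /K opprD addrA.
  rewrite (@horner_pencil_slots _ _ _ g G K H pc _ t' M' _ (unitK s se)) -DE (dE _ se) -/n0 -/Q /v.
  rewrite powRN rmorphM /= rmorphXn /= fmorphV /=.
  have p0 : ((dd s * k) `^ p g)%:C != 0 :> R[i].
    by rewrite (inj_eq (@complexI _)) gt_eqF// powR_gt0// mulr_gt0// d0.
  have d00 : (dd s)%:C != 0 :> R[i] by rewrite (inj_eq (@complexI _)) gt_eqF// d0.
  by field; rewrite p0 expf_neq0.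
have e00 : `|0 : R| < e by rewrite normr0.
have du : cderive u (complex_expectation P (fun w => Y w * \tr (H *m W g w) * (tilt (W g) (theta g) w)%:C)).
  exact: (derive_tilt (hW g) (wishart_tiltable (wW g) (dom g).1 (dom g).2) tY Hh).
have dD := cderive_horner D.
have dd' : is_derive (0 : R) (1 : R) dd (complex.Re D^`().[0]) := dD.1.
have D'E : (complex.Re D^`().[0])%:C = D^`().[0].
  apply: (cderive_unique e0 _ (cderive_real dd') dD) => s se; by rewrite dE.
have [v' dv v'E] := derive_powR_prod (p g) n0 dd' (d0 0 e00) k0.
(* Both sides of [key] are differentiated at 0. *)
have eqd := cderive_unique e0 key
  (cderiveM (cderiveM du (cderive_cst Rest)) (cderive_real dv))
  (cderiveM (cderive_cst RestLap) (cderive_horner Q)).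
have z : (0 : R)%:C = 0 :> R[i] by [].
have key0 := key 0 e00.
have slots := @wick_pencil_slots _ _ _ g G K H pc _ t (fupd M ord0 H) erefl erefl.
have {}slots : D.[0] * Q^`().[0] - (pc g + n0%:R) * D^`().[0] * Q.[0]
    = (wick (polyC \o pc) t (pencil_slots g G K H t (fupd M ord0 H))).[0].
  rewrite -slots -polyC_natr -polyCD hornerD hornerN !hornerM hornerC.
  by rewrite (_ : fupd M ord0 H \o lift ord0 = M')// ; apply/funext => i.
have v'C : v'%:C * (dd 0)%:C = (pc g + n0%:R) * D^`().[0] * (v 0)%:C.
  by rewrite -D'E -rmorphM v'E !rmorphM rmorphD rmorph_nat.
have v0E : (v 0)%:C = ((dd 0 * k) `^ p g)%:C * (dd 0)%:C ^+ n0.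
  by rewrite /v rmorphM rmorphXn.
have p0 : ((dd 0 * k) `^ p g)%:C != 0 :> R[i].
  by rewrite (inj_eq (@complexI _)) gt_eqF// powR_gt0// mulr_gt0// d0.
have d00 : (dd 0)%:C != 0 :> R[i] by rewrite (inj_eq (@complexI _)) gt_eqF// d0.
rewrite (dE 0 e00) in slots.
have eqf := derivative_step_solve d00 p0 v0E key0 eqd v'C slots.
rewrite /moment_formula trace_moment_split.
rewrite (_ : (fun i => _) = (fun i => fupd M ord0 H i *m
      (if t i == g then invmx (K - 0 *: H) else G (t i)))); last first.
  by apply/funext => i; rewrite /G scale0r subr0 /K; case: eqP => // ->.
have u0 : K - 0 *: H \in unitmx := unitK 0 e00.
rewrite (@horner_pencil_slots _ _ _ g G K H pc _ t (fupd M ord0 H) _ u0).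
have -> : \det (K - 0 *: H) = (dd 0)%:C by rewrite -(dE 0 e00) DE.
have -> : #|[set i | t i == g]| = n0.+1.
  by rewrite card_ordS eqxx.
apply: (etrans eqf); congr (_ * _).
have e0h : theta g + (0 : R)%:C *: H = theta g by rewrite scale0r addr0.
have := lapE 0 e00; rewrite e0h powRN => lg.
have bD (F : Gm -> R[i]) : \prod_h F h = F g * \prod_(h | h != g) F h by exact: bigD1.
by apply: esym; apply: (etrans (bD _)); rewrite lg fmorphV.
Qed.

(** Both sides are linear over the complex numbers in the matrix of the first
    trace, and Hermitian matrices span all matrices. *)
Lemma moment_formula_step :
  (forall theta', (forall g, tilt_domain g (theta' g)) -> moment_formula t' M' theta') ->
  moment_formula t M theta.
Proof.
move=> IH; have [H1 [H2 [h1 h2 XE]]] := hermitian_decomposition (M ord0).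
have E1 := moment_formula_step_herm h1 IH.
have E2 := moment_formula_step_herm h2 IH.
have th := wishart_tiltable (wW g) (dom g).1 (dom g).2.
pose Z (H : 'M[R[i]]_N) w := Y w * \tr (H *m W g w) * (tilt (W g) (theta g) w)%:C.
have iH (H : 'M[R[i]]_N) : cintegrable P (Z H).
  by apply: (tempered_integrable (hW g) th); apply: temperedM => //; exact: tempered_tr.
have lin : complex_expectation P (Z ('i%R *: H2 + H1))
  = 'i%R * complex_expectation P (Z H2) + complex_expectation P (Z H1).
  have e1 := complex_expectationZ 'i%R (iH H2).
  have e2 := complex_expectationD (cintegrableZ 'i%R (iH H2)) (iH H1).
  rewrite -e1 -e2; congr complex_expectation; apply/funext => w.
  rewrite /Z mulmxDl -scalemxAl mxtraceD mxtraceZ.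
  set b := \tr (H2 *m _); set c := \tr (H1 *m _); set e := (tilt _ _ _)%:C.
  by rewrite mulrDr mulrDl mulrCA !mulrA.
pose G0 := invmx (invmx (Sigma (t ord0)) - theta (t ord0)).
pose B i := M i *m invmx (invmx (Sigma (t i)) - theta (t i)).
pose wk (S : 'I_n.+1 -> 'M[R[i]]_N) := wick (fun g => (p g)%:C) t S.
pose Lap := \prod_g (laplace g (theta g))%:C.
have mfE H : moment_formula t (fupd M ord0 H) theta
    = (complex_expectation P (Z H) * Rest = Lap * wk (fupd B ord0 (H *m G0))).
  rewrite /moment_formula trace_moment_split; congr (_ = _ * wick _ _ _).
  by apply/funext => i; rewrite /fupd; case: eqP => // ->.
rewrite mfE in E1; rewrite mfE in E2.
rewrite -(fupd_id M ord0) mfE XE mulmxDl -scalemxAl /wk wick_lin -/wk mulrDr mulrCA.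
by rewrite -E1 -E2 lin mulrDl mulrA.
Qed.
End Step.

Lemma tilted_moments n (t : 'I_n -> Gm) (M : 'I_n -> 'M[R[i]]_N) theta :
  (forall g, tilt_domain g (theta g)) -> moment_formula t M theta.
Proof.
elim: n t M theta => [|n IH] t M theta dom; first exact: moment_formula0.
by apply: moment_formula_step => // theta' dom'; exact: IH.
Qed.

(** The untilted case [theta = 0]. *)
Lemma wishart_moments n (t : 'I_n -> Gm) (M : 'I_n -> 'M[R[i]]_N) :
  \prod_g complex_expectation P (fun w => \prod_(i | t i == g) \tr (M i *m W g w))
  = wick (fun g => (p g)%:C) t (fun i => M i *m Sigma (t i)).
Proof.
have dom g : tilt_domain g 0.
  split; last by rewrite subr0; exact: posdef_inv.
  by apply: adj_hermsymmx; rewrite trmx0 map_mx0.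
have := tilted_moments t M (theta := fun=> 0) dom.
rewrite /moment_formula [X in _ = X * _]big1 => [|g _]; last first.
  by rewrite /laplace mul0mx subr0 det1 powR1.
rewrite mul1r => e; apply: etrans (etrans e _).
  apply: eq_bigr => g _; congr complex_expectation; apply/funext => w.
  by rewrite /tilt mul0mx mxtrace0 expR0 mulr1.
by apply: eq_wick => i; rewrite subr0 invmxK.
Qed.
End Moments.

Import HBNNSimple.

(** * Expectation of a product of two real variables *)

Section Product.
Context (R : realType) (d : measure_display) (T : measurableType d).
Variable P : probability T R.
Local Open Scope classical_set_scope.

Lemma Rdominated_convergence (f : nat -> T -> R) (f' G : T -> R) :
  (forall n, measurable_fun setT (f n)) -> measurable_fun setT f' ->
  (forall w, f n w @[n --> \oo] --> f' w) ->
  P.-integrable setT (EFin \o G) -> (forall n w, `|f n w| <= G w) ->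
  (\int[P]_w f n w)%R @[n --> \oo] --> (\int[P]_w f' w)%R.
Proof.
move=> mf mf' cf iG le.
have mf1 n : measurable_fun setT (EFin \o f n) by exact/measurable_EFinP.
have mf2 : measurable_fun setT (EFin \o f') by exact/measurable_EFinP.
have cv1 : {ae P, forall w, setT w -> (EFin \o f n) w @[n --> \oo] --> (EFin \o f') w}.
  by apply: aeW => w _; apply: cvg_EFin (cf w); exact: nearW.
have le1 : {ae P, forall w n, setT w -> (`|(EFin \o f n) w| <= (EFin \o G) w)%E}.
  by apply: aeW => w n _; rewrite lee_fin.
have [i1 _ cv] := dominated_convergence measurableT mf1 mf2 cv1 iG le1.
rewrite /Rintegral; apply: fine_cvg; rewrite fineK; first exact: cv.
exact: integrable_fin_num.
Qed.

Variables Z X : T -> R.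
Hypotheses (iZ : P.-integrable setT (EFin \o Z)) (iX : P.-integrable setT (EFin \o X)).
Hypothesis iZX : P.-integrable setT (EFin \o (fun w => Z w * X w)).
Hypothesis ind : forall B : set R, measurable B ->
  (\int[P]_w (Z w * \1_B (X w)) = (\int[P]_w Z w) * (\int[P]_w \1_B (X w)))%R.

Let mZ : measurable_fun setT Z.
Proof. by have /integrableP[/measurable_EFinP] := iZ. Qed.
Let mX : measurable_fun setT X.
Proof. by have /integrableP[/measurable_EFinP] := iX. Qed.

Lemma integrable_mul_indic (Y : T -> R) (B : set R) : measurable B ->
  P.-integrable setT (EFin \o Y) -> P.-integrable setT (EFin \o (fun w => Y w * \1_B (X w))).
Proof.
move=> mB iY; have /integrableP[/measurable_EFinP mY _] := iY.
have iN : P.-integrable setT (EFin \o (fun w => `|Y w|)) by exact: integrable_norm.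
apply: (integrable_dominated _ iN).
  apply: measurable_funM => //.
  have mi : measurable_fun setT (\1_B : R -> R) by exact: measurable_indic.
  exact: (measurableT_comp mi mX).
move=> w; rewrite normrM ler_piMr// indicE.
by case: (_ \in _); rewrite ?normr1 ?normr0.
Qed.

Lemma expectation_mul_simple (g : {nnsfun R >-> R}) :
  (\int[P]_w (Z w * g (X w)) = (\int[P]_w Z w) * (\int[P]_w g (X w)))%R.
Proof.
pose s : seq R := finmap.enum_fset (fset_set (g @` setT)).
pose c (i : 'I_(size s)) := s`_i; pose B (i : 'I_(size s)) : set R := g @^-1` [set s`_i].
have mB i : measurable (B i) by exact: measurable_sfunP.
have gE x : g x = \sum_i (c i * \1_(B i) x) by rewrite fimfunEord.
have i1 : P.-integrable setT (EFin \o (fun=> 1 : R)) by exact: finite_measure_integrable_cst.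
have ii i : P.-integrable setT (EFin \o (fun w => \1_(B i) (X w))).
  by have := integrable_mul_indic (mB i) i1; rewrite /comp; under eq_fun do rewrite mul1r.
have lin (n : nat) (F : 'I_n -> T -> R) : (forall i, P.-integrable setT (EFin \o F i)) ->
   ((\int[P]_w (\sum_i F i w)) = \sum_i (\int[P]_w F i w))%R.
  move=> iF; rewrite /Rintegral; under eq_integral do rewrite -sumEFin.
  by rewrite integral_sum// -sum_fine// => i _; apply: integrable_fin_num => //; exact: iF.
under eq_Rintegral do rewrite gE mulr_sumr.
rewrite lin; last first.
  move=> i; have := integrable_scale (c i) (integrable_mul_indic (mB i) iZ).
  by rewrite /comp; under eq_fun do rewrite mulrCA.
under [X in _ = _ * X]eq_Rintegral do rewrite gE.
rewrite lin; last by move=> i; exact: integrable_scale.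
rewrite mulr_sumr; apply: eq_bigr => i _.
under eq_Rintegral do rewrite mulrCA.
by rewrite !RintegralZl ?ind//; [rewrite mulrCA|exact: integrable_mul_indic].
Qed.

Lemma expectation_mul_nonneg (h : R -> R) : measurable_fun setT h ->
  (forall x, 0 <= h x <= `|x|) ->
  (\int[P]_w (Z w * h (X w)) = (\int[P]_w Z w) * (\int[P]_w h (X w)))%R.
Proof.
move=> mh hh.
have h0 x : setT x -> (0 <= (EFin \o h) x)%E by move=> _; rewrite lee_fin; case/andP: (hh x).
have mEh : measurable_fun setT (EFin \o h) by exact/measurable_EFinP.
pose g n := nnsfun_approx measurableT mEh n.
have gle n x : g n x <= h x.
  by rewrite -lee_fin /g nnsfun_approxE; exact: (@le_approx _ _ _ setT _ n x h0 Logic.I).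
have gcvg x : g n x @[n --> \oo] --> h x.
  by have /fine_cvg := @cvg_nnsfun_approx _ _ _ _ measurableT _ mEh h0 x Logic.I.
have g0 n x : 0 <= g n x by exact: fun_ge0.
have hX w : `|h (X w)| <= `|X w| by case/andP: (hh (X w)) => ? ?; rewrite ger0_norm.
have gX n w : `|g n (X w)| <= `|X w|.
  by rewrite (le_trans _ (hX w))// !ger0_norm//; case/andP: (hh (X w)).
have mg n : measurable_fun setT (fun w => g n (X w)) by exact: measurableT_comp.
have mhX : measurable_fun setT (fun w => h (X w)) by exact: measurableT_comp.
have iNX : P.-integrable setT (EFin \o (fun w => `|X w|)) by exact: integrable_norm.
have iNZX : P.-integrable setT (EFin \o (fun w => `|Z w * X w|)) by exact: integrable_norm.
have c1 : (\int[P]_w (Z w * g n (X w)))%R @[n --> \oo] --> (\int[P]_w (Z w * h (X w)))%R.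
  apply: (Rdominated_convergence _ _ _ iNZX).
  - by move=> n; exact: measurable_funM.
  - exact: measurable_funM.
  - by move=> w; apply: cvgMr; exact: gcvg.
  - by move=> n w; rewrite !normrM ler_wpM2l.
have c2 : (\int[P]_w (g n (X w)))%R @[n --> \oo] --> (\int[P]_w (h (X w)))%R.
  exact: (Rdominated_convergence _ _ _ iNX).
have c3 : ((\int[P]_w Z w) * (\int[P]_w (g n (X w))))%R @[n --> \oo] --> ((\int[P]_w Z w) * (\int[P]_w (h (X w))))%R by apply: cvgMr; exact: c2.
have e : (fun n => \int[P]_w (Z w * g n (X w)))%R
    = (fun n => (\int[P]_w Z w) * (\int[P]_w (g n (X w))))%R.
  by apply/funext => n; exact: expectation_mul_simple.
by rewrite e in c1; exact: (cvg_unique _ c1 c3).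
Qed.

(** The hypothesis [ind] is the case of the indicator of an event of [X]; simple
    functions, then nonnegative functions and finally the positive and negative
    parts of [X] follow. *)
Lemma expectation_mul :
  (\int[P]_w (Z w * X w) = (\int[P]_w Z w) * (\int[P]_w X w))%R.
Proof.
pose hp (x : R) := Num.max x 0; pose hn (x : R) := Num.max (- x) 0.
have Xpn x : x = hp x - hn x.
  by rewrite /hp /hn; case: (leP x 0) => h; [rewrite max_l ?oppr_ge0// sub0r opprK|rewrite max_r ?oppr_le0 ?ltW// subr0].
have mp : measurable_fun setT hp by exact: measurable_maxr.
have mn : measurable_fun setT hn by apply: measurable_maxr => //; exact: measurable_funN.
have bp x : 0 <= hp x <= `|x| by rewrite /hp le_max lexx orbT ge_max ler_norm normr_ge0.
have bn x : 0 <= hn x <= `|x|.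
  by rewrite /hn le_max lexx orbT ge_max -normrN ler_norm normr_ge0.
have int (h : R -> R) (Y : T -> R) : measurable_fun setT h -> (forall x, 0 <= h x <= `|x|) ->
   measurable_fun setT Y ->
   P.-integrable setT (EFin \o (fun w => Y w * X w)) ->
   P.-integrable setT (EFin \o (fun w => Y w * h (X w))).
  move=> mh bh mY iYX; have iN : P.-integrable setT (EFin \o (fun w => `|Y w * X w|)) by exact: integrable_norm.
  apply: (integrable_dominated _ iN).
    by apply: measurable_funM => //; exact: measurableT_comp.
  move=> w /=; rewrite !normrM ler_wpM2l//.
  by case/andP: (bh (X w)) => b0 b1; rewrite ger0_norm.
have int1 (h : R -> R) : measurable_fun setT h -> (forall x, 0 <= h x <= `|x|) ->
   P.-integrable setT (EFin \o (fun w => h (X w))).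
  move=> mh bh; have := int h (fun=> 1 : R) mh bh (measurable_cst _).
  have E (k : T -> R) : (fun w => (1 : R) * k w) = k by apply/funext => w; rewrite mul1r.
  by rewrite !E; apply.
under eq_Rintegral do rewrite (Xpn (X _)) mulrBr.
rewrite RintegralB//; [|exact: int|exact: int].
rewrite !expectation_mul_nonneg// -mulrBr -RintegralB//; [|exact: int1|exact: int1].
by congr (_ * _); apply: eq_Rintegral => w _; rewrite -Xpn.
Qed.
End Product.

(** * Expectation of a product over an independent family *)

Section ComplexProduct.
Context (R : realType) (d : measure_display) (T : measurableType d).
Variable P : probability T R.
Local Open Scope classical_set_scope.

Lemma l1norm_integrable (Z : T -> R[i]) (G : T -> R) : cmeasurable Z ->
  P.-integrable setT (EFin \o G) -> (forall w, l1norm (Z w) <= G w) -> cintegrable P Z.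
Proof.
move=> [m1 m2] iG le; split; apply: (integrable_dominated _ iG) => // w;
  rewrite (le_trans _ (le w))//; [exact: Re_l1norm|exact: Im_l1norm].
Qed.

(** A complex variable is independent of [Z] as far as products are concerned as
    soon as its real and imaginary parts are.  The bound [G] makes the two factors
    and their product integrable at once. *)
Lemma complex_expectation_mul (Z X : T -> R[i]) (G : T -> R) :
  cmeasurable Z -> cmeasurable X -> P.-integrable setT (EFin \o G) ->
  (forall w, (1 + l1norm (Z w)) * (1 + l1norm (X w)) <= G w) ->
  (forall (B : set R) (h : R[i] -> R), measurable B ->
     h = (fun z => complex.Re z) \/ h = (fun z => complex.Im z) ->
     complex_expectation P (fun w => Z w * (\1_B (h (X w)) : R)%:C)
     = complex_expectation P Z * complex_expectation P (fun w => (\1_B (h (X w)) : R)%:C)) ->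
  complex_expectation P (fun w => Z w * X w)
  = complex_expectation P Z * complex_expectation P X.
Proof.
move=> mZ mX iG hG ind.
have lZ w : l1norm (Z w) <= G w.
  by rewrite (le_trans _ (hG w))//; have := l1norm_ge0 (Z w); have := l1norm_ge0 (X w); nra.
have lX w : l1norm (X w) <= G w.
  by rewrite (le_trans _ (hG w))//; have := l1norm_ge0 (Z w); have := l1norm_ge0 (X w); nra.
have lZX w : l1norm (Z w) * l1norm (X w) <= G w.
  by rewrite (le_trans _ (hG w))//; have := l1norm_ge0 (Z w); have := l1norm_ge0 (X w); nra.
have [iZr iZi] := l1norm_integrable mZ iG lZ.
have [iXr iXi] := l1norm_integrable mX iG lX.
(* The product is computed on each of the four pairs of a real or imaginary part
   of [Z] and one of [X]. *)
have key (a b : R[i] -> R) : (a = (fun z => complex.Re z) \/ a = (fun z => complex.Im z)) ->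
    (b = (fun z => complex.Re z) \/ b = (fun z => complex.Im z)) ->
    P.-integrable setT (EFin \o (fun w => a (Z w) * b (X w))) /\
    (\int[P]_w (a (Z w) * b (X w)) = (\int[P]_w a (Z w)) * (\int[P]_w b (X w)))%R.
  move=> ha hb.
  have la z : `|a z| <= l1norm z by case: ha => ->; [exact: Re_l1norm|exact: Im_l1norm].
  have lb z : `|b z| <= l1norm z by case: hb => ->; [exact: Re_l1norm|exact: Im_l1norm].
  have iaZ : P.-integrable setT (EFin \o (fun w => a (Z w))) by case: ha => ->.
  have ibX : P.-integrable setT (EFin \o (fun w => b (X w))) by case: hb => ->.
  have /integrableP[/measurable_EFinP maZ _] := iaZ.
  have /integrableP[/measurable_EFinP mbX _] := ibX.
  have iab : P.-integrable setT (EFin \o (fun w => a (Z w) * b (X w))).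
    apply: (integrable_dominated _ iG); first exact: measurable_funM.
    by move=> w; rewrite (le_trans _ (lZX w))// normrM ler_pM.
  split=> //; apply: expectation_mul => // B mB.
  have := ind B b mB hb; rewrite !complex_expectationE /= => e.
  have i1 : (\int[P]_w complex.Im (\1_B (b (X w)) : R)%:C = 0)%R.
    by rewrite /= /Rintegral integral0.
  case: ha => ha; move: e.
    move=> /(congr1 (fun z => complex.Re z)); rewrite cReM /= i1 mulr0 subr0 ha => <-.
    by apply: eq_Rintegral => w _; rewrite cReM /= mulr0 subr0.
  move=> /(congr1 (fun z => complex.Im z)); rewrite cImM /= i1 mulr0 add0r ha => <-.
  by apply: eq_Rintegral => w _; rewrite cImM /= mulr0 add0r.
have [i1 e1] := key _ _ (or_introl erefl) (or_introl erefl).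
have [i2 e2] := key _ _ (or_introl erefl) (or_intror erefl).
have [i3 e3] := key _ _ (or_intror erefl) (or_introl erefl).
have [i4 e4] := key _ _ (or_intror erefl) (or_intror erefl).
rewrite !complex_expectationE.
under eq_Rintegral do rewrite cReM.
under [X in _ +i* X]eq_Rintegral do rewrite cImM.
rewrite RintegralB// RintegralD// e1 e2 e3 e4.
by apply/eqP; rewrite eq_complex /= !eqxx.
Qed.
End ComplexProduct.

(** Measurable types are pointed; this makes matrices over [R[i]] pointed. *)
HB.instance Definition _ (R : realType) := isPointed.Build R[i] 0.

Section Family.
Context (R : realType) (d : measure_display) (T : measurableType d).
Variable P : probability T R.
Local Open Scope classical_set_scope.
Variables (I : finType) (N : nat).
Variable W : I -> T -> 'M[R[i]]_N.
Hypotheses (hW : forall r, random_hermitian (W r)) (hind : mutually_independent P W).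

(** A generating family of the Borel sets of matrices, named in order to equip
    matrices with the structure of a measurable type. *)
Definition mx_cylinders : set (set 'M[R[i]]_N) :=
  [set A | exists (i j : 'I_N) (B : set R), measurable B /\
        (A = [set M : 'M[R[i]]_N | B (complex.Re (M i j))] \/
         A = [set M : 'M[R[i]]_N | B (complex.Im (M i j))])].

Definition mx_cmeasurable (f : 'M[R[i]]_N -> R[i]) : Prop :=
  cmeasurable (f : g_sigma_algebraType mx_cylinders -> R[i]).

Lemma mx_cmeasurable_entry a b : mx_cmeasurable (fun M => M a b).
Proof.
split => _ B mB; rewrite setTI; apply: sub_sigma_algebra; exists a, b, B; split => //.
  by left.
by right.
Qed.

Lemma measurable_W r : measurable_fun setT (W r : T -> g_sigma_algebraType mx_cylinders).
Proof. by move=> _ B mB; rewrite setTI; apply: (hW r).1. Qed.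

Lemma cmeasurable_W r f : mx_cmeasurable f -> cmeasurable (fun w => f (W r w)).
Proof.
move=> [m1 m2]; split.
  exact: (measurableT_comp m1 (measurable_W r)).
exact: (measurableT_comp m2 (measurable_W r)).
Qed.

Lemma indic_preimage U V (g : U -> V) (A : set V) w :
  \1_A (g w) = \1_(g @^-1` A) w :> R.
Proof.
by rewrite !indicE; congr (_%:R); apply/idP/idP => /set_mem h; apply/mem_set.
Qed.

Lemma prod_indic (J : finType) (A : J -> set T) w :
  \prod_r (\1_(A r) w : R) = \1_(\bigcap_(r in [set` [set: J]%SET]) A r) w.
Proof.
rewrite indicE; case: (boolP (_ \in _)) => [|].
  move=> /set_mem h; rewrite big1// => r _; rewrite indicE mem_set//.
  by apply: h; rewrite /= finset.in_setT.
move=> /negP h; have [r hr] : exists r, ~ A r w.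
  apply/existsNP => hA; apply: h; apply/mem_set => r _; exact: hA.
by rewrite (bigD1 r)//= indicE memNset// mul0r.
Qed.

Variable f : I -> 'M[R[i]]_N -> R[i].
Hypothesis mf : forall r, mx_cmeasurable (f r).
Variable G : T -> R.
Hypothesis iG : P.-integrable setT (EFin \o G).
Hypothesis hG : forall w, \prod_r (1 + l1norm (f r (W r w))) <= G w.

Let X r w := f r (W r w).
Let ind (A : set 'M[R[i]]_N) r w : R[i] := (\1_A (W r w) : R)%:C.
Let term (js : seq I) (A : I -> set 'M[R[i]]_N) r w : R[i] :=
  if r \in js then X r w else ind (A r) r w.

Let mind A r : mx_borel A -> cmeasurable (ind A r).
Proof.
move=> mA; split => /=; last exact: measurable_cst.
have -> : (fun w => \1_A (W r w)) = (\1_(W r @^-1` A) : T -> R).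
  by apply/funext => w; rewrite indic_preimage.
by apply: measurable_indic; exact: (hW r).1.
Qed.

Let mX r : cmeasurable (X r). Proof. exact: cmeasurable_W. Qed.

Let mterm js A r : (forall r, mx_borel (A r)) -> cmeasurable (term js A r).
Proof.
move=> mA; rewrite /term; case: (r \in js); [exact: mX|exact: mind].
Qed.

Let ind_le A r w : l1norm (ind A r w) <= 1.
Proof.
rewrite /ind /l1norm /= normr0 addr0 indicE.
by case: (_ \in _); rewrite ?normr1 ?normr0.
Qed.

Let term_le js A r w : l1norm (term js A r w) <= 1 + l1norm (X r w).
Proof.
rewrite /term; case: (r \in js); first by rewrite lerDr.
by rewrite (le_trans (ind_le _ _ _))// lerDl l1norm_ge0.
Qed.

Lemma l1norm_prod (s : seq I) (p : pred I) (F : I -> R[i]) :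
  l1norm (\prod_(r <- s | p r) F r) <= \prod_(r <- s | p r) l1norm (F r).
Proof.
elim/big_rec2: _ => [|i y z _ h]; first by rewrite /l1norm /= normr0 addr0 normr1.
by rewrite (le_trans (l1normM _ _))// ler_wpM2l// l1norm_ge0.
Qed.

(** Independence is the case where all factors are indicators.  The indicators are
    replaced by the functions [f r] one index at a time, by
    [complex_expectation_mul], for which the events of the new index are still
    available. *)
Lemma expectation_mixed js A : uniq js -> (forall r, mx_borel (A r)) ->
  complex_expectation P (fun w => \prod_r term js A r w)
  = \prod_r complex_expectation P (term js A r).
Proof.
elim: js A => [|r0 js IH] A /=.
  move=> _ mA.
  have E (B : set T) : measurable B ->
      complex_expectation P (fun w => (\1_B w : R)%:C) = (fine (P B))%:C.
    move=> mB; rewrite complex_expectationE /= /Rintegral integral0.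
    by rewrite integral_indic// setIT.
  have mAW r : measurable (W r @^-1` A r) by exact: (hW r).1.
  have e r : term [::] A r = (fun w => (\1_(W r @^-1` A r) w : R)%:C).
    by apply/funext => w; rewrite /term /ind indic_preimage.
  under eq_fun do (under eq_bigr do rewrite e); under [RHS]eq_bigr do rewrite e E//.
  under eq_fun do rewrite -rmorph_prod prod_indic.
  rewrite E; last by apply: fin_bigcap_measurable.
  rewrite hind; last by move=> r _; exact: mA.
  rewrite -rmorph_prod; congr (_%:C).
  rewrite (eq_bigr (fun r => (fine (P (W r @^-1` A r)))%:E)); last first.
    by move=> r _; rewrite fineK// fin_num_measure.
  rewrite prodEFin /=; apply: eq_bigl => r; exact: finset.in_setT.
move=> /andP[r0js ujs] mA.
pose Z w := \prod_(r | r != r0) term js A r w.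
pose c := \prod_(r | r != r0) complex_expectation P (term js A r).
have teq r : r != r0 -> term (r0 :: js) A r = term js A r.
  by move=> rr0; rewrite /term inE (negbTE rr0).
have tr0 : term (r0 :: js) A r0 = X r0 by rewrite /term mem_head.
have LE : (fun w => \prod_r term (r0 :: js) A r w) = (fun w => Z w * X r0 w).
  apply/funext => w; rewrite (bigD1 r0)//= tr0 mulrC; congr (_ * _).
  by apply: eq_bigr => r rr0; rewrite teq.
have RE : \prod_r complex_expectation P (term (r0 :: js) A r)
    = c * complex_expectation P (X r0).
  rewrite (bigD1 r0)//= tr0 mulrC; congr (_ * _).
  by apply: eq_bigr => r rr0; rewrite teq.
(* The induction hypothesis with the event of index [r0] replaced by [B]. *)
have step B : mx_borel B -> complex_expectation P (fun w => Z w * ind B r0 w)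
    = c * complex_expectation P (ind B r0).
  move=> mB; pose A' r := if r == r0 then B else A r.
  have mA' r : mx_borel (A' r) by rewrite /A'; case: eqP.
  have teq' r : r != r0 -> term js A' r = term js A r.
    by move=> rr0; rewrite /term /A' (negbTE rr0).
  have tr0' : term js A' r0 = ind B r0 by rewrite /term (negbTE r0js) /A' eqxx.
  have := IH A' ujs mA'.
  rewrite (_ : (fun w => \prod_r term js A' r w) = (fun w => Z w * ind B r0 w)); last first.
    apply/funext => w; rewrite (bigD1 r0)//= tr0' mulrC; congr (_ * _).
    by apply: eq_bigr => r rr0; rewrite teq'.
  move=> ->; rewrite (bigD1 r0)//= tr0' mulrC; congr (_ * _).
  by apply: eq_bigr => r rr0; rewrite teq'.
have cE : complex_expectation P Z = c.
  have mT : mx_borel (setT : set 'M[R[i]]_N).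
    exact: (@measurableT _ (g_sigma_algebraType mx_cylinders)).
  have := step _ mT.
  have -> : ind setT r0 = (fun=> 1) by apply/funext => w; rewrite /ind indicE in_setT.
  rewrite [X in _ = _ * X](_ : _ = 1) ?mulr1; last first.
    by rewrite /complex_expectation /= !expectation_cst.
  by move=> <-; congr complex_expectation; apply/funext => w; rewrite mulr1.
have iG2 := integrable_scale 2 iG.
rewrite LE RE -cE; apply: (complex_expectation_mul _ (mX r0) iG2) => [|w|B h mB hh].
- by apply: cmeasurable_prod => r _; exact: mterm.
- pose Pi := \prod_(r | r != r0) (1 + l1norm (X r w)).
  have Z1 : l1norm (Z w) <= Pi.
    rewrite (le_trans (l1norm_prod _ _ _))// ler_prod// => r _.
    by rewrite l1norm_ge0 term_le.
  have Pi1 : 1 <= Pi.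
    rewrite /Pi; elim/big_ind: _ => // [x y|r _]; first exact: mulr_ege1.
    by rewrite lerDl l1norm_ge0.
  have := hG w; rewrite (bigD1 r0)//= -/Pi => h.
  rewrite (@le_trans _ _ (2 * Pi * (1 + l1norm (X r0 w))))//.
    by rewrite ler_wpM2r ?addr_ge0 ?l1norm_ge0// mulr2n mulrDl mul1r lerD.
  by rewrite -mulrA ler_wpM2l// mulrC.
- pose A' : set 'M[R[i]]_N := (fun M => h (f r0 M)) @^-1` B.
  have mA' : mx_borel A'.
    have mh : measurable_fun setT
        ((fun M => h (f r0 M)) : g_sigma_algebraType mx_cylinders -> R).
      by case: hh => ->; [exact: (mf r0).1|exact: (mf r0).2].
    by have := mh measurableT B mB; rewrite setTI.
  have eB v : \1_B (h (X r0 v)) = \1_A' (W r0 v) :> R.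
    exact: (indic_preimage (fun M => h (f r0 M)) B (W r0 v)).
  have e : (fun w => (\1_B (h (X r0 w)) : R)%:C) = ind A' r0.
    by apply: funext => v; rewrite /ind -eB.
  have e2 : (fun w => Z w * (\1_B (h (X r0 w)) : R)%:C) = (fun w => Z w * ind A' r0 w).
    by rewrite -e.
  by rewrite e e2 cE; exact: step.
Qed.

Lemma expectation_prod :
  complex_expectation P (fun w => \prod_r f r (W r w))
  = \prod_r complex_expectation P (fun w => f r (W r w)).
Proof.
have mT (r : I) : mx_borel (setT : set 'M[R[i]]_N).
  exact: (@measurableT _ (g_sigma_algebraType mx_cylinders)).
have := expectation_mixed (enum_uniq I) mT.
have e r : term (enum I) (fun=> setT) r = X r.
  by apply/funext => w; rewrite /term mem_enum.
under eq_fun do under eq_bigr do rewrite e.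
by under [RHS]eq_bigr do rewrite e.
Qed.

End Family.

(** * Moments of replicas *)

(** The largest factor bounds all the others. *)
Lemma prod_le_sum_pow (R : realDomainType) (I : finType) (y : I -> R) :
  (forall r, 0 <= y r) -> \prod_r y r <= 1 + \sum_r y r ^+ #|I|.
Proof.
move=> y0; have s0 (q : pred I) : 0 <= \sum_(r | q r) y r ^+ #|I|.
  by apply: sumr_ge0 => r _; exact: exprn_ge0.
case: (pickP I) => [r0 _|I0]; last by rewrite big_pred0// lerDl s0.
have [r1 _ h] := arg_maxP y (erefl : xpredT r0).
rewrite (@le_trans _ _ (\prod_(r : I) y r1))//.
  by apply: ler_prod => r _; rewrite y0 /=; apply: h.
rewrite prodr_const (bigD1 r1)//= addrCA lerDl addr_ge0//.
Qed.

Section Replicas.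
Context (R : realType) (d : measure_display) (T : measurableType d).
Variable P : probability T R.
Variables (N s : nat) (Sigma : 'I_s -> 'M[R[i]]_N) (p : 'I_s -> R).
Variable W : 'I_s -> T -> 'M[R[i]]_N.
Hypothesis wW : forall r, wishart P (Sigma r) (p r) (W r).
Hypothesis hind : mutually_independent P W.
Local Open Scope classical_set_scope.

Let hW r : random_hermitian (W r). Proof. by case: (wW r). Qed.

Lemma tiltable0 r : tiltable P (W r) 0.
Proof.
apply: (wishart_tiltable (wW r)).
  by apply: adj_hermsymmx; rewrite trmx0 map_mx0.
by rewrite subr0; apply: posdef_inv; case: (wW r).
Qed.

(** Bounding a product by a sum of powers reduces the integrability of a product of
    functions of different matrices to that of functions of one matrix. *)
Lemma tempered_envelope (f : 'I_s -> T -> R[i]) : (forall r, tempered (W r) (f r)) ->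
  exists2 G : T -> R, P.-integrable setT (EFin \o G) &
    forall w, \prod_r (1 + l1norm (f r w)) <= G w.
Proof.
move=> tf; pose y r w : R := 1 + l1norm (f r w).
have y0 r w : 0 <= y r w by rewrite addr_ge0// l1norm_ge0.
exists (fun w => 1 + \sum_r y r w ^+ #|'I_s|); last by move=> w; exact: (prod_le_sum_pow (fun r => y0 r w)).
have ty r : tempered (W r) (fun w => (y r w)%:C).
  have [mf [c [k [c0 h]]]] := tf r; split.
    split; last exact: measurable_cst.
    by apply: measurable_funD => //; exact: measurable_l1norm.
  exists (1 + c), k; split=> [|w]; first by rewrite addr_ge0.
  rewrite /l1norm /= normr0 addr0 ger0_norm ?y0// /y mulrDl mul1r lerD//.
  by rewrite exprn_ege1// lerDl mass_ge0.
have iy r : P.-integrable setT (EFin \o (fun w => y r w ^+ #|'I_s|)).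
  have tp : tempered (W r) (fun w => \prod_(i < #|'I_s|) (y r w)%:C).
    by apply: tempered_prod => i _; exact: ty.
  have [+ _] := tempered_integrable (hW r) (tiltable0 r) tp.
  have e w : complex.Re (\prod_(i < #|'I_s|) (y r w)%:C * (tilt (W r) 0 w)%:C) = y r w ^+ #|'I_s|.
    rewrite -rmorph_prod /tilt mul0mx mxtrace0 expR0 mulr1 /=.
    by rewrite prodr_const !card_ord.
  by rewrite (funext e).
pose Y r : T -> R := fun w => y r w ^+ #|'I_s|; pose one : T -> R := fun=> 1.
rewrite (_ : _ \o _ = (EFin \o one) \+ (fun w => \sum_r (EFin \o Y r) w))%E.
  apply: integrableD => //; first exact: finite_measure_integrable_cst.
  apply: integrable_sum => // r _; exact: iy.
by apply/funext => w; rewrite /= EFinD sumEFin.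
Qed.

Variable n : nat.
Variables (t : 'I_n -> 'I_s) (A : 'I_n -> 'M[R[i]]_N).

Let f (q : pred 'I_n) r M := \prod_(i | (t i == r) && q i) \tr (A i *m M).

Let fE q w : \prod_r f q r (W r w) = \prod_(i | q i) \tr (A i *m W (t i) w).
Proof.
rewrite [RHS](partition_big t xpredT)//=; apply: eq_bigr => r _.
under eq_bigl do rewrite andbC.
by rewrite /f; apply: eq_big => [i|i /andP[/eqP <-]//]; rewrite andbC.
Qed.

Let tf q r : tempered (W r) (fun w => f q r (W r w)).
Proof. by apply: tempered_prod => i _; exact: tempered_tr. Qed.

Lemma cintegrable_trace_prod (q : pred 'I_n) :
  cintegrable P (fun w => \prod_(i | q i) \tr (A i *m W (t i) w)).
Proof.
have [G iG hG] := tempered_envelope (tf q).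
apply: (l1norm_integrable _ iG) => [|w].
  by apply: cmeasurable_prod => i _; exact: cmeasurable_tr.
rewrite -fE (le_trans (l1norm_prod _ _ _))// (le_trans _ (hG w))// ler_prod// => r _.
by rewrite l1norm_ge0 /= lerDr ler01.
Qed.

Lemma mx_cmeasurable_trace_prod q r : mx_cmeasurable (f q r).
Proof.
apply: cmeasurable_prod => i _; apply: cmeasurable_sum => a _.
under eq_fun do rewrite mxE.
apply: cmeasurable_sum => b _; apply: cmeasurableM; first exact: cmeasurable_cst.
exact: mx_cmeasurable_entry.
Qed.

(** A product of [kappa] expectations is an expectation over [kappa] independent
    copies of the family [W].  As [wishart_moments] is about products of
    expectations, it applies to the family indexed by pairs of a matrix and a
    replica, without constructing the copies. *)
Lemma replica_moments kappa (chi : 'I_n -> 'I_kappa) :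
  \prod_c complex_expectation P (fun w => \prod_(i | chi i == c) \tr (A i *m W (t i) w))
  = wick (fun g : 'I_s * 'I_kappa => (p g.1)%:C) (fun i => (t i, chi i))
      (fun i => A i *m Sigma (t i)).
Proof.
rewrite -(@wishart_moments R d T P _ N (fun g => Sigma g.1) (fun g => p g.1) (fun g => W g.1)
  (fun g => wW g.1) n (fun i => (t i, chi i)) A).
transitivity (\prod_(c < kappa) \prod_(r < s)
   complex_expectation P (fun w => \prod_(i | (t i, chi i) == (r, c)) \tr (A i *m W r w))).
  apply: eq_bigr => c _; pose q i := chi i == c.
  have [G iG hG] := tempered_envelope (tf q).
  have := expectation_prod hW hind (mx_cmeasurable_trace_prod q) iG hG.
  under eq_fun do rewrite fE.
  move=> ->; apply: eq_bigr => r _; congr complex_expectation; apply: funext => w.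
rewrite exchange_big pair_big /=; apply: eq_bigr => -[r c] _ //.
Qed.
End Replicas.

(** * The genus expansion *)

Section StarTypes.
Variables (s m : nat) (q : 'I_m -> seq 'I_s) (k : mindex m).

Let js : seq 'I_m := flatten [seq nseq (k j) j | j <- enum 'I_m].

Lemma stars_map : stars q k = map q js.
Proof.
rewrite /js map_flatten -map_comp; congr flatten; apply: eq_map => j /=.
by rewrite map_nseq.
Qed.

Lemma size_shape_stars : size (shape (stars q k)) = size js.
Proof. by rewrite size_map stars_map size_map. Qed.

Definition star_type (i : 'I_(size (shape (stars q k)))) : 'I_m :=
  tnth (in_tuple js) (cast_ord size_shape_stars i).

Lemma star_typeP (i : 'I_(size (shape (stars q k)))) : nth [::] (stars q k) i = q (star_type i).
Proof.
have lti : (i < size js)%N by rewrite -size_shape_stars ltn_ord.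
transitivity (nth [::] (map q js) i); first by rewrite -stars_map.
rewrite (nth_map (star_type i))//.
by congr q; rewrite {2}/star_type (tnth_nth (star_type i)).
Qed.

Lemma sum_cast_tnth (X : Type) (l : seq X) n (e : n = size l) (F : X -> nat) :
  \sum_(i < n) F (tnth (in_tuple l) (cast_ord e i)) = (\sum_(x <- l) F x)%N.
Proof.
subst n; rewrite big_tnth; apply: eq_bigr => i _; by rewrite cast_ord_id.
Qed.

Lemma type_of_stars : type_of star_type [set: _] = k.
Proof.
apply/ffunP => j; rewrite ffunE -sum1dep_card big_mkcond /=.
under eq_bigr do rewrite finset.in_setT /=.
rewrite (sum_cast_tnth size_shape_stars (fun x => if x == j then 1%N else 0%N)).
rewrite /js big_flatten big_map big_enum /= (bigD1 j)//= big_nseq eqxx iter_addn_0 mul1n.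
rewrite [X in (_ + X)%N]big1 ?addn0// => j' ne.
by rewrite big_nseq (negbTE ne) iter_addn_0 mul0n.
Qed.

Lemma prod_type_of (K : comPzSemiRingType) (L : finType) (tau : L -> 'I_m) (x : 'I_m -> K) (S : {set L}) :
  \prod_j x j ^+ type_of tau S j = \prod_(i in S) x (tau i).
Proof.
rewrite (partition_big tau xpredT)//=; apply: eq_bigr => j _.
rewrite ffunE -prodr_const; apply: eq_big => [i|i]; first by rewrite inE.
by rewrite inE => /andP[_ /eqP ->].
Qed.
End StarTypes.

Section Assembly.
Context (R : realType) (d : measure_display) (T : measurableType d).
Variables (P : probability T R) (N s m : nat).
Hypothesis hN : (1 <= N)%N.
Variables (q : 'I_m -> seq 'I_s) (C : 'I_s -> 'M[R[i]]_N) (lambda : 'I_s -> R).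
Variable W : 'I_s -> T -> 'M[R[i]]_N.
Hypothesis hq : forall j, (1 <= size (q j))%N.
Hypothesis hW : forall r, wishart P (N%:R^-1 *: C r) (N%:R * lambda r) (W r).
Hypothesis hind : mutually_independent P W.
Variable k : mindex m.

Let ds := shape (stars q k).
Let n := nstars q k.
Let sigma : 'S_n := sigmak q k.
Let t : 'I_n -> 'I_s := @color s m q k.
Let bo : 'I_n -> 'I_(size ds) := @block_of ds.
Let x0 : 'I_N := Ordinal hN.
Let tau := @star_type s m q k.

Lemma star_trace (i : 'I_(size ds)) (A : 'I_s -> 'M[R[i]]_N) :
  \tr (mx_word A (q (tau i)))
  = \sum_(b : {ffun 'I_n -> 'I_N} | off_support x0 (fun e => bo e == i) b)
      \prod_(e | bo e == i) A (t e) (b e) (b (sigma e)).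
Proof.
have bgt := @stars_gt0 s m q k hq.
have -> : mx_word A (q (tau i)) = \big[mulmx/1%:M]_(e <- block i) A (t e).
  by rewrite -star_typeP -(star_colors hq) /mx_word big_map.
rewrite (tr_cycle (fun e => A (t e)) x0 (block_neq0 bgt i) (block_uniq i) (block_fcycle bgt i)).
apply: eq_big => [b|b _].
  by apply: eq_forallb => e; rewrite /= mem_block.
by rewrite big_uniq ?block_uniq //; apply: eq_bigl => e; rewrite mem_block.
Qed.

(** The traces of the words of some stars, expanded over the indices of their
    darts.  An entry of a matrix is written as a trace against an elementary
    matrix, the form in which [wishart_moments] applies. *)
Lemma prod_star_traces (S : pred 'I_(size ds)) (A : 'I_s -> 'M[R[i]]_N) :
  \prod_(i | S i) \tr (mx_word A (q (tau i)))
  = \sum_(b : {ffun 'I_n -> 'I_N} | off_support x0 (fun e => S (bo e)) b)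
      \prod_(e | S (bo e)) \tr (delta_mx (b (sigma e)) (b e) *m A (t e)).
Proof.
have bgt := @stars_gt0 s m q k hq.
under eq_bigr do rewrite star_trace.
rewrite (@prod_sum_regroup _ _ _ _ x0 bo S) => [|i b b' _ h].
  apply: eq_bigr => b _; rewrite [RHS](partition_big bo S)//=.
  apply: eq_bigr => i Si; apply: eq_big => [e|e _]; last by rewrite tr_delta_mul.
  by case: eqP => [->|]; rewrite ?Si ?andbF.
apply: eq_bigr => e /eqP ei; rewrite !h// -ei.
exact: (block_of_perm bgt).
Qed.

(** The contribution of [alpha] to the moments of the traces of the stars: a shape
    parameter for each cycle of [alpha], and an index sum along the faces, which
    are the cycles of [alpha * sigma]. *)
Definition permutation_weight (alpha : 'S_n) : R[i] :=
  (\prod_(e | cycle_max alpha e) (N%:R * lambda (t e))%:C)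
  * \sum_(b : {ffun 'I_n -> 'I_N})
      \prod_e (N%:R^-1 *: C (t e)) (b e) (b ((alpha * sigma)%g e)).

(** Expectation being linear, [replica_moments] applies for each index function on
    the darts, and [wick_delta] then couples its values along the faces. *)
Lemma labelled_moments kappa (chi : {ffun 'I_(size ds) -> 'I_kappa}) :
  \prod_c complex_expectation P
      (fun w => \prod_(i | chi i == c) \tr (mx_word (fun r => W r w) (q (tau i))))
  = \sum_(alpha : 'S_n | [forall e, (t (alpha e), chi (bo (alpha e))) == (t e, chi (bo e))])
      permutation_weight alpha.
Proof.
have bgt := @stars_gt0 s m q k hq.
pose A (b : {ffun 'I_n -> 'I_N}) (e : 'I_n) : 'M[R[i]]_N := delta_mx (b (sigma e)) (b e).
pose phi c b := complex_expectation P
  (fun w => \prod_(e | chi (bo e) == c) \tr (A b e *m W (t e) w)).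
have E c : complex_expectation P
      (fun w => \prod_(i | chi i == c) \tr (mx_word (fun r => W r w) (q (tau i))))
    = \sum_(b | off_support x0 (fun e => chi (bo e) == c) b) phi c b.
  rewrite -complex_expectation_sum => [|b _]; last first.
    exact: (cintegrable_trace_prod hW).
  congr complex_expectation; apply/funext => w; exact: prod_star_traces.
under eq_bigr do rewrite E.
rewrite (@prod_sum_regroup _ _ _ _ x0 (fun e => chi (bo e)) xpredT) => [|c b b' _ h]; last first.
  congr complex_expectation; apply/funext => w; apply: eq_bigr => e /eqP ec.
  by rewrite /A !h// -ec; congr (chi _); exact: (block_of_perm bgt).
under eq_bigl do rewrite off_supportT.
rewrite (eq_bigr (fun b : {ffun 'I_n -> 'I_N} => \sum_(alpha : 'S_n | [forall e, (t (alpha e), chi (bo (alpha e))) == (t e, chi (bo e))])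
   (\prod_(e | cycle_max alpha e) (N%:R * lambda (t e))%:C)
   * \prod_e (N%:R^-1 *: C (t e)) (b e) (b ((alpha * sigma)%g e)))) => [|b _].
  rewrite exchange_big /=; apply: eq_bigr => alpha _.
  by rewrite /permutation_weight mulr_sumr.
rewrite (replica_moments hW hind t (A b) (fun e => chi (bo e))).
exact: (@wick_delta _ _ N n (fun g => (N%:R * lambda g.1)%:C)
  (fun e => (t e, chi (bo e))) sigma (fun e => N%:R^-1 *: C (t e)) b).
Qed.

(** Replicas are attached to stars, that is, they are labellings of the darts
    invariant under [sigma]. *)
Lemma card_block_labels kappa (alpha : 'S_n) :
  #|[set chi : {ffun 'I_(size ds) -> 'I_kappa} | [forall e, chi (bo (alpha e)) == chi (bo e)]]|
  = (kappa ^ components sigma alpha)%N.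
Proof.
have bgt := @stars_gt0 s m q k hq.
have [g gP] := choice (block_of_surj bgt).
pose pull (chi : {ffun 'I_(size ds) -> 'I_kappa}) : {ffun 'I_n -> 'I_kappa} := [ffun e => chi (bo e)].
have pull_inj : injective pull.
  by move=> c c' /ffunP h; apply/ffunP => i; have := h (g i); rewrite !ffunE /bo gP.
rewrite -[X in (X ^ _)%N]card_ord -card_invariant_labels -(card_imset _ pull_inj).
apply: eq_card => b; apply/imsetP/invariant_labelsP => [[chi + ->] e|h].
  rewrite inE => /forallP h; rewrite !ffunE (eqP (h e)); split=> //; congr (chi _).
  exact: (block_of_perm bgt).
have bE e : b e = b (g (bo e)).
  have bs x : b (sigma x) = b x := (h x).1.
  apply: (porbit_invariant (s := sigma) bs).
  by rewrite (porbit_block bgt) /bo gP.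
exists [ffun i => b (g i)]; last by apply/ffunP => e; rewrite !ffunE.
by rewrite inE; apply/forallP => e; rewrite !ffunE -!bE (h e).2.
Qed.

Let Z := partition_series P q W.

(** The [kappa]-th power distributes the stars over [kappa] replicas; once the sums
    are exchanged, [alpha] is counted once for each labelling of its components by
    replicas. *)
Lemma fps_exp_partition_series kappa :
  fps_exp Z kappa.+1 k = (- N%:R) ^+ mdeg k / (mfact k)%:R
    * \sum_(alpha : 'S_n | [forall e, t (alpha e) == t e])
        permutation_weight alpha * kappa.+1%:R ^+ components sigma alpha.
Proof.
pose z (k' : mindex m) := complex_expectation P
  (fun w => \prod_j (\tr (mx_word (fun r => W r w) (q j))) ^+ k' j).
have ZE k' : Z k' = (- N%:R) ^+ mdeg k' / (mfact k')%:R * z k'.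
  by rewrite /Z /partition_series mulrA -exprMn mulrN1.
rewrite -[in LHS](type_of_stars q k) (fps_exp_type _ _ _ ZE) type_of_stars; congr (_ * _).
rewrite labelled_sumT.
have zE (chi : {ffun 'I_(size ds) -> 'I_kappa.+1}) :
    \prod_c z (type_of (@star_type s m q k) [set i | chi i == c])
    = \sum_(alpha : 'S_n | [forall e, t (alpha e) == t e])
        if [forall e, chi (bo (alpha e)) == chi (bo e)] then permutation_weight alpha else 0.
  rewrite -big_mkcondr (eq_bigl (fun alpha : 'S_n =>
    [forall e, (t (alpha e), chi (bo (alpha e))) == (t e, chi (bo e))])) => [|alpha].
    rewrite -labelled_moments; apply: eq_bigr => c _; congr complex_expectation.
    apply/funext => w.
    rewrite (prod_type_of (@star_type s m q k) (fun j => \tr (mx_word (fun r => W r w) (q j)))).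
    by apply: eq_bigl => i; rewrite inE.
  apply/andP/forallP => [[/forallP h1 /forallP h2] e|h].
    by rewrite xpair_eqE h1 h2.
  by split; apply/forallP => e; have := h e; rewrite xpair_eqE => /andP[].
rewrite (eq_bigr _ (fun chi _ => zE chi)) exchange_big; apply: eq_bigr => alpha _.
rewrite -big_mkcond sumr_const -natrX -card_block_labels mulr_natr.
by congr (_ *+ _); apply: eq_card => chi; rewrite !inE.
Qed.

Let N0 : (N%:R : R[i]) != 0. Proof. by rewrite pnatr_eq0 -lt0n. Qed.

Lemma permutation_weight_faces (alpha : 'S_n) : (forall e, t (alpha e) = t e) ->
  permutation_weight alpha
  = N%:R ^+ (#|porbits alpha| + #|faces alpha|) / N%:R ^+ n
    * ((\prod_r (lambda r)%:C ^+ #|vertices_of_color alpha r|)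
      * \prod_(f in faces alpha) face_trace C alpha f).
Proof.
move=> tal; rewrite /permutation_weight.
under eq_bigr do rewrite rmorphM rmorph_nat.
rewrite big_split prodr_const (prod_cycle_max (fun r => (lambda r)%:C) tal).
rewrite (_ : #|_| = #|porbits alpha|); last first.
  by rewrite -card_cycle_max; apply: eq_card => e; rewrite inE.
have -> : \sum_(b : {ffun 'I_n -> 'I_N}) \prod_e (N%:R^-1 *: C (t e)) (b e) (b ((alpha * sigma)%g e))
  = (N%:R ^+ n)^-1 * \prod_(f in faces alpha) (N%:R * face_trace C alpha f).
  have -> : \prod_(f in faces alpha) (N%:R * face_trace C alpha f)
      = \prod_(f in porbits (alpha * sigma)%g) \tr (\big[mulmx/1%:M]_(e <- face_cycle alpha f) C (t e)).
    apply: eq_bigr => f _; rewrite /face_trace mulrA mulfV// mul1r.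
    by rewrite /mx_word big_map.
  rewrite -(@sum_prod_porbits _ N _ (fun e => C (t e)) x0) => [|f].
    rewrite mulr_sumr; apply: eq_bigr => b _.
    under eq_bigr do rewrite mxE.
    by rewrite big_split prodr_const card_ord exprVn.
  case/imsetP=> e _ ->; rewrite /face_cycle; case: pickP => [j jf|h]; first by exists j.
  by have := h e; rewrite /= porbit_id.
rewrite big_split prodr_const /= exprD.
rewrite -!mulrA; congr (_ * _); rewrite [RHS]mulrCA [RHS]mulrC -!mulrA.
by rewrite [RHS]mulrCA; congr (_ * _); rewrite mulrCA; congr (_ * _); exact: mulrC.
Qed.

Lemma partition_series0 : Z [ffun=> 0%N] = 1.
Proof.
have m0 : mdeg [ffun=> 0%N] = 0%N by move=> m'; apply/eqP; rewrite mdeg0P.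
rewrite /Z /partition_series m0 !expr0 /mfact big1 => [|j _]; last by rewrite ffunE.
rewrite invr1 !mul1r.
have -> : (fun w => \prod_j \tr (mx_word (fun r => W r w) (q j)) ^+ [ffun=> 0%N] j) = (fun w => 1 : R[i]).
  by apply/funext => w; rewrite big1// => j _; rewrite ffunE.
by rewrite /complex_expectation /= !expectation_cst.
Qed.

Let colored : pred 'S_n := fun alpha => [forall e, t (alpha e) == t e].

(** The linear coefficient in the number of replicas retains the permutations with
    a single component, that is, the hypermaps. *)
Lemma log_partition_coef :
  log_partition_series P q W k = (- N%:R) ^+ mdeg k / (mfact k)%:R
    * \sum_(alpha | colored alpha && (components sigma alpha == 1%N)) permutation_weight alpha.
Proof.
pose c : R[i] := (- N%:R) ^+ mdeg k / (mfact k)%:R.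
pose p : {poly R[i]} := c *: \sum_(alpha | colored alpha) permutation_weight alpha *: 'X^(components sigma alpha).
rewrite /log_partition_series (@fps_log_coef _ _ _ _ p).
- rewrite coefZ coef_sum big_mkcondr; congr (_ * _); apply: eq_bigr => alpha _.
  by rewrite coefZ coefXn eq_sym; case: eqP => _; rewrite ?mulr1 ?mulr0.
- have m0 : mdeg [ffun=> 0%N] = 0%N by move=> m'; apply/eqP; rewrite mdeg0P.
  by rewrite /fps_sub -/Z partition_series0 /fps_one m0 subrr.
- move=> kappa.
  have -> : (fun k' => @fps_one R[i] m k' + fps_sub (partition_series P q W) (@fps_one R[i] m) k') = Z.
    by apply/funext => k'; rewrite /fps_sub addrC subrK.
  rewrite fps_exp_partition_series hornerZ horner_sum; congr (_ * _).
  by apply: eq_bigr => alpha _; rewrite hornerZ hornerXn.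
Qed.

(** Each star carries a factor [N] and so do each vertex, through its shape
    parameter, and each face, through the normalization of its trace, while each
    dart carries [N^-1] through the scale parameter; the exponent is Euler's
    characteristic [2 - 2 * g]. *)
Lemma genus_power (alpha : 'S_n) g : has_genus sigma alpha g ->
  N%:R ^- 2 * (N%:R ^+ mdeg k * (N%:R ^+ (#|porbits alpha| + #|faces alpha|) / N%:R ^+ n))
  = N%:R ^- (2 * g) :> R[i].
Proof.
rewrite /has_genus (card_porbits_block (stars_gt0 hq)) size_map size_stars -/(faces alpha).
move: #|porbits alpha| #|faces alpha| (mdeg k) => a f l /eqP h.
have e : (N%:R ^+ 2 * N%:R ^+ n : R[i]) = N%:R ^+ l * N%:R ^+ (a + f) * N%:R ^+ (2 * g).
  by rewrite -!exprD; congr (_ ^+ _); rewrite addnC -h; lia.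
have := expf_neq0 2 N0; have := expf_neq0 n N0; have := expf_neq0 (2 * g) N0.
move: e; move: (N%:R ^+ 2) (N%:R ^+ n) (N%:R ^+ (2 * g)) (N%:R ^+ l) (N%:R ^+ (a + f)) => x y w u v e nw ny nx.
have uv : u * v = x * y / w by rewrite e mulfK.
by rewrite [u * _]mulrA uv; field; rewrite nw ny nx.
Qed.

End Assembly.

Theorem theorem4p6 (R : realType) (d : measure_display) (T : measurableType d)
    (P : probability T R) (N s m : nat)
    (hN : (1 <= N)%N) (hs : (1 <= s)%N) (hm : (1 <= m)%N)
    (q : 'I_m -> seq 'I_s) (hq : forall j, (1 <= size (q j))%N)
    (C : 'I_s -> 'M[R[i]]_N) (lambda : 'I_s -> R)
    (W : 'I_s -> T -> 'M[R[i]]_N)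
    (hW : forall r, wishart P (N%:R^-1 *: C r) (N%:R * lambda r) (W r))
    (hind : mutually_independent P W) :
  fps_scale (N%:R ^- 2) (log_partition_series P q W)
  =1 fps_sum (fun g => fps_scale (N%:R ^- (2 * g)) (genus_series q lambda C g)).
Proof.
move=> k; rewrite /fps_scale.
have [k0|k_gt0] := posnP (mdeg k).
  rewrite (@fps_sum_finite _ _ _ k 0) => [|g _]; last by rewrite /genus_series k0 mulr0.
  rewrite big_ord0 /log_partition_series /fps_comp (@fps_sum_finite _ _ _ k 1) => [|n n0].
    by rewrite big_ord1 /fps_scale /fps_ln1p mul0r mulr0.
  rewrite /fps_scale fps_exp_small ?mulr0 ?k0//.
  rewrite /fps_sub (partition_series0 P q W) /fps_one.
  by rewrite (_ : mdeg _ == 0%N) ?subrr// mdeg0P.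
pose B := (nstars q k).+3.
rewrite (@fps_sum_finite _ _ _ k B) => [|g Bg]; last first.
  rewrite /genus_series k_gt0 /hypermap_sum hypermaps_large ?big_set0 ?mulr0//.
  by rewrite /B in Bg; lia.
have n_gt0 : (0 < nstars q k)%N.
  have := @card_porbits_block (shape (stars q k)) (stars_gt0 hq).
  rewrite size_map size_stars /nstars => e.
  rewrite lt0n; apply/eqP => n0; move: k_gt0; rewrite -e lt0n => /negP; apply.
  rewrite cards_eq0; apply/eqP/finset.setP => v; rewrite inE.
  by apply/negbTE/imsetP => -[[x lx]]; exfalso; move: lx; rewrite n0.
rewrite (log_partition_coef hN hq hW hind).
pose F (alpha : 'S_(nstars q k)) : R[i] := (\prod_r (lambda r)%:C ^+ #|vertices_of_color alpha r|)
      * \prod_(f in faces alpha) face_trace C alpha f.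
have gE g : N%:R ^- (2 * g) * genus_series q lambda C g k
    = \sum_(alpha : 'S_(nstars q k) | alpha \in hypermaps q k g)
        N%:R ^- (2 * g) * ((-1) ^+ mdeg k / (mfact k)%:R * F alpha).
  by rewrite /genus_series k_gt0 /hypermap_sum !mulr_sumr.
under [RHS]eq_bigr do rewrite gE big_mkcond.
rewrite exchange_big !mulr_sumr [LHS]big_mkcond; apply: eq_bigr => alpha _ /=.
rewrite -(hypermap_components _ n_gt0).
rewrite -big_mkcond.
case: ifP => [/andP[tal hyp]|no]; last first.
  rewrite big_pred0// => g; rewrite inE; apply/negbTE/negP => /and3P[h1 _ h2].
  by case/negP: no; rewrite h1 andbT.
have [g gP] := hypermap_genus n_gt0 hyp.
have gB : (g < B)%N.
  by rewrite ltnNge; apply/negP => Bg; move: gP; rewrite /has_genus /B in Bg *; lia.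
rewrite (big_pred1 (Ordinal gB)) => [|g']; last first.
  rewrite inE hyp tal andbT /= -val_eqE /=.
  apply/idP/eqP => [|->//]; move: gP; rewrite /has_genus; lia.
have tal' e : color (alpha e) = color e by apply/eqP; move/forallP: tal; exact.
rewrite (permutation_weight_faces hN C lambda tal').
rewrite -(genus_power R hN hq gP) -/(F alpha) exprNn.
move: (N%:R ^- 2) (N%:R ^+ mdeg k) (_ ^+ (#|_| + _) / _) ((-1) ^+ mdeg k) (mfact k)%:R^-1 (F alpha) => a b c e f h.
by ring.
Qed.
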